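(* Let $p,q,r$ be natural numbers, let $\mathcal M_{p,q}(\mathbb R)$ be the space of real $p\times q$ matrices with the Frobenius norm, let $\mathcal D_r\subset\mathcal M_{p,q}(\mathbb R)$ be the manifold of matrices of rank equal to $r$, and let $E\subset\mathcal M_{p,q}(\mathbb R)$ be an affine subspace, with $d=\dim(E)$. The algorithm NewtonSLRA (described in the context) computes a function $\varphi$ defined on an open neighborhood $U\supset\mathcal D_r$, and with codomain $E$, verifying the following property. Let $\zeta$ be in $E\cap\mathcal D_r$ such that $E$ and $\mathcal D_r$ intersect transversally at $\zeta$. There exist $\nu,\gamma,\gamma'>0$ such that, for all $M_0$ in $E\cap B_\nu(\zeta)$, the sequence $(M_i)$ given by $M_{i+1}=\varphi(M_i)$ is well defined and converges towards a matrix $M_\infty\in E\cap\mathcal D_r$, and 1. $\|M_{i+1}-M_\infty\|\le\gamma\,\|M_i-M_\infty\|^2$ for all $i\ge 0$; 2. $\|\Pi_{E\cap\mathcal D_r}(M_0)-M_\infty\|\le\gamma'\,\mathrm{dist}(M_0,E\cap\mathcal D_r)^2$. Moreover, the function $\varphi$ can be computed by means of a singular value decomposition of the input matrix $M$, plus $$O\big(\min\big(pqd(p-r)(q-r)+pqr,\ pqr(pq-d)(p+q-r)\big)\big)$$ arithmetic operations.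
   Context: $\mathcal M_{p,q}(\mathbb R)$ carries the inner product $\langle M_1,M_2\rangle=\mathrm{trace}(M_1M_2^{\intercal})$ and the norm $\|M\|=\sqrt{\langle M,M\rangle}$. $B_\rho(M)$ is the open ball of center $M$ and radius $\rho$. For an affine space $F$, $F^0$ denotes its underlying vector space. For a manifold $\mathcal V$ in a Euclidean space and $x\in\mathcal V$, $T_x\mathcal V=x+T_x\mathcal V^0$ is the affine tangent space at $x$, with underlying vector space $T_x\mathcal V^0$. For a set $S$, $\mathrm{dist}(M,S)$ is the distance from $M$ to $S$, and $\Pi_S(M)$ is the point of $S$ nearest to $M$. $E$ and $\mathcal D_r$ intersect transversally at $\zeta\in E\cap\mathcal D_r$ if $\mathrm{codim}(E^0\cap T_\zeta\mathcal D_r^0)=\mathrm{codim}(E^0)+\mathrm{codim}(T_\zeta\mathcal D_r^0)$. Cost model: arithmetic operations $+,-,\times,\div$ on real numbers are counted at unit cost; the cost of the singular value decomposition is counted separately. $A^\dagger$ denotes the Moore–Penrose pseudoinverse. One iteration of the algorithm NewtonSLRA on an input matrix $M\in E$ computes the projection $\widetilde M=\Pi_{\mathcal D_r}(M)$, then generators of the normal (or tangent) space to $\mathcal D_r$ at $\widetilde M$, then the point of $E\cap T_{\widetilde M}\mathcal D_r$ that minimizes the distance to $M$; the returned matrix is $\varphi(M)$. In detail, it computes a singular value decomposition $M=USV^{\intercal}$ ($U\in\mathcal M_{p,p}(\mathbb R)$ and $V\in\mathcal M_{q,q}(\mathbb R)$ orthogonal, $S$ diagonal with singular values in decreasing order),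 sets $\widetilde M=U_rS_rV_r^{\intercal}$, where $U_r,V_r$ consist of the first $r$ columns of $U,V$ and $S_r$ is the top-left $r\times r$ block of $S$, and then uses one of two variants. Variant NewtonSLRA/1, given an orthonormal basis $(E_1,\dots,E_d)$ of $E^0$: let $\widetilde u_1,\dots,\widetilde u_{p-r}$ be the last $p-r$ columns of $U$, $\widetilde v_1,\dots,\widetilde v_{q-r}$ the last $q-r$ columns of $V$, $N_{(i-1)(q-r)+j}=\widetilde u_i\widetilde v_j^{\intercal}$, $A=(\langle N_k,E_\ell\rangle)_{k,\ell}$, $b=(\langle N_k,\widetilde M-M\rangle)_k$; return $M+\sum_{\ell=1}^d(A^\dagger b)_\ell E_\ell$. Variant NewtonSLRA/2, given an orthonormal basis $(E'_1,\dots,E'_{pq-d})$ of $(E^0)^\perp$: let $u_i,v_j$ be the columns of $U,V$, let $(T_\ell)_{1\le\ell\le(p+q-r)r}$ be the list of all matrices $u_iv_j^{\intercal}$ with $i\le r$ or $j\le r$, $A'=(\langle E'_k,T_\ell\rangle)_{k,\ell}$, $b'=(\langle E'_k,M-\widetilde M\rangle)_k$; return $\widetilde M+\sum_{\ell=1}^{(p+q-r)r}(A'^\dagger b')_\ell T_\ell$.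
   Formalization: When E is the whole matrix space (d = pq) the printed operation bound equals 0, which is false (e.g. p = q = 2, r = 1); in that case only, the bound is replaced by its first term pqd(p−r)(q−r)+pqr. *)

(* Defs.v *)
From mathcomp Require Import all_boot all_order all_algebra.
From mathcomp Require Import all_classical all_reals all_analysis.

Set Implicit Arguments.
Unset Strict Implicit.
Unset Printing Implicit Defensive.

Import Order.TTheory GRing.Theory Num.Theory numFieldNormedType.Exports.

Local Open Scope classical_set_scope.
Local Open Scope ring_scope.

Section Geometry.
Variables (R : realType) (p q : nat).
Implicit Types (M X Y : 'M[R]_(p, q)) (S : set 'M[R]_(p, q)).
Implicit Types (W : {vspace 'M[R]_(p, q)}).

Definition frob M1 M2 : R := \tr (M1 *m M2^T).

(* The library norm `|M| on matrices is the sup norm.  Open sets and limits are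
   unaffected by the choice of norm, so the library topology is used for them. *)
Definition fnorm M : R := Num.sqrt (frob M M).

Definition fball M (rho : R) : set 'M[R]_(p, q) :=
  [set Y | fnorm (M - Y) < rho].

Definition fdist M S : R := inf [set fnorm (M - Y) | Y in S].

(* X = Pi_S(M), including the fact that the nearest point exists and is
   unique. *)
Definition is_proj S M X : Prop :=
  S X /\ forall Y, S Y -> Y <> X -> fnorm (M - X) < fnorm (M - Y).

Definition rank_manifold (r : nat) : set 'M[R]_(p, q) :=
  [set M | \rank M = r].

Definition affine_space (a : 'M[R]_(p, q)) W : set 'M[R]_(p, q) :=
  [set M | M - a \in W].

(* T_x S ^0 as the set of velocities at x of smooth curves in S.  The curve is
   smooth on the whole line but is only required to stay in S near 0: every germ
   of smooth curve has such an extension. *)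
Definition tangent_vec S x : set 'M[R]_(p, q) :=
  [set X | exists gamma : R -> 'M[R]_(p, q),
    [/\ forall n t, derivable (derive1n n gamma) t 1,
        \forall t \near (0 : R), S (gamma t),
        gamma 0 = x
      & derive1 gamma 0 = X]].

Definition tangent_affine S x : set 'M[R]_(p, q) :=
  [set Y | tangent_vec S x (Y - x)].

Definition codimv W : nat := (\dim {:'M[R]_(p, q)} - \dim W)%N.

Definition transversal_at W S x : Prop :=
  exists2 T : {vspace 'M[R]_(p, q)},
    (forall X, X \in T <-> tangent_vec S x X)
    & codimv (W :&: T)%VS = (codimv W + codimv T)%N.

Definition orth_compl W : set 'M[R]_(p, q) :=
  [set X | forall Y, Y \in W -> frob X Y = 0].

Definition is_onb n S (e : n.-tuple 'M[R]_(p, q)) : Prop :=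
  (forall k l, frob (tnth e k) (tnth e l) = (k == l)%:R)
  /\ (forall X, X \in <<e>>%VS <-> S X).

End Geometry.

Section PseudoInverse.
Variables (R : realType) (m n : nat).

Definition penrose (A : 'M[R]_(m, n)) (X : 'M[R]_(n, m)) : Prop :=
  [/\ A *m X *m A = A, X *m A *m X = X,
      (A *m X)^T = A *m X & (X *m A)^T = X *m A].

(* The matrix characterized by the four Penrose equations, which have exactly
   one solution. *)
Definition mp_pinv (A : 'M[R]_(m, n)) : 'M[R]_(n, m) :=
  xget 0 [set X | penrose A X].

End PseudoInverse.

Section Algorithm.
Variables (R : realType) (p q r : nat).
Implicit Types (M S : 'M[R]_(p, q)) (U : 'M[R]_p) (V : 'M[R]_q).

Definition is_svd M U S V : Prop :=
  [/\ M = U *m S *m V^T,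
      U^T *m U = 1%:M, V^T *m V = 1%:M,
      is_diag_mx S
    & (forall i j, 0 <= S i j) /\
      (forall (i i' : 'I_p) (j j' : 'I_q), i = j :> nat -> i' = j' :> nat -> (i <= i')%N ->
        S i' j' <= S i j)].

(* U_r S_r V_r ^T; multiplying by pid_mx r extracts the first r columns or
   rows. *)
Definition svd_trunc U S V : 'M[R]_(p, q) :=
  let Ur := U *m (pid_mx r : 'M[R]_(p, r)) in
  let Vr := V *m (pid_mx r : 'M[R]_(q, r)) in
  let Sr := (pid_mx r : 'M[R]_(r, p)) *m S *m (pid_mx r : 'M[R]_(q, r)) in
  Ur *m Sr *m Vr^T.

Definition outer U V (ij : 'I_p * 'I_q) : 'M[R]_(p, q) :=
  col ij.1 U *m (col ij.2 V)^T.

(* Indices are 0-based.  Pairs are enumerated in row-major order, so that the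
   normal generators N_k come out in the order k = i (q - r) + j. *)
Definition normal_idx : {set 'I_p * 'I_q} :=
  finset (fun ij : 'I_p * 'I_q => (r <= ij.1)%N && (r <= ij.2)%N).

Definition tangent_idx : {set 'I_p * 'I_q} :=
  finset (fun ij : 'I_p * 'I_q => (ij.1 < r)%N || (ij.2 < r)%N).

Definition newtonSLRA1 d M U S V (E : d.-tuple 'M[R]_(p, q)) : 'M[R]_(p, q) :=
  let Mt := svd_trunc U S V in
  let N (k : 'I_#|normal_idx|) := outer U V (enum_val k) in
  let A := \matrix_(k < #|normal_idx|, l < d) frob (N k) (tnth E l) in
  let b := \col_(k < #|normal_idx|) frob (N k) (Mt - M) in
  M + \sum_(l < d) (mp_pinv A *m b) l 0 *: tnth E l.

Definition newtonSLRA2 n M U S V (F : n.-tuple 'M[R]_(p, q)) : 'M[R]_(p, q) :=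
  let Mt := svd_trunc U S V in
  let T (l : 'I_#|tangent_idx|) := outer U V (enum_val l) in
  let A := \matrix_(k < n, l < #|tangent_idx|) frob (tnth F k) (T l) in
  let b := \col_(k < n) frob (tnth F k) (M - Mt) in
  Mt + \sum_(l < #|tangent_idx|) (mp_pinv A *m b) l 0 *: T l.

End Algorithm.

(* Algebraic computation trees over the reals: inputs are indexed by I and read
   only, outputs are indexed by O, and there is one register for each natural
   number, initially 0.  Only the operations + - * / are counted; the
   comparisons used for branching are not. *)
Variant arith_op := OpAdd | OpSub | OpMul | OpDiv.

Inductive operand (I : Type) :=
  | Inp of I
  | Reg of nat
  | Cst of int.

Inductive actree (I O : Type) :=
  | Output of (O -> operand I)
  (* Arith op k x y t: put x op y in register k, then run t *)
  | Arith of arith_op & nat & operand I & operand I & actree I O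
  (* Branch x y t1 t2: run t1 if x <= y, and t2 otherwise *)
  | Branch of operand I & operand I & actree I O & actree I O.

Fixpoint op_count I O (t : actree I O) : nat :=
  match t with
  | Output _ => 0
  | Arith _ _ _ _ t' => (op_count t').+1
  | Branch _ _ t1 t2 => maxn (op_count t1) (op_count t2)
  end.

Section Run.
Variables (R : realType) (I O : Type) (inp : I -> R).

Definition eval_operand (s : nat -> R) (x : operand I) : R :=
  match x with
  | Inp i => inp i
  | Reg k => s k
  | Cst z => z%:~R
  end.

(* x / 0 = 0 here; divisors can be tested beforehand at no cost. *)
Definition eval_op (o : arith_op) (x y : R) : R :=
  match o with
  | OpAdd => x + y
  | OpSub => x - y
  | OpMul => x * y
  | OpDiv => x / y
  end.

Fixpoint run_from (s : nat -> R) (t : actree I O) : O -> R :=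
  match t with
  | Output out => fun o => eval_operand s (out o)
  | Arith o k x y t' =>
      let v := eval_op o (eval_operand s x) (eval_operand s y) in
      run_from (fun n => if n == k then v else s n) t'
  | Branch x y t1 t2 =>
      if eval_operand s x <= eval_operand s y
      then run_from s t1 else run_from s t2
  end.

Definition run : actree I O -> O -> R := run_from (fun=> 0).

End Run.

(* The entries of M, of the factors U, S, V of a singular value decomposition of
   M, and of orthonormal bases of E^0 and of its orthogonal complement. *)
Inductive slra_input (p q d : nat) :=
  | InM of 'I_p & 'I_q
  | InU of 'I_p & 'I_p
  | InS of 'I_p & 'I_q
  | InV of 'I_q & 'I_q
  | InE of 'I_d & 'I_p & 'I_q
  | InF of 'I_(p * q - d) & 'I_p & 'I_q.

Definition slra_input_val (R : realType) p q d (M : 'M[R]_(p, q)) (U : 'M[R]_p)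
    (S : 'M[R]_(p, q)) (V : 'M[R]_q) (E : d.-tuple 'M[R]_(p, q))
    (F : (p * q - d).-tuple 'M[R]_(p, q)) (x : slra_input p q d) : R :=
  match x with
  | InM i j => M i j
  | InU i j => U i j
  | InS i j => S i j
  | InV i j => V i j
  | InE k i j => tnth E k i j
  | InF k i j => tnth F k i j
  end.

(* When E is the whole space (d = p q) the second expression is 0 although
   Pi_{D_r}(M) must still be formed from the singular value decomposition, so
   there only the first one can serve as a bound. *)
Definition slra_ops (p q r d : nat) : nat :=
  let c1 := (p * q * d * (p - r) * (q - r) + p * q * r)%N in
  let c2 := (p * q * r * (p * q - d) * (p + q - r))%N in
  if d == (p * q)%N then c1 else minn c1 c2.

(* E meets the affine tangent space to S at Pi_S(M): the set over which the
   Newton step from M minimizes the distance to M is not empty. *)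
Definition newton_step_defined (R : realType) p q (E S : set 'M[R]_(p, q))
    (M : 'M[R]_(p, q)) : Prop :=
  exists2 Mt, is_proj S M Mt & E `&` tangent_affine S Mt !=set0.

(* Main.v *)
Require Import Defs.

(* The map phi has to exist at every M near D_r, also where M lies outside E or E misses the tangent
   space. It is therefore defined by equations instead of by a minimum: these have exactly one
   solution in all cases, and the agreement of phi with either variant and with the program is each
   time an appeal to that uniqueness.

   Near zeta, E /\ D_r is known only through its equations. The points with which a nearest point of
   E /\ D_r is compared come from the iteration itself: it moves a point of E to a point of E /\ D_r
   at a distance comparable to the distance to D_r. One constant K bounds both |x^+|, that is the
   curvature of D_r, and the transversality constant; all radii are explicit in K.

   The operation bound is 0 when r = 0 and d < p q. The program must then answer without computing,
   which is possible when 0 is in E since the step then returns 0; if 0 is not in E, the domain is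
   cut down so that it contains no point of E. *)
From HB Require Import structures.
From mathcomp Require Import all_boot all_order all_algebra.
From mathcomp Require Import all_classical all_reals all_analysis.
From mathcomp Require Import zify ring lra.

Set Implicit Arguments.
Unset Strict Implicit.
Unset Printing Implicit Defensive.
Import Order.TTheory GRing.Theory Num.Theory numFieldNormedType.Exports.
Local Open Scope classical_set_scope.
Local Open Scope ring_scope.

(**
For x in D_r let P = x x^+ and Q = x^+ x; the tangent space to D_r at x is the kernel of
N_x(X) = (1 - P) X (1 - Q).  Three estimates, valid near zeta with a uniform bound on x^+, carry the
analysis: N_x (y - x) = O(|y - x|^2) for y in D_r; x + v is within O(|v|^2) of D_r for v tangent at x;
and N_y w = O(|x - y| |w|) for w tangent at x.  Transversality at zeta gives, near zeta, a constant
kappa with dist(v, E^0 /\ T_x) <= kappa |N_x v| for all v in E^0.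

With e_i = |M_i - Pi(M_i)| one gets |M_(i+1) - M_i| <= kappa e_i and e_(i+1) = O(e_i^2), hence the
convergence and (1).  The limits of the iteration started at points X + t w, with w in E^0 /\ T_X, are
points of E /\ D_r at distance O(t^2) from X + t w; this gives the first order condition at a point X
of E /\ D_r nearest to M_0, then its uniqueness, and finally (2) by comparing M_1 with X.

Both variants of the algorithm solve the normal equations of the Newton step.  This remains true of
the second one when E misses the tangent space, once its output is projected orthogonally onto E; so
either variant can be run.  Pseudoinverses are computed column by column by Greville's method, which
for an m x n matrix costs O(m n^2) operations.
*)

(** * The Frobenius inner product *)

Section Frobenius.
Variable R : realType.
Implicit Types m n k : nat.

Lemma frobE m n (A B : 'M[R]_(m, n)) :
  frob A B = \sum_i \sum_j A i j * B i j.
Proof.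
apply: eq_bigr => i _; rewrite mxE; apply: eq_bigr => j _.
by rewrite mxE.
Qed.

Lemma frobC m n (A B : 'M[R]_(m, n)) : frob A B = frob B A.
Proof.
by rewrite !frobE; apply: eq_bigr => i _; apply: eq_bigr => j _; rewrite mulrC.
Qed.

Lemma frobDl m n (A B C : 'M[R]_(m, n)) : frob (A + B) C = frob A C + frob B C.
Proof. by rewrite /frob mulmxDl mxtraceD. Qed.

Lemma frobDr m n (A B C : 'M[R]_(m, n)) : frob A (B + C) = frob A B + frob A C.
Proof. by rewrite frobC frobDl !(frobC A). Qed.

Lemma frobNl m n (A B : 'M[R]_(m, n)) : frob (- A) B = - frob A B.
Proof. by rewrite /frob mulNmx linearN. Qed.

Lemma frobNr m n (A B : 'M[R]_(m, n)) : frob A (- B) = - frob A B.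
Proof. by rewrite frobC frobNl frobC. Qed.

Lemma frobBl m n (A B C : 'M[R]_(m, n)) : frob (A - B) C = frob A C - frob B C.
Proof. by rewrite frobDl frobNl. Qed.

Lemma frobBr m n (A B C : 'M[R]_(m, n)) : frob A (B - C) = frob A B - frob A C.
Proof. by rewrite frobDr frobNr. Qed.

Lemma frobZl m n c (A B : 'M[R]_(m, n)) : frob (c *: A) B = c * frob A B.
Proof. by rewrite /frob -scalemxAl mxtraceZ. Qed.

Lemma frobZr m n c (A B : 'M[R]_(m, n)) : frob A (c *: B) = c * frob A B.
Proof. by rewrite frobC frobZl frobC. Qed.

Lemma frob0l m n (B : 'M[R]_(m, n)) : frob 0 B = 0.
Proof. by rewrite /frob mul0mx mxtrace0. Qed.

Lemma frob0r m n (B : 'M[R]_(m, n)) : frob B 0 = 0.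
Proof. by rewrite frobC frob0l. Qed.

Lemma frob_suml m n (I : Type) (s : seq I) (P : pred I) (F : I -> 'M[R]_(m, n))
  (B : 'M[R]_(m, n)) :
  frob (\sum_(i <- s | P i) F i) B = \sum_(i <- s | P i) frob (F i) B.
Proof.
by apply: (big_morph (fun X => frob X B)) => [X Y|]; rewrite ?frobDl ?frob0l.
Qed.

Lemma frob_sumr m n (I : Type) (s : seq I) (P : pred I) (F : I -> 'M[R]_(m, n))
  (B : 'M[R]_(m, n)) :
  frob B (\sum_(i <- s | P i) F i) = \sum_(i <- s | P i) frob B (F i).
Proof. by rewrite frobC frob_suml; apply: eq_bigr => i _; rewrite frobC. Qed.

Lemma frob_mull m n k (A : 'M[R]_(m, k)) (B : 'M[R]_(k, n)) C :
  frob (A *m B) C = frob B (A^T *m C).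
Proof. by rewrite /frob trmx_mul trmxK mulmxA -mulmxA mxtrace_mulC. Qed.

Lemma frob_mulr m n k (A : 'M[R]_(m, k)) (B : 'M[R]_(k, n)) C :
  frob (A *m B) C = frob A (C *m B^T).
Proof. by rewrite /frob trmx_mul trmxK mulmxA. Qed.

Lemma frob_tr m n (A B : 'M[R]_(m, n)) : frob A^T B^T = frob A B.
Proof. by rewrite /frob trmxK -mxtrace_tr trmx_mul trmxK mxtrace_mulC. Qed.

Lemma frob_ge0 m n (A : 'M[R]_(m, n)) : 0 <= frob A A.
Proof.
by rewrite frobE; do 2 (apply: sumr_ge0 => ? _); rewrite -expr2 sqr_ge0.
Qed.

Lemma frob_eq0 m n (A : 'M[R]_(m, n)) : frob A A = 0 -> A = 0.
Proof.
rewrite frobE pair_big /= => /eqP.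
rewrite psumr_eq0 => [/allP h|? _]; last by rewrite -expr2 sqr_ge0.
apply/matrixP => i j; rewrite mxE.
have := h (i, j); rewrite mem_index_enum /= => /(_ isT).
by rewrite mulf_eq0 orbb => /eqP.
Qed.

Lemma fnorm_ge0 m n (A : 'M[R]_(m, n)) : 0 <= fnorm A.
Proof. exact: sqrtr_ge0. Qed.

Lemma sqr_fnorm m n (A : 'M[R]_(m, n)) : fnorm A ^+ 2 = frob A A.
Proof. by rewrite /fnorm sqr_sqrtr ?frob_ge0. Qed.

Lemma fnorm0 m n : fnorm (0 : 'M[R]_(m, n)) = 0.
Proof. by rewrite /fnorm frob0l sqrtr0. Qed.

Lemma fnorm_eq0 m n (A : 'M[R]_(m, n)) : fnorm A = 0 -> A = 0.
Proof. by move=> h; apply: frob_eq0; rewrite -sqr_fnorm h expr0n. Qed.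

Lemma fnorm_gt0 m n (A : 'M[R]_(m, n)) : A <> 0 -> 0 < fnorm A.
Proof.
by move=> A0; rewrite lt0r fnorm_ge0 andbT; apply/eqP => /fnorm_eq0.
Qed.

Lemma fnorm_le m n k l (A : 'M[R]_(m, n)) (B : 'M[R]_(k, l)) :
  (fnorm A <= fnorm B) = (frob A A <= frob B B).
Proof. by rewrite /fnorm ler_sqrt // frob_ge0. Qed.

Lemma frobDD m n (A B : 'M[R]_(m, n)) :
  frob (A + B) (A + B) = frob A A + 2 * frob A B + frob B B.
Proof. rewrite !frobDl !frobDr (frobC B A); ring. Qed.

Lemma frobBB m n (A B : 'M[R]_(m, n)) :
  frob (A - B) (A - B) = frob A A - 2 * frob A B + frob B B.
Proof. rewrite frobDD frobNr frobNl frobNr; ring. Qed.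

Lemma frob_CS m n (A B : 'M[R]_(m, n)) : frob A B <= fnorm A * fnorm B.
Proof.
have [->|B0] := eqVneq B 0; first by rewrite frob0r fnorm0 mulr0.
have Bp : 0 < fnorm B by apply: fnorm_gt0; apply/eqP.
(* This matrix is |B|^2 times the component of A orthogonal to B; expanding its square gives the
   inequality multiplied by |B|^2. *)
have := frob_ge0 (fnorm B ^+ 2 *: A - frob A B *: B).
rewrite frobBB !frobZl !frobZr -!sqr_fnorm => h.
have : frob A B ^+ 2 <= (fnorm A * fnorm B) ^+ 2.
  have B2 : 0 < fnorm B ^+ 2 by rewrite exprn_gt0.
  rewrite -(ler_pM2l B2) exprMn; nra.
have [/le_trans ab|ab] := leP (frob A B) 0.
  by move=> _; apply: ab; rewrite mulr_ge0 ?fnorm_ge0.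
by rewrite ler_pXn2r ?nnegrE ?mulr_ge0 ?fnorm_ge0 // ltW.
Qed.

Lemma frob_abs m n (A B : 'M[R]_(m, n)) : `|frob A B| <= fnorm A * fnorm B.
Proof.
have h (X : 'M[R]_(m, n)) : fnorm (- X) = fnorm X.
  by rewrite /fnorm frobNl frobNr opprK.
by rewrite ler_norml frob_CS andbT lerNl -frobNl -(h A) frob_CS.
Qed.

Lemma fnormN m n (A : 'M[R]_(m, n)) : fnorm (- A) = fnorm A.
Proof. by rewrite /fnorm frobNl frobNr opprK. Qed.

Lemma fnormB m n (A B : 'M[R]_(m, n)) : fnorm (A - B) = fnorm (B - A).
Proof. by rewrite -fnormN opprB. Qed.

Lemma fnormZ m n c (A : 'M[R]_(m, n)) : fnorm (c *: A) = `|c| * fnorm A.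
Proof.
by rewrite /fnorm frobZl frobZr mulrA -expr2 sqrtrM ?sqr_ge0 // sqrtr_sqr.
Qed.

Lemma fnormT m n (A : 'M[R]_(m, n)) : fnorm A^T = fnorm A.
Proof. by rewrite /fnorm frob_tr. Qed.

Lemma fnormD m n (A B : 'M[R]_(m, n)) : fnorm (A + B) <= fnorm A + fnorm B.
Proof.
rewrite -(@ler_pXn2r _ 2) ?nnegrE ?addr_ge0 ?fnorm_ge0 //.
rewrite sqr_fnorm frobDD -!sqr_fnorm sqrrD.
by have := frob_CS A B; lra.
Qed.

Lemma fnormD_le m n (A B : 'M[R]_(m, n)) a b :
  fnorm A <= a -> fnorm B <= b -> fnorm (A + B) <= a + b.
Proof. by move=> ha hb; apply: le_trans (fnormD _ _) (lerD ha hb). Qed.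

Lemma fnorm_tri m n (C A B : 'M[R]_(m, n)) :
  fnorm (A - B) <= fnorm (A - C) + fnorm (C - B).
Proof. by rewrite -[A - B](subrKA C) fnormD. Qed.

Lemma fnorm_sum m n (I : Type) (s : seq I) (P : pred I) (F : I -> 'M[R]_(m, n)) :
  fnorm (\sum_(i <- s | P i) F i) <= \sum_(i <- s | P i) fnorm (F i).
Proof.
elim/big_rec2: _ => [|i y x _ h]; first by rewrite fnorm0.
by apply: le_trans (fnormD _ _) _; rewrite lerD2l.
Qed.

Lemma frob_rows m n (A B : 'M[R]_(m, n)) :
  frob A B = \sum_i frob (row i A) (row i B).
Proof.
rewrite frobE; apply: eq_bigr => i _; rewrite frobE big_ord1.
by apply: eq_bigr => j _; rewrite !mxE.
Qed.

Lemma fnormM m n k (A : 'M[R]_(m, k)) (B : 'M[R]_(k, n)) :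
  fnorm (A *m B) <= fnorm A * fnorm B.
Proof.
rewrite -(@ler_pXn2r _ 2) ?nnegrE ?mulr_ge0 ?fnorm_ge0 //.
rewrite exprMn !sqr_fnorm (frob_rows A A) -[frob B B]frob_tr.
rewrite (frob_rows B^T B^T) frobE mulr_suml; apply: ler_sum => i _.
rewrite mulr_sumr; apply: ler_sum => j _.
have -> : (A *m B) i j = frob (row i A) (row j B^T).
  rewrite frobE big_ord1 mxE; apply: eq_bigr => l _; by rewrite !mxE.
rewrite -expr2 -!sqr_fnorm -exprMn -ler_sqrt ?exprn_ge0 ?mulr_ge0 ?fnorm_ge0 //.
by rewrite !sqrtr_sqr (ger0_norm (mulr_ge0 _ _)) ?fnorm_ge0 // frob_abs.
Qed.

Lemma fnormM3 m n k l (A : 'M[R]_(m, k)) (B : 'M[R]_(k, l)) (C : 'M[R]_(l, n)) :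
  fnorm (A *m B *m C) <= fnorm A * fnorm B * fnorm C.
Proof. by apply: le_trans (fnormM _ _) _; rewrite ler_wpM2r ?fnorm_ge0 ?fnormM. Qed.

(** Orthogonal projections of R^m, acting on matrices by multiplication. The projection of the
    matrix space onto a subspace is [oproj], further down. *)
Definition oproj_mx m (P : 'M[R]_m) := P^T = P /\ P *m P = P.

Lemma oproj_mxC m (P : 'M[R]_m) : oproj_mx P -> oproj_mx (1%:M - P).
Proof.
move=> [s i]; split; first by rewrite linearB /= trmx1 s.
by rewrite mulmxBl !mulmxBr !mul1mx mulmx1 i subrr subr0.
Qed.

Lemma frob_oproj_mx m n (P : 'M[R]_m) (A : 'M[R]_(m, n)) : oproj_mx P ->
  frob A A = frob (P *m A) (P *m A) + frob (A - P *m A) (A - P *m A).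
Proof.
move=> [s i]; have e : frob A (P *m A) = frob (P *m A) (P *m A).
  by rewrite [RHS]frob_mull s mulmxA i.
rewrite frobBB e; ring.
Qed.

Lemma fnorm_oproj_mxl m n (P : 'M[R]_m) (A : 'M[R]_(m, n)) : oproj_mx P ->
  fnorm (P *m A) <= fnorm A.
Proof.
move=> hP; rewrite fnorm_le (frob_oproj_mx A hP).
by have := frob_ge0 (A - P *m A); lra.
Qed.

Lemma fnorm_oproj_mxr m n (P : 'M[R]_n) (A : 'M[R]_(m, n)) : oproj_mx P ->
  fnorm (A *m P) <= fnorm A.
Proof.
move=> hP; rewrite -fnormT trmx_mul; rewrite -[leRHS]fnormT.
by case: (hP) => -> _; apply: fnorm_oproj_mxl.
Qed.

Lemma fnorm_entry m n (A : 'M[R]_(m, n)) i j : `|A i j| <= fnorm A.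
Proof.
rewrite -(@ler_pXn2r _ 2) ?nnegrE ?fnorm_ge0 // sqr_fnorm frobE.
rewrite real_normK ?num_real // (bigD1 i) //= (bigD1 j) //= expr2 -addrA lerDl.
rewrite addr_ge0 //; repeat (apply: sumr_ge0 => ? _); by rewrite -expr2 sqr_ge0.
Qed.

Lemma norm_le_fnorm m n (A : 'M[R]_(m, n)) : `|A| <= fnorm A.
Proof.
have [->|] := eqVneq `|A| 0; first exact: fnorm_ge0.
by move=> /mx_norm_neq0[ij]; rewrite /Num.norm /= => ->; exact: fnorm_entry.
Qed.

Lemma norm_entry m n (A : 'M[R]_(m, n)) i j : `|A i j| <= `|A|.
Proof.
rewrite [leRHS]mx_normrE.
exact: (le_bigmax _ (fun ij : 'I_m * 'I_n => `|A ij.1 ij.2|) (i, j)).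
Qed.

Lemma fnorm_le_norm m n (A : 'M[R]_(m, n)) : fnorm A <= (m * n)%:R * `|A|.
Proof.
rewrite [A in fnorm A]matrix_sum_delta pair_big /=.
apply: le_trans (fnorm_sum _ _ _) _.
have -> : (m * n)%:R * `|A| = \sum_(p : 'I_m * 'I_n) `|A|.
  by rewrite sumr_const card_prod !card_ord mulr_natl.
apply: ler_sum => -[i j] _ /=; rewrite fnormZ.
suff -> : fnorm (delta_mx i j : 'M[R]_(m,n)) = 1 by rewrite mulr1 norm_entry.
rewrite /fnorm frobE (bigD1 i) //= (bigD1 j) //= !mxE !eqxx /= mulr1.
rewrite big1 ?addr0 => [|k kn]; last by rewrite !mxE (negbTE kn) andbF mulr0.
rewrite big1 ?addr0 ?sqrtr1 // => k kn.
by apply: big1 => l _; rewrite !mxE (negbTE kn) mulr0.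
Qed.

End Frobenius.

(** * Pseudoinverses *)

Section Pseudoinverse.
Variable R : realType.
Implicit Types m n k : nat.

(** A X and A Y are both the orthogonal projection onto the columns of A, and X A, Y A both the one
    onto its rows. Hence X = X A X = X A Y = Y A Y = Y. *)
Lemma penrose_uniq m n (A : 'M[R]_(m, n)) X Y :
  penrose A X -> penrose A Y -> X = Y.
Proof.
move=> [x1 x2 x3 x4] [y1 y2 y3 y4].
have e1 : A *m X = A *m Y.
  rewrite -x3 -{1}y1 -mulmxA trmx_mul x3 y3.
  by rewrite !mulmxA x1.
have e2 : X *m A = Y *m A.
  rewrite -x4 -{1}y1 -(mulmxA A) mulmxA trmx_mul x4 y4.
  by rewrite -!mulmxA (mulmxA A X) x1.
by rewrite -x2 -mulmxA e1 mulmxA e2 y2.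
Qed.

(* The row to append to B = A^+ when the column a is appended to A.  Since 0^-1 = 0, the factor
   1 - s / s is 1 when c = 0 and 0 otherwise, which selects the right case without branching. *)
Definition greville_row m n (B : 'M[R]_(n, m)) (A : 'M[R]_(m, n)) (a : 'cV[R]_m) : 'rV[R]_m :=
  let d := B *m a in
  let c := a - A *m d in
  let s := (c^T *m c) 0 0 in
  let t := (d^T *m d) 0 0 in
  s^-1 *: c^T + ((1 - s / s) / (1 + t)) *: (d^T *m B).

Definition greville_step m n (B : 'M[R]_(n, m)) (A : 'M[R]_(m, n)) (a : 'cV[R]_m) : 'M[R]_(n + 1, m) :=
  let b := greville_row B A a in
  col_mx (B - B *m a *m b) b.

Lemma tr_mx11 (x : 'M[R]_1) : x^T = x.
Proof. by rewrite [x]mx11_scalar tr_scalar_mx. Qed.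

(** The residual c of a is orthogonal to the columns of A, so c^T A = 0 and B c = 0, and all four
    equations reduce to the values of b A and b a. If c = 0, the column projection stays A B.
    Otherwise b A = 0 and b a = 1, and the column projection gains the term c b = c c^T / s. *)
Lemma greville_penrose m n (A : 'M[R]_(m, n)) (B : 'M[R]_(n, m)) a :
  penrose A B -> penrose (row_mx A a) (greville_step B A a).
Proof.
move=> [h1 h2 h3 h4].
rewrite /greville_step /greville_row.
set d := B *m a; set c := a - A *m d; set s : R := (c^T *m c) 0 0.
set t : R := (d^T *m d) 0 0.
have cA : c^T *m A = 0.
  rewrite /c /d linearB /= mulmxBl !trmx_mul -!mulmxA.
  rewrite (mulmxA B^T) -trmx_mul h3 !mulmxA.
  by rewrite -(mulmxA _ _ B) -(mulmxA _ _ A) h1 subrr.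
have Bc : B *m c = 0 by rewrite /c mulmxBr /d !mulmxA h2 subrr.
have cBT : c^T *m B^T = 0 by rewrite -trmx_mul Bc trmx0.
have BAd : B *m A *m d = d by rewrite /d !mulmxA h2.
have ae : a = A *m d + c by rewrite /c addrC subrK.
have sE : c^T *m c = s%:M by rewrite [LHS]mx11_scalar.
have tE : d^T *m d = t%:M by rewrite [LHS]mx11_scalar.
have t0 : 1 + t != 0.
  have : 0 <= t by rewrite /t mxE; apply: sumr_ge0 => i _; rewrite mxE -expr2 sqr_ge0.
  by move=> h; apply/eqP; lra.
have ca : c^T *m a = s%:M by rewrite ae mulmxDr mulmxA cA mul0mx add0r.
have dE : B *m a = d by [].
clearbody t s c d.
have [s0|s0] := eqVneq s 0.
  have c0 : c = 0.
    by apply: frob_eq0; rewrite -[frob c c]frob_tr /frob trmxK sE s0 mxtrace_scalar mul0rn.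
  rewrite s0 invr0 scale0r add0r mulr0 subr0 mul1r.
  set b := _ *: _.
  have aE : a = A *m d by rewrite ae c0 addr0.
  have bA : b *m A = (1 + t)^-1 *: d^T.
    rewrite /b -scalemxAl; congr (_ *: _).
    by rewrite -[in RHS]BAd trmx_mul h4 mulmxA.
  have bad : b *m A *m d = ((1 + t)^-1 * t)%:M.
    by rewrite bA -scalemxAl tE scale_scalar_mx.
  have ba : b *m a = ((1 + t)^-1 * t)%:M by rewrite aE mulmxA bad.
  have AA : row_mx A a *m col_mx (B - d *m b) b = A *m B.
    by rewrite mul_row_col mulmxBr aE mulmxA subrK.
  have bAB : b *m A *m B = b.
    by rewrite /b -!scalemxAl -!mulmxA (mulmxA B) h2.
  have e : (b *m A)^T = (B - d *m b) *m a.
    rewrite mulmxBl dE bA -mulmxA ba linearZ /= trmxK.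
    rewrite -scalemx1 -scalemxAr mulmx1 -[d in RHS]scale1r.
    rewrite [1 *: d - _](_ : _ = (1 - (1 + t)^-1 * t) *: d); last first.
      by rewrite scalerBl !scale1r.
    by congr (_ *: _); rewrite -[X in _ = X - _](mulVf t0) -mulrBr addrK mulr1.
  split.
  - rewrite AA mul_mx_row h1; congr row_mx.
    by rewrite aE mulmxA h1.
  - rewrite -mulmxA AA mul_col_mx; congr col_mx; last by rewrite mulmxA bAB.
    by rewrite mulmxBl (mulmxA B) h2 -(mulmxA d) (mulmxA b) bAB.
  - by rewrite AA h3.
  - rewrite mul_col_row tr_block_mx ; congr block_mx.
    + rewrite mulmxBl !linearB /= h4 -mulmxA bA -scalemxAr linearZ /=.
      by rewrite trmx_mul trmxK.
    + exact: e.
    + by rewrite -e trmxK.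
    + exact: tr_mx11.
rewrite divff // subrr mul0r scale0r addr0.
set b := _ *: _.
have bA : b *m A = 0 by rewrite /b -scalemxAl cA scaler0.
have ba : b *m a = 1%:M by rewrite /b -scalemxAl ca scale_scalar_mx mulVf.
have AA : row_mx A a *m col_mx (B - d *m b) b = A *m B + c *m b.
  rewrite mul_row_col mulmxBr mulmxA ae mulmxDl.
  by rewrite addrA subrK.
have bAB : b *m (A *m B) = 0 by rewrite mulmxA bA mul0mx.
have bcb : b *m c = 1%:M by rewrite /b -scalemxAl sE scale_scalar_mx mulVf.
split.
- rewrite AA mul_mx_row mulmxDl h1 -(mulmxA c) bA mulmx0 addr0; congr row_mx.
  by rewrite mulmxDl -(mulmxA c) ba mulmx1 -mulmxA dE -ae.
- rewrite -mulmxA AA mul_col_mx; congr col_mx.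
    rewrite mulmxDr !mulmxBl mulmxA h2 -(mulmxA d b (A *m B)) bAB mulmx0 subr0.
    rewrite mulmxA Bc mul0mx sub0r.
    by rewrite mulmxA -(mulmxA d b c) bcb mulmx1.
  by rewrite mulmxDr bAB add0r mulmxA bcb mul1mx.
- by rewrite AA linearD /= h3; congr (_ + _); rewrite /b -scalemxAr linearZ /= trmx_mul trmxK.
- rewrite mul_col_row tr_block_mx ; congr block_mx.
  + by rewrite mulmxBl -mulmxA bA mulmx0 subr0 h4.
  + by rewrite bA trmx0 mulmxBl dE -mulmxA ba mulmx1 subrr.
  + by rewrite bA mulmxBl dE -mulmxA ba mulmx1 subrr trmx0.
  + exact: tr_mx11.
Qed.

Lemma penrose_exists m n (A : 'M[R]_(m, n)) : exists X, penrose A X.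
Proof.
elim: n A => [|n IH] A.
  exists 0; split; rewrite ?mul0mx ?mulmx0 ?trmx0 ?flatmx0 //.
  by apply/matrixP => i [].
rewrite -addn1 in A *.
have [X hX] := IH (lsubmx A).
by exists (greville_step X (lsubmx A) (rsubmx A)); rewrite -{1}[A]hsubmxK; exact: greville_penrose.
Qed.

Lemma mp_pinvP m n (A : 'M[R]_(m, n)) : penrose A (mp_pinv A).
Proof. by rewrite /mp_pinv; have [X hX] := penrose_exists A; apply: (xgetPex 0); exists X. Qed.

Lemma mp_pinvE m n (A : 'M[R]_(m, n)) X : penrose A X -> mp_pinv A = X.
Proof. exact/penrose_uniq/mp_pinvP. Qed.

Lemma mp_pinv_mulKA m n (A : 'M[R]_(m, n)) : A *m mp_pinv A *m A = A.
Proof. by case: (mp_pinvP A). Qed.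

Lemma mp_pinv_mulK m n (A : 'M[R]_(m, n)) : mp_pinv A *m A *m mp_pinv A = mp_pinv A.
Proof. by case: (mp_pinvP A). Qed.

Lemma oproj_cols m n (A : 'M[R]_(m, n)) : oproj_mx (A *m mp_pinv A).
Proof. by case: (mp_pinvP A) => h1 h2 h3 h4; split => //; rewrite mulmxA h1. Qed.

Lemma oproj_rows m n (A : 'M[R]_(m, n)) : oproj_mx (mp_pinv A *m A).
Proof. by case: (mp_pinvP A) => h1 h2 h3 h4; split => //; rewrite mulmxA h2. Qed.

Lemma pinv_normal_eq m n (A : 'M[R]_(m, n)) (b : 'cV_m) :
  A^T *m (A *m (mp_pinv A *m b) - b) = 0.
Proof.
rewrite mulmxBr !mulmxA -(mulmxA A^T).
have [<- _] := oproj_cols A; rewrite -trmx_mul mp_pinv_mulKA subrr //.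
Qed.

(** A^+ b lies in the range of the symmetric projection A^+ A, which is orthogonal to the kernel of
    A. With [pinv_normal_eq] this says that A^+ b is the least-squares solution of minimal norm. *)
Lemma pinv_row_space m n (A : 'M[R]_(m, n)) (b : 'cV_m) (c : 'cV_n) :
  A *m c = 0 -> frob (mp_pinv A *m b) c = 0.
Proof.
move=> Ac; rewrite -mp_pinv_mulK -mulmxA frob_mull; have [-> _] := oproj_rows A.
by rewrite -mulmxA Ac mulmx0 frob0r.
Qed.

(** Finding the coordinates of Y in a basis of W is a least-squares problem; it is solved by the
    pseudoinverse of the matrix C whose columns are the vectorized basis, and [pinv_normal_eq] is
    the orthogonality. *)
Lemma orth_decomp p q (W : {vspace 'M[R]_(p, q)}) X :
  exists2 Y, Y \in W & forall Z, Z \in W -> frob (X - Y) Z = 0.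
Proof.
pose k := \dim W; pose e := vbasis W.
pose C : 'M[R]_(p * q, k) := \matrix_(a, l) mxvec (tnth e l) 0 a.
have frobv (Y Z : 'M[R]_(p, q)) : frob Y Z = frob (mxvec Y)^T (mxvec Z)^T.
  rewrite !frobE pair_big /= (reindex _ (curry_mxvec_bij p q)) /=.
  by apply: eq_bigr => -[i j] _; rewrite big_ord1 !mxE /= !mxvecE.
have combE (c : 'cV[R]_k) : (mxvec (\sum_l c l 0 *: tnth e l))^T = C *m c.
  apply/matrixP => a i; rewrite !mxE linear_sum /= summxE ord1.
  by apply: eq_bigr => l _; rewrite linearZ !mxE /= mulrC.
pose c := mp_pinv C *m (mxvec X)^T.
exists (\sum_l c l 0 *: tnth e l).
  by apply: memv_suml => l _; apply: memvZ; rewrite vbasis_mem // mem_tnth.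
move=> Z /coord_vbasis ->.
pose z : 'cV[R]_k := \col_l coord e l Z.
have -> : \sum_(i < \dim W) coord (vbasis W) i Z *: (vbasis W)`_i = \sum_l z l 0 *: tnth e l.
  by apply: eq_bigr => l _; rewrite !mxE (tnth_nth 0).
rewrite frobv combE linearB linearB /= combE frobC frob_mull -opprB mulmxN.
by rewrite pinv_normal_eq oppr0 frob0r.
Qed.

End Pseudoinverse.

(** * Geometry of the rank manifold *)

Lemma eq_ler (R : numDomainType) (x y : R) : x = y -> x <= y.
Proof. by move->. Qed.

Section RankGeometry.
Variable R : realType.
Implicit Types p q : nat.

(** If u (1 + K) = 0 then |u| = |u K| <= |u| |K|, which forces u = 0. *)
Lemma unitmx_near1 n (K : 'M[R]_n) : fnorm K < 1 -> 1%:M + K \in unitmx.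
Proof.
move=> K1; rewrite -row_free_unit; apply: inj_row_free => u.
rewrite mulmxDr mulmx1 => /eqP; rewrite addr_eq0 => /eqP uK.
apply: fnorm_eq0; apply/eqP; rewrite eq_le fnorm_ge0 andbT.
have := fnormM u K; rewrite -fnormN -uK => h.
by have := fnorm_ge0 u; nra.
Qed.

(* For x of rank r, nproj x is the orthogonal projection onto the normal space at x to the manifold of
   matrices of rank r; the tangent space is its kernel. *)
Definition colproj p q (x : 'M[R]_(p, q)) := x *m mp_pinv x.
Definition rowproj p q (x : 'M[R]_(p, q)) := mp_pinv x *m x.
Definition nproj p q (x X : 'M[R]_(p, q)) :=
  (1%:M - colproj x) *m X *m (1%:M - rowproj x).

Fact nproj_linear p q (x : 'M[R]_(p, q)) : linear (nproj x).
Proof.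
by move=> a X Y; rewrite /nproj (mulmxDr (_ - colproj x)) mulmxDl -scalemxAr -scalemxAl.
Qed.
HB.instance Definition _ p q (x : 'M[R]_(p, q)) :=
  GRing.isLinear.Build R 'M[R]_(p, q) 'M[R]_(p, q) _ (nproj x) (nproj_linear x).

Section Fixed.
Variables p q : nat.
Implicit Types x y X Y v w z : 'M[R]_(p, q).

Lemma colprojC_oproj x : oproj_mx (1%:M - colproj x).
Proof. exact/oproj_mxC/oproj_cols. Qed.

Lemma rowprojC_oproj x : oproj_mx (1%:M - rowproj x).
Proof. exact/oproj_mxC/oproj_rows. Qed.

Lemma colprojK x : colproj x *m x = x.
Proof. exact: mp_pinv_mulKA. Qed.

Lemma rowprojK x : x *m rowproj x = x.
Proof. by rewrite /rowproj mulmxA mp_pinv_mulKA. Qed.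

Lemma colprojC_mul x : (1%:M - colproj x) *m x = 0.
Proof. by rewrite mulmxBl mul1mx colprojK subrr. Qed.

Lemma mul_rowprojC x : x *m (1%:M - rowproj x) = 0.
Proof. by rewrite mulmxBr mulmx1 rowprojK subrr. Qed.

Lemma nproj_self x : nproj x x = 0.
Proof. by rewrite /nproj colprojC_mul mul0mx. Qed.

Lemma nproj_idem x X : nproj x (nproj x X) = nproj x X.
Proof.
rewrite /nproj !mulmxA; have [_ ->] := colprojC_oproj x.
by rewrite -mulmxA; have [_ ->] := rowprojC_oproj x.
Qed.

Lemma nproj_adj x X Y : frob (nproj x X) Y = frob X (nproj x Y).
Proof.
rewrite /nproj frob_mulr frob_mull; have [-> _] := colprojC_oproj x.
by have [-> _] := rowprojC_oproj x; rewrite mulmxA.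
Qed.

Lemma nproj_sqr x X : frob (nproj x X) X = frob (nproj x X) (nproj x X).
Proof. by rewrite -[in RHS]nproj_adj nproj_idem. Qed.

Lemma fnorm_nproj x X : fnorm (nproj x X) <= fnorm X.
Proof.
apply: le_trans (fnorm_oproj_mxr _ (rowprojC_oproj x)) _.
exact: fnorm_oproj_mxl (colprojC_oproj x).
Qed.

(** The pseudoinverse has the least norm among inner inverses: x^+ = (x^+ x) G (x x^+) is G
    compressed by two orthogonal projections. *)
Lemma fnorm_pinv_le x (G : 'M[R]_(q, p)) :
  x *m G *m x = x -> fnorm (mp_pinv x) <= fnorm G.
Proof.
move=> xGx; have -> : mp_pinv x = rowproj x *m G *m colproj x.
  by rewrite /rowproj /colproj -!mulmxA (mulmxA G) (mulmxA x) (mulmxA x) xGx mulmxA mp_pinv_mulK.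
apply: le_trans (fnorm_oproj_mxr _ (oproj_cols x)) _.
exact: fnorm_oproj_mxl (oproj_rows x).
Qed.

(* With y = y y^+ y, the factors (1 - P_x) and (1 - Q_x) let both outer y's be replaced by y - x. *)
Lemma nproj_secant x y :
  fnorm (nproj x (y - x)) <= fnorm (mp_pinv y) * fnorm (y - x) ^+ 2.
Proof.
have -> : nproj x (y - x) = (1%:M - colproj x) *m ((y - x) *m mp_pinv y *m (y - x))
     *m (1%:M - rowproj x).
  have e1 : (1%:M - colproj x) *m (y - x) = (1%:M - colproj x) *m y.
    by rewrite mulmxBr colprojC_mul subr0.
  have e2 : (y - x) *m (1%:M - rowproj x) = y *m (1%:M - rowproj x).
    by rewrite mulmxBl mul_rowprojC subr0.
  rewrite linearB /= nproj_self subr0 /nproj !mulmxA e1 -!mulmxA e2.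
  by rewrite (mulmxA y (mp_pinv y)) (mulmxA (y *m mp_pinv y) y) mp_pinv_mulKA.
apply: le_trans (fnorm_oproj_mxr _ (rowprojC_oproj x)) _.
apply: le_trans (fnorm_oproj_mxl _ (colprojC_oproj x)) _.
by apply: le_trans (fnormM3 _ _ _) _; apply: eq_ler; ring.
Qed.

(** As w is tangent at x, w = P_x w + (1 - P_x) w Q_x. In the first term (1 - P_y) P_x = (1 - P_y)
    (x - y) x^+, and in the second Q_x (1 - Q_y) = x^+ (x - y) (1 - Q_y). Each term contributes
    |x^+| |x - y| |w|, whence the factor 2. *)
Lemma nproj_lip x y w : nproj x w = 0 ->
  fnorm (nproj y w) <= 2 * fnorm (mp_pinv x) * fnorm (x - y) * fnorm w.
Proof.
move=> nw.
have cP : (1%:M - colproj y) *m colproj x = (1%:M - colproj y) *m ((x - y) *m mp_pinv x).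
  by rewrite !mulmxA mulmxBr colprojC_mul subr0 -mulmxA.
have rP : rowproj x *m (1%:M - rowproj y) = mp_pinv x *m (x - y) *m (1%:M - rowproj y).
  by rewrite -!mulmxA mulmxBl mul_rowprojC subr0 mulmxA.
have wE : w = colproj x *m w + (1%:M - colproj x) *m w *m rowproj x.
  move: nw; rewrite /nproj mulmxBr mulmx1 => /eqP; rewrite subr_eq0 => /eqP <-.
  by rewrite -mulmxDl addrC subrK mul1mx.
have -> : nproj y w = (1%:M - colproj y) *m (((x - y) *m mp_pinv x) *m w) *m (1%:M - rowproj y)
  + (1%:M - colproj y) *m ((1%:M - colproj x) *m (w *m (mp_pinv x *m (x - y)))) *m (1%:M - rowproj y).
  rewrite {1}wE linearD /=; congr (_ + _).
    by rewrite /nproj; congr (_ *m _); rewrite (mulmxA _ (colproj x)) cP [RHS]mulmxA.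
  rewrite /nproj -(mulmxA _ (_ *m rowproj x)) -(mulmxA _ (rowproj x)) rP.
  by rewrite -[RHS]mulmxA; congr (_ *m _); rewrite -!mulmxA.
rewrite -!mulrA mulr_natl mulr2n; apply: fnormD_le.
  apply: le_trans (fnorm_oproj_mxr _ (rowprojC_oproj y)) _.
  apply: le_trans (fnorm_oproj_mxl _ (colprojC_oproj y)) _.
  by apply: le_trans (fnormM3 _ _ _) _; apply: eq_ler; ring.
apply: le_trans (fnorm_oproj_mxr _ (rowprojC_oproj y)) _.
apply: le_trans (fnorm_oproj_mxl _ (colprojC_oproj y)) _.
apply: le_trans (fnorm_oproj_mxl _ (colprojC_oproj x)) _.
by rewrite mulmxA; apply: le_trans (fnormM3 _ _ _) _; apply: eq_ler; ring.
Qed.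

(* A point of rank at most \rank x which agrees with x + v to first order when v is tangent at x. *)
Definition retract x v := (1%:M + (1%:M - colproj x) *m v *m mp_pinv x) *m (x + colproj x *m v).

(** The right factor of the retraction is P (x + v) = x x^+ (x + v), whose rank is at most that of
    x. *)
Lemma rank_retract x v : (\rank (retract x v) <= \rank x)%N.
Proof.
apply: leq_trans (mxrankM_maxr _ _) _.
rewrite -{1}(colprojK x) -mulmxDr /colproj -mulmxA.
exact: mxrankM_maxl.
Qed.

(** Tangency means (1 - P) v = (1 - P) v x^+ x, so the left factor applied to x supplies exactly the
    part of v missing from P v; the only other term is quadratic in v. *)
Lemma retractE x v : nproj x v = 0 ->
  retract x v = x + v + (1%:M - colproj x) *m v *m mp_pinv x *m v.
Proof.
move=> nv.
have e1 : (1%:M - colproj x) *m v *m mp_pinv x *m x = (1%:M - colproj x) *m v.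
  move: nv; rewrite /nproj mulmxBr mulmx1 => /eqP; rewrite subr_eq0 => /eqP nv.
  by rewrite [RHS]nv /rowproj mulmxA.
have e2 : mp_pinv x *m colproj x = mp_pinv x by rewrite /colproj mulmxA mp_pinv_mulK.
rewrite /retract mulmxDl mul1mx mulmxDr e1 (mulmxA _ (colproj x)) -(mulmxA _ _ (colproj x)) e2.
rewrite addrA; congr (_ + _); rewrite -addrA; congr (_ + _).
by rewrite mulmxBl mul1mx addrC subrK.
Qed.

Lemma fnorm_retract x v : nproj x v = 0 ->
  fnorm (retract x v - (x + v)) <= fnorm (mp_pinv x) * fnorm v ^+ 2.
Proof.
move=> /retractE ->; rewrite [x + v + _]addrC addrK -!mulmxA.
apply: le_trans (fnorm_oproj_mxl _ (colprojC_oproj x)) _.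
by rewrite mulmxA; apply: le_trans (fnormM3 _ _ _) _; apply: eq_ler; ring.
Qed.

Section NearRank.
Variables z x : 'M[R]_(p, q).
Let K := mp_pinv z *m (x - z).
Hypothesis near : fnorm (mp_pinv z) * fnorm (x - z) <= 2^-1.

Let K_le : fnorm K <= 2^-1.
Proof. exact: le_trans (fnormM _ _) near. Qed.

Let K_unit : 1%:M + K \in unitmx.
Proof. by apply: unitmx_near1; apply: le_lt_trans K_le _; lra. Qed.

(** On the row space of z the matrix z^+ x is a small perturbation of the identity. Since 1 + K is
    invertible, x keeps there the full rank of z, and can be inverted there with a bound. *)
Let KE : mp_pinv z *m x *m rowproj z = (1%:M + K) *m rowproj z.
Proof.
rewrite mulmxDl mul1mx /K mulmxBr -/(rowproj z) mulmxBl.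
by have [_ ->] := oproj_rows z; rewrite addrC subrK.
Qed.

Let rank_rowproj : \rank (rowproj z) = \rank z.
Proof.
apply/eqP; rewrite eqn_leq mxrankM_maxr /=.
by rewrite -[z in (\rank z <= _)%N]rowprojK mxrankM_maxr.
Qed.

Let rank_xQ : (\rank z <= \rank (x *m rowproj z))%N.
Proof.
have full : row_full (1%:M + K)%R by rewrite row_full_unit K_unit.
by rewrite -rank_rowproj -(eqmxMfull _ full) -KE -mulmxA mxrankM_maxr.
Qed.

Lemma rank_near : (\rank z <= \rank x)%N.
Proof. exact: leq_trans rank_xQ (mxrankM_maxl _ _). Qed.

(* With K = z^+ (x - z), the matrix z^+ z (1 + K)^-1 z^+ is an inner inverse of x. *)
Lemma fnorm_pinv_near : \rank x = \rank z -> fnorm (mp_pinv x) <= 2 * fnorm (mp_pinv z).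
Proof.
move=> rx; pose H := invmx (1%:M + K) *m mp_pinv z.
have H_le : fnorm H <= 2 * fnorm (mp_pinv z).
  have e : mp_pinv z = H + K *m H.
    by rewrite -{1}(mul1mx H) -mulmxDl /H mulmxA mulmxV // mul1mx.
  have : fnorm H <= fnorm (mp_pinv z) + fnorm K * fnorm H.
    have -> : H = mp_pinv z + - (K *m H) by rewrite {1}e addrK.
    apply: fnormD_le => //; rewrite fnormN.
    have <- : H = mp_pinv z + - (K *m H) by rewrite {1}e addrK.
    exact: fnormM.
  by have := fnorm_ge0 H; have := K_le; nra.
apply: le_trans H_le.
apply: le_trans (fnorm_oproj_mxl H (oproj_rows z)).
apply: fnorm_pinv_le.
(* Equality of the ranks enters here: the columns of x Q, with Q = z^+ z, already span those of x,
   so x factors as x Q times a matrix. *)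
have /submxP[B xB] : (x^T <= (x *m rowproj z)^T)%MS.
  have s : ((x *m rowproj z)^T <= x^T)%MS by rewrite trmx_mul submxMl.
  by rewrite -(geq_leqif (mxrank_leqif_sup s)) !mxrank_tr rx rank_xQ.
move: xB => /(congr1 trmx); rewrite !trmxK trmx_mul trmxK => xB.
have HxQ : H *m x *m rowproj z = rowproj z.
  by rewrite -[H *m x]mulmxA -[_ *m rowproj z]mulmxA KE mulmxA mulVmx ?mul1mx.
have [_ idQ] := oproj_rows z; rewrite -/(rowproj z) in idQ *.
clearbody H; move: (rowproj z) idQ HxQ xB => Q idQ HxQ xB.
rewrite {2}xB !mulmxA -(mulmxA (x *m Q) H x) -(mulmxA (x *m Q) (H *m x)) HxQ.
by rewrite -(mulmxA x) idQ -xB.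
Qed.

End NearRank.

End Fixed.
End RankGeometry.

(** * Topology of the Frobenius norm and existence of nearest points *)

Section FrobeniusTopology.
Variables (R : realType) (p q : nat).
Implicit Types (M X Y Z : 'M[R]_(p, q)) (S : set 'M[R]_(p, q)).

Lemma nbhs_fball M S : nbhs M S <-> exists2 e : R, 0 < e & fball M e `<=` S.
Proof.
split=> [/nbhs_normP[e e0 eS]|[e e0 eS]].
  exists e => // Y MY; apply: eS => /=; exact: le_lt_trans (norm_le_fnorm _) MY.
apply/(nbhs_normP M S); have c0 : 0 < (p * q)%:R + 1 :> R by rewrite ltr_wpDl.
exists (e / ((p * q)%:R + 1)); first by rewrite /= divr_gt0.
move=> Y /= MY; apply: eS; rewrite /fball /=; apply: le_lt_trans (fnorm_le_norm _) _.
have : `|M - Y| * ((p * q)%:R + 1) < e by rewrite -ltr_pdivlMr.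
by apply: le_lt_trans; rewrite mulrC ler_wpM2l // lerDl.
Qed.

Lemma nbhs_norm_of_fnorm e : 0 < e -> exists2 d : R, 0 < d & forall Y, `|Y| < d -> fnorm Y < e.
Proof.
move=> e0; have /nbhs_normP[d d0 h] : nbhs (0 : 'M[R]_(p, q)) (fball 0 e) by apply/nbhs_fball; exists e.
exists d => // Y Yd; have := h (- Y); rewrite /fball /= sub0r opprK => -> //.
Qed.

Lemma cvg_fnorm (u : nat -> 'M[R]_(p, q)) X :
  u @ \oo --> X <-> forall e : R, 0 < e -> exists N, forall n, (N <= n)%N -> fnorm (X - u n) < e.
Proof.
split=> [/cvgrPdist_lt h e /nbhs_norm_of_fnorm[d d0 hd]|h].
  by have [N _ hN] := h d d0; exists N => n Nn; apply: hd; exact: hN.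
apply/cvgrPdist_lt => e /h[N hN]; exists N => // n /= Nn.
exact: le_lt_trans (norm_le_fnorm _) (hN n Nn).
Qed.

Lemma fnorm_geometric_cvg (u : nat -> 'M[R]_(p, q)) (c : R) :
  (forall n, fnorm (u n.+1 - u n) <= c * 2^-1 ^+ n) ->
  exists X, u @ \oo --> X.
Proof.
move=> hu.
have c0 : 0 <= c by have := le_trans (fnorm_ge0 _) (hu 0%N); rewrite expr0 mulr1.
(* The right-hand side is the geometric sum of c 2^-j over n <= j < n + k, written in closed form so
   that the induction telescopes. *)
have tail n k : fnorm (u (n + k)%N - u n) <= 2 * c * 2^-1 ^+ n - 2 * c * 2^-1 ^+ (n + k).
  elim: k => [|k IH]; first by rewrite addn0 !subrr fnorm0.
  rewrite addnS; apply: le_trans (fnorm_tri (u (n + k)%N) _ _) _.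
  by have := hu (n + k)%N; rewrite exprS; lra.
apply/cvg_ex; apply/cauchy_cvgP/cauchy_exP => e e0.
have [N hN] : exists N, 2 * c * 2^-1 ^+ N < e.
  have : (fun n => 2 * c * 2^-1 ^+ n) @ \oo --> (2 * c * 0 : R).
    by apply: cvgMr; apply: cvg_expr; rewrite ger0_norm; lra.
  move/cvgrPdist_lt => /(_ e e0)[N _ hN]; exists N.
  have := hN N (leqnn N); rewrite mulr0 sub0r normrN; exact: le_lt_trans (ler_norm _).
exists (u N); exists N => // n /= Nn; rewrite -ball_normE /=.
apply: le_lt_trans (norm_le_fnorm _) _; rewrite fnormB -(subnKC Nn).
apply: le_lt_trans (tail _ _) _; apply: le_lt_trans hN.
by rewrite gerBl !mulr_ge0 // exprn_ge0 // invr_ge0.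
Qed.

(** The points of S no farther from M than X0 form a compact set. Closedness is asked only within
    that distance of M, because the manifold of matrices of rank r is closed only locally. *)
Lemma nearest_exists S M X0 : S X0 ->
  (forall Y, fnorm (M - Y) <= fnorm (M - X0) ->
     (forall e : R, 0 < e -> exists2 Z, S Z & fnorm (Y - Z) < e) -> S Y) ->
  exists2 X, S X & forall Y, S Y -> fnorm (M - X) <= fnorm (M - Y).
Proof.
move=> SX0 Scl; pose f (v : 'rV[R]_(p * q)) := fnorm (M - vec_mx v).
pose A : set 'rV[R]_(p * q) := [set v | S (vec_mx v) /\ f v <= fnorm (M - X0)].
have vec_near v (e : R) : 0 < e -> exists2 d : R, 0 < d &
    forall w, `|v - w| < d -> fnorm (vec_mx v - vec_mx w : 'M[R]_(p, q)) < e.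
  move=> /nbhs_norm_of_fnorm[d d0 hd]; exists d => // w vw; apply: hd.
  rewrite -linearB /=; apply: le_lt_trans vw.
  have [->|] := eqVneq `|vec_mx (v - w) : 'M[R]_(p, q)| 0; first exact: normr_ge0.
  move=> /mx_norm_neq0[ij eij]; apply: le_trans (eq_ler eij) _.
  by rewrite mxE norm_entry.
have fv v w : f w - f v <= fnorm (vec_mx v - vec_mx w : 'M[R]_(p, q)).
  by rewrite lerBlDl; exact: fnorm_tri.
have fcont : continuous f.
  move=> v; apply/(@cvgrPdist_lt R R^o _ (nbhs v) (nbhs_filter v)) => e e0; have [d d0 hd] := vec_near v e e0.
  apply/(nbhs_normP v); exists d => // w /= /hd vw.
  rewrite ltr_distlC; have := fv v w; have := fv w v; rewrite fnormB; lra.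
have A0 : A !=set0 by exists (mxvec X0); rewrite /A /f /= mxvecK.
have Acl : closed A.
  move=> v Av.
  have fvle : f v <= fnorm (M - X0).
    rewrite leNgt; apply/negP => lt.
    have [d d0 hd] := vec_near v (f v - fnorm (M - X0)) ltac:(by rewrite subr_gt0).
    have [w [[_ fw]]] := Av (ball v d) ltac:(exact: nbhsx_ballx).
    rewrite -ball_normE /= => /hd; have := fv w v; rewrite fnormB; lra.
  split=> //; apply: Scl => // e e0.
  have [d d0 hd] := vec_near v e e0.
  have [w [[Sw _]]] := Av (ball v d) ltac:(exact: nbhsx_ballx).
  by rewrite -ball_normE /= => /hd vw; exists (vec_mx w).
have Abd : bounded_set A.
  exists (fnorm M + fnorm (M - X0)); split; first exact: num_real.
  move=> x hx v [_ fvle]; apply: le_trans (ltW hx).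
  apply: le_trans (norm_le_fnorm _) _.
  have -> : fnorm v = fnorm (vec_mx v : 'M[R]_(p, q)).
    congr Num.sqrt; rewrite !frobE big_ord1 [RHS]pair_big /=.
    rewrite (reindex _ (curry_mxvec_bij p q)) /=.
    by apply: eq_bigr => -[i j] _ /=; rewrite !mxE.
  rewrite -[vec_mx v](subKr M) -[M - (_ - _)]/(M + - _).
  by apply: fnormD_le => //; rewrite fnormN.
have [v] := EVT_min_rV A0 (bounded_closed_compact Abd Acl) (continuous_subspaceT fcont).
rewrite inE => -[Sv _] vmin; exists (vec_mx v) => // Y SY.
have [le|/ltW le] := leP (fnorm (M - Y)) (fnorm (M - X0)).
  by have := vmin (mxvec Y); rewrite /f mxvecK; apply; rewrite inE /A /f /= mxvecK.
apply: le_trans le; have := vmin (mxvec X0); rewrite /f mxvecK; apply.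
by rewrite inE /A /f /= mxvecK.
Qed.

End FrobeniusTopology.

(** * The tangent space of the rank manifold *)

Section TangentSpace.
Variables (R : realType) (p q : nat).
Implicit Types (A B C x X : 'M[R]_(p, q)).

(** This family is stable under differentiation, so smoothness of its members is a single induction;
    it contains the curves t -> [retract x (t *: X)] for X tangent at x. *)
Let quad A B C := fun t : R => A + t *: B + t ^+ 2 *: C.

Let quad_cvg A B C t :
  (fun h : R => h^-1 *: ((quad A B C \o shift t) (h *: 1) - quad A B C t)) @ 0^'
    --> quad B (2 *: C) 0 t.
Proof.
have e : {near (0 : R)^', (fun h : R => B + (t + t + h) *: C) =1
   (fun h : R => h^-1 *: ((quad A B C \o shift t) (h *: 1) - quad A B C t))}.
  near=> h; have h0 : h != 0 by near: h; exact: nbhs_dnbhs_neq.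
  rewrite /quad /= [h *: 1]mulr1.
  apply: (scalerI h0); rewrite scalerA divff // scale1r.
  apply/matrixP => i j; rewrite !mxE; ring.
apply: cvg_trans; first exact: near_eq_cvg e.
rewrite /quad scaler0 addr0 scalerA mulr_natr mulr2n.
apply: cvgD; first exact: cvg_cst.
apply: cvgZr_tmp; rewrite -[X in _ --> X]addr0; apply: cvgD; first exact: cvg_cst.
exact: nbhs_dnbhs.
Unshelve. all: by end_near. Qed.

Let derive1_quad A B C : derive1 (quad A B C) = quad B (2 *: C) 0.
Proof.
by apply/funext => t; rewrite derive1E; apply/cvg_lim => //; exact: quad_cvg.
Qed.

Let derivable_quad n A B C t : derivable (derive1n n (quad A B C)) t 1.
Proof.
elim: n A B C => [|n IH] A B C; first by apply/cvg_ex; eexists; exact: quad_cvg.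
by rewrite /derive1n iterSr derive1_quad; exact: IH.
Qed.

(** Divided by h, the secant estimate bounds N_x applied to the difference quotient (g h - x) / h by
    O(|h|), with a constant that is uniform because |(g h)^+| <= 2 |x^+| for small h. The quotient
    tends to X. *)
Lemma nproj_velocity r (g : R -> 'M[R]_(p, q)) x X : \rank x = r ->
  derivable g 0 1 -> derive1 g 0 = X -> g 0 = x ->
  (\forall t \near (0 : R), rank_manifold r (g t)) -> nproj x X = 0.
Proof.
move=> rx gdif gX g0 gD.
have gcvg : (fun h => h^-1 *: (g h - x)) @ 0^' --> X.
  move: gdif; rewrite -gX derive1E /derive => /cvg_ex[l] gl.
  rewrite (cvg_lim _ gl) //; move: gl; rewrite g0.
  by under eq_fun do rewrite /= addr0 [_ *: 1]mulr1.
apply: fnorm_eq0; apply/eqP; rewrite eq_le fnorm_ge0 andbT.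
pose k := fnorm (mp_pinv x); pose a := fnorm X + 1.
have k0 : 0 <= k by exact: fnorm_ge0.
have a1 : 1 <= a by rewrite lerDr fnorm_ge0.
pose c := 1 + 2 * k * a ^+ 2.
have c1 : 1 <= c by rewrite lerDl !mulr_ge0 //; lra.
apply/ler_addgt0Pr => e e0; rewrite add0r.
pose e1 := Num.min 1 (e / (2 * c)).
have e10 : 0 < e1 by rewrite lt_min ltr01 divr_gt0 //; lra.
have e1e : e1 * (2 * c) <= e by rewrite -ler_pdivlMr ?ge_min ?lexx ?orbT //; lra.
have e11 : e1 <= 1 by rewrite ge_min lexx.
(* The first bound makes the quadratic error at most (c - 1) e1; the second gives |x^+| |g h - x| <=
   1/2, as [fnorm_pinv_near] requires. *)
pose d := Num.min e1 (2^-1 / (k + 1) / a).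
have d0 : 0 < d by rewrite lt_min e10 !divr_gt0 ?invr_gt0 //; lra.
have dk : d * a * k <= 2^-1.
  have h : d * a <= 2^-1 / (k + 1) by rewrite -ler_pdivlMr ?ge_min ?lexx ?orbT //; lra.
  have := h; rewrite ler_pdivlMr; last by lra.
  have : 0 <= d * a by rewrite mulr_ge0 //; lra.
  lra.
have [h [h0 hd gDh ghX]] : exists h : R, [/\ h != 0, `|h| < d, \rank (g h) = r
    & fnorm (X - h^-1 *: (g h - x)) < e1].
  have [d1 d10 hd1] := nbhs_norm_of_fnorm p q e10.
  near (0 : R)^' => h; exists h; split.
  - by near: h; exact: nbhs_dnbhs_neq.
  - by near: h; exact: dnbhs0_lt.
  - by near: h; exact: nbhs_dnbhs.
  - by apply: hd1; near: h; exact: cvgr_dist_lt gcvg _ d10.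
set Y := h^-1 *: (g h - x) in ghX.
have gE : g h - x = h *: Y by rewrite /Y scalerA divff // scale1r.
clearbody Y.
have Ya : fnorm Y <= a.
  rewrite -(subKr X Y); apply: fnormD_le => //.
  by rewrite fnormN; apply: le_trans (ltW ghX) _.
have hn : 0 <= `|h| by [].
have gx : fnorm (g h - x) <= d * a.
  by rewrite gE fnormZ; apply: ler_pM; rewrite ?fnorm_ge0 // ltW.
have near_h : fnorm (mp_pinv x) * fnorm (g h - x) <= 2^-1.
  rewrite mulrC; apply: le_trans dk; by rewrite ler_wpM2r.
have kg := fnorm_pinv_near near_h (etrans gDh (esym rx)).
have nY : fnorm (nproj x Y) <= 2 * k * a ^+ 2 * d.
  have := nproj_secant x (g h); rewrite gE linearZ /= !fnormZ => H.
  have {}H : fnorm (nproj x Y) <= fnorm (mp_pinv (g h)) * fnorm Y ^+ 2 * `|h|.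
    have hp : 0 < `|h| by rewrite normr_gt0.
    rewrite -(ler_pM2l hp); apply: le_trans H _; apply: eq_ler; ring.
  apply: le_trans H _; apply: ler_pM => //; last exact: ltW.
    by rewrite mulr_ge0 ?fnorm_ge0 // exprn_ge0 // fnorm_ge0.
  apply: ler_pM => //; rewrite ?fnorm_ge0 ?exprn_ge0 ?fnorm_ge0 //.
  by rewrite lerXn2r ?nnegrE ?fnorm_ge0 //; lra.
have -> : X = Y + (X - Y) by rewrite addrC subrK.
rewrite linearD /=; apply: le_trans (fnormD _ _) _.
have := fnorm_nproj x (X - Y).
have de1 : d <= e1 by rewrite ge_min lexx.
have : 2 * k * a ^+ 2 * d <= (c - 1) * e1.
  by rewrite /c addrC addKr; apply: ler_wpM2l => //; rewrite !mulr_ge0 //; lra.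
move: nY ghX e1e; nra.
Unshelve. all: by end_near. Qed.

(** Conversely, for X in the kernel of N_x the curve t -> [retract x (t *: X)] is a quadratic
    polynomial with velocity X. Its rank is at most r everywhere and at least r near t = 0 by
    [rank_near]. *)
Lemma tangent_rank r x X : \rank x = r ->
  tangent_vec (rank_manifold r) x X <-> nproj x X = 0.
Proof.
move=> rx; split=> [[g [gdif gD g0 gX]]|nX].
  exact: nproj_velocity rx (gdif 0%N 0) gX g0 gD.
pose C := (1%:M - colproj x) *m X *m mp_pinv x *m X.
have gE t : quad x X C t = retract x (t *: X).
  rewrite retractE; last by rewrite linearZ /= nX scaler0.
  by rewrite /quad /C -!scalemxAr -!scalemxAl scalerA expr2.
exists (quad x X C); split.
- by move=> n t; exact: derivable_quad.
- have gcont : quad x X C @ (0 : R) --> x.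
    have q0 : quad x X C 0 = x by rewrite /quad scale0r expr0n scale0r !addr0.
    rewrite -[in X in _ --> X]q0.
    rewrite /quad; apply: cvgD; last by apply: cvgZr_tmp; exact: cvgM.
    by apply: cvgD; [exact: cvg_cst | exact: cvgZr_tmp].
  have k0 : 0 < 2^-1 / (fnorm (mp_pinv x) + 1) by rewrite divr_gt0 // ltr_wpDl ?fnorm_ge0.
  have [d d0 hd] := nbhs_norm_of_fnorm p q k0.
  near=> t; apply/eqP; rewrite eqn_leq -{1}rx gE rank_retract /= -gE -rx.
  apply: rank_near.
  have : fnorm (quad x X C t - x) < 2^-1 / (fnorm (mp_pinv x) + 1).
    rewrite fnormB; apply: hd; near: t.
    by move/cvgrPdist_lt: gcont => /(_ d d0).
  rewrite ltr_pdivlMr ?ltr_wpDl ?fnorm_ge0 // => /ltW; apply: le_trans.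
  by rewrite mulrC ler_wpM2l ?fnorm_ge0 // lerDl.
- by rewrite /quad scale0r expr0n scale0r !addr0.
- by rewrite derive1_quad /quad scale0r scaler0 !addr0.
Unshelve. all: by end_near. Qed.

End TangentSpace.

(** * The Newton step *)

Ltac mx_ring := apply/matrixP => ? ?; rewrite !mxE; ring.

Section OrthonormalBases.
Variables (R : realType) (p q : nat).
Implicit Types (M X Y Z e : 'M[R]_(p, q)).

Lemma onb_mem n (S : set 'M[R]_(p, q)) (e : n.-tuple 'M[R]_(p, q)) k : is_onb S e -> S (tnth e k).
Proof. by case=> _ h; apply/h; apply: memv_span; exact: mem_tnth. Qed.

Lemma onb_expand n (S : set 'M[R]_(p, q)) (e : n.-tuple 'M[R]_(p, q)) X : is_onb S e -> S X ->
  X = \sum_k frob (tnth e k) X *: tnth e k.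
Proof.
move=> [orth span] /span /coord_span XE.
have nthE (k : 'I_n) : e`_k = tnth e k by rewrite (tnth_nth 0).
rewrite {1}XE; apply: eq_bigr => k _; rewrite nthE; congr (_ *: _).
rewrite [in RHS]XE frob_sumr (bigD1 k) //= nthE frobZr orth eqxx mulr1 big1 ?addr0 // => l lk.
by rewrite nthE frobZr orth eq_sym (negbTE lk) mulr0.
Qed.

(** The double orthogonal complement of E0 is E0: the component of X orthogonal to E0 expands in F,
    and all its coefficients vanish. *)
Lemma orth_compl_mem n (E0 : {vspace 'M[R]_(p, q)}) (F : n.-tuple 'M[R]_(p, q)) X : is_onb (orth_compl E0) F ->
  (forall k, frob (tnth F k) X = 0) -> X \in E0.
Proof.
move=> hF FX; have [Y YE0 hY] := orth_decomp E0 X.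
suff /eqP : X - Y = 0 by rewrite subr_eq0 => /eqP ->.
apply: frob_eq0; rewrite {1}(onb_expand hF hY) frob_suml big1 // => k _.
have /(_ Y YE0) FY := onb_mem k hF.
by rewrite frobZl (frobBr _ X) FX FY subrr mulr0.
Qed.

End OrthonormalBases.

Section NewtonStep.
Variables (R : realType) (p q : nat) (a : 'M[R]_(p, q)) (E0 : {vspace 'M[R]_(p, q)}).
Implicit Types (M Mt X Y Z e : 'M[R]_(p, q)).
Let E := affine_space a E0.

(* The normal equations of the Newton step at Mt from M: X is a point of E minimizing the distance
   to the tangent space at Mt, and among those the nearest to M. *)
Definition newton_eqs Mt M X : Prop :=
  [/\ E X, forall e, e \in E0 -> frob (nproj Mt (X - Mt)) e = 0
    & forall e, e \in E0 -> nproj Mt e = 0 -> frob (X - M) e = 0].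

Lemma affine_subr X Y : E X -> E Y -> X - Y \in E0.
Proof. by rewrite /E /affine_space /= => hX hY; rewrite -(subrKA a) -(opprB Y) memvB. Qed.

Lemma affine_addr X e : E X -> e \in E0 -> E (X + e).
Proof. by rewrite /E /affine_space /= => hX he; rewrite addrAC memvD. Qed.

(** The difference lies in E0. The second equations, tested on it, give N (X - Y) = 0; this allows
    the third ones to be tested on it, which gives X = Y. *)
Lemma newton_eqs_uniq Mt M X Y : newton_eqs Mt M X -> newton_eqs Mt M Y -> X = Y.
Proof.
move=> [EX X2 X3] [EY Y2 Y3]; have XY := affine_subr EX EY.
have n0 : nproj Mt (X - Y) = 0.
  have e : X - Y = (X - Mt) - (Y - Mt) by rewrite opprB subrKA.
  apply: frob_eq0; rewrite -nproj_sqr {1}e linearB /= frobBl.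
  by rewrite X2 // Y2 // subrr.
have e : X - Y = (X - M) - (Y - M) by rewrite opprB subrKA.
apply/eqP; rewrite -subr_eq0; apply/eqP; apply: frob_eq0.
by rewrite {1}e frobBl X3 // Y3 // subrr.
Qed.

(** Two orthogonal projections in succession: e1 makes N (a + e1 - Mt) orthogonal to N (E0), then w
    removes from a + e1 - M its component in E0 /\ ker N, which leaves the first condition
    untouched. *)
Lemma newton_eqs_exists Mt M : exists X, newton_eqs Mt M X.
Proof.
pose N := linfun (nproj Mt).
have NE X : N X = nproj Mt X by rewrite lfunE.
have [s] := orth_decomp (N @: E0)%VS (nproj Mt (Mt - a)).
move=> /memv_imgP[e1 e1E0 ->] hs.
pose X0 := a + e1.
have [w] := orth_decomp (E0 :&: lker N)%VS (X0 - M).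
rewrite memv_cap memv_ker NE => /andP[wE0 /eqP w0] hw.
have EX0 : E (X0 - w) by rewrite /E /affine_space /= /X0 addrAC [a + _]addrC addrK memvB.
exists (X0 - w); split=> //.
  move=> e eE0; have := hs (N e) (memv_img _ eE0); rewrite !NE.
  rewrite -nproj_adj !linearB /= !nproj_idem w0 subr0 linearD /= => h.
  by rewrite -[LHS]opprK -frobNl !opprB opprD addrA h oppr0.
move=> e eE0 e0; have := hw e; rewrite memv_cap memv_ker NE e0 eqxx eE0 => /(_ isT).
by rewrite addrAC.
Qed.

Lemma newton_eqs_tangent Mt M X Y : newton_eqs Mt M X -> E Y -> nproj Mt (Y - Mt) = 0 ->
  nproj Mt (X - Mt) = 0.
Proof.
move=> [EX X2 _] EY Y0; apply: frob_eq0; rewrite -nproj_sqr.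
rewrite -{2}(subrKA Y) frobDr X2 ?(affine_subr EX EY) // add0r.
by rewrite nproj_adj Y0 frob0r.
Qed.

(** Pythagoras: for Z in E /\ T the difference X - Z lies in E0 /\ ker N, hence is orthogonal to X -
    M. *)
Lemma newton_eqs_proj Mt M X (T : set 'M[R]_(p, q)) :
  (forall Y, T Y <-> nproj Mt (Y - Mt) = 0) ->
  newton_eqs Mt M X -> E `&` T !=set0 -> is_proj (E `&` T) M X.
Proof.
move=> hT hX [Y [EY /hT Y0]]; have X0 := newton_eqs_tangent hX EY Y0.
have [EX _ X3] := hX; split; first by split=> //; apply/hT.
move=> Z [EZ /hT Z0] ZX; rewrite ltNge fnorm_le -ltNge.
have e : M - Z = (X - Z) - (X - M) by mx_ring.
have e' : X - Z = (X - Mt) - (Z - Mt) by mx_ring.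
have XZ : nproj Mt (X - Z) = 0 by rewrite e' linearB /= X0 Z0 subrr.
rewrite e (frobBB (X - Z)) (frobC (X - Z) (X - M)) X3 ?affine_subr // mulr0 subr0 -(opprB X M) frobNl frobNr opprK.
rewrite ltrDr lt0r frob_ge0 andbT; apply/eqP => /frob_eq0 /eqP.
by rewrite subr_eq0 => /eqP XZe; apply: ZX.
Qed.

(** A is the matrix of N_Mt restricted to E0. The two properties of A^+ b correspond to the two
    orthogonality conditions: the normal equations of the least-squares problem give the one on N_Mt
    (X - Mt), and minimality of the norm gives the one on X - M, because Es is orthonormal and ker A
    represents E0 /\ ker N_Mt. *)
Lemma newton1_eqs n d (N : 'I_n -> 'M[R]_(p, q)) (Es : d.-tuple 'M[R]_(p, q)) Mt M :
  (forall X, nproj Mt X = \sum_k frob (N k) X *: N k) ->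
  is_onb [set X | X \in E0] Es -> E M ->
  let A := \matrix_(k < n, l < d) frob (N k) (tnth Es l) in
  let b := \col_(k < n) frob (N k) (Mt - M) in
  newton_eqs Mt M (M + \sum_(l < d) (mp_pinv A *m b) l 0 *: tnth Es l).
Proof.
move=> hN hE EM A b; set x := mp_pinv A *m b.
have combE (c : 'cV[R]_d) k : frob (N k) (\sum_l c l 0 *: tnth Es l) = (A *m c) k 0.
  by rewrite frob_sumr mxE; apply: eq_bigr => l _; rewrite frobZr mxE mulrC.
have coordE e : e \in E0 -> exists c : 'cV[R]_d, e = \sum_l c l 0 *: tnth Es l.
  move=> /(onb_expand hE) eE; exists (\col_l frob (tnth Es l) e); rewrite {1}eE.
  by apply: eq_bigr => l _; rewrite mxE.
split.
- by apply: affine_addr => //; apply: memv_suml => l _; apply: memvZ; exact: (onb_mem l hE).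
- move=> _ /coordE[c ->].
  rewrite hN frob_suml.
  have -> : \sum_k frob (frob (N k) (M + \sum_l x l 0 *: tnth Es l - Mt) *: N k)
       (\sum_l c l 0 *: tnth Es l) = frob (A *m x - b) (A *m c).
    rewrite frobE; apply: eq_bigr => k _; rewrite big_ord1 frobZl combE; congr (_ * _).
    rewrite addrAC addrC frobDr combE !mxE -[M - Mt]opprB frobNr //.
  by rewrite frobC frob_mull pinv_normal_eq frob0r.
- move=> _ /coordE[c ->] n0; rewrite addrC addKr.
  have Ac : A *m c = 0.
    apply: frob_eq0; rewrite frobE.
    transitivity (frob (nproj Mt (\sum_l c l 0 *: tnth Es l)) (\sum_l c l 0 *: tnth Es l)).
      rewrite hN frob_suml; apply: eq_bigr => k _.
      by rewrite big_ord1 frobZl combE.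
    by rewrite n0 frob0l.
  rewrite -(pinv_row_space b Ac) [RHS]frobE frob_suml; apply: eq_bigr => l _.
  rewrite big_ord1 frobZl frob_sumr; congr (_ * _).
  have [orth _] := hE.
  rewrite (bigD1 l) //= frobZr orth eqxx mulr1 big1 ?addr0 // => k kl.
  by rewrite frobZr orth eq_sym (negbTE kl) mulr0.
Qed.

Section Variant2.
Variables (m n : nat) (T : 'I_m -> 'M[R]_(p, q)) (F : n.-tuple 'M[R]_(p, q)) (Mt M : 'M[R]_(p, q)).
Hypothesis hT : forall X, X - nproj Mt X = \sum_l frob (T l) X *: T l.
Hypothesis T0 : forall l, nproj Mt (T l) = 0.
Hypothesis Torth : forall k l, frob (T k) (T l) = (k == l)%:R.
Hypothesis hF : is_onb (orth_compl E0) F.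
Hypothesis EM : E M.
Hypothesis normal : nproj Mt (M - Mt) = M - Mt.
Let A := \matrix_(k < n, l < m) frob (tnth F k) (T l).
Let b := \col_(k < n) frob (tnth F k) (M - Mt).
Let y := mp_pinv A *m b.
Let X2 := Mt + \sum_(l < m) y l 0 *: T l.
(** The component of X2 - M orthogonal to E0, so that X2 - f is the orthogonal projection of X2 onto
    E. *)
Let f := \sum_(k < n) frob (tnth F k) (X2 - M) *: tnth F k.

Let combE (c : 'cV[R]_m) k : frob (tnth F k) (\sum_l c l 0 *: T l) = (A *m c) k 0.
Proof. by rewrite frob_sumr mxE; apply: eq_bigr => l _; rewrite frobZr mxE mulrC. Qed.

Let tanE X : nproj Mt X = 0 -> exists c : 'cV[R]_m, X = \sum_l c l 0 *: T l.
Proof.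
move=> X0; exists (\col_l frob (T l) X); have := hT X; rewrite X0 subr0 => {1}->.
by apply: eq_bigr => l _; rewrite mxE.
Qed.

Let X2_tangent : nproj Mt (X2 - Mt) = 0.
Proof.
rewrite /X2 addrC addKr linear_sum big1 // => l _.
by rewrite linearZ /= T0 scaler0.
Qed.

Let f_orth : forall e, e \in E0 -> frob f e = 0.
Proof.
move=> e eE0; rewrite frob_suml big1 // => k _; rewrite frobZl.
by have /(_ e eE0) -> := onb_mem k hF; rewrite mulr0.
Qed.

(** The normal equations of the second variant say that its residual f is orthogonal to every
    tangent vector. Being both normal at Mt and orthogonal to E0, f can be subtracted from X2
    without spoiling the Newton equations. *)
Let f_normal : nproj Mt f = f.
Proof.
suff h X : nproj Mt X = 0 -> frob f X = 0.
  have fX : frob f (f - nproj Mt f) = 0 by apply: h; rewrite linearB /= nproj_idem subrr.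
  apply/esym/eqP; rewrite -subr_eq0; apply/eqP; apply: frob_eq0.
  by rewrite frobBl fX nproj_adj linearB /= nproj_idem subrr frob0r subr0.
move=> /tanE[c ->]; rewrite frob_suml.
transitivity (frob (A *m y - b) (A *m c)); last by rewrite frobC frob_mull pinv_normal_eq frob0r.
rewrite frobE; apply: eq_bigr => k _; rewrite big_ord1 frobZl combE; congr (_ * _).
by rewrite /X2 addrAC addrC frobDr combE !mxE -[Mt - M]opprB frobNr.
Qed.

Let X3_affine : E (X2 - f).
Proof.
rewrite -[X2 - f](subrK M) addrC; apply: affine_addr => //.
apply: (orth_compl_mem hF) => k; rewrite addrAC frobBr frob_sumr (bigD1 k) //=.
have [orth _] := hF; rewrite frobZr orth eqxx mulr1 big1 ?addr0 ?subrr // => l lk.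
by rewrite frobZr orth eq_sym (negbTE lk) mulr0.
Qed.

(* X2 - Mt is orthogonal to E0 /\ T, and so are M - Mt (normal) and f (orthogonal to E0). *)
Lemma newton2_eqs : newton_eqs Mt M (X2 - f).
Proof.
split=> //.
  move=> e eE0; rewrite addrAC linearB /= X2_tangent sub0r f_normal frobNl f_orth ?oppr0 //.
move=> e eE0 e0; rewrite addrAC frobBl f_orth // subr0 -(subrKA Mt) frobDl.
have -> : frob (Mt - M) e = 0.
  by rewrite -opprB -normal frobNl nproj_adj e0 frob0r oppr0.
rewrite addr0 /X2 addrC addKr; have [c cE] := tanE e0; rewrite cE.
have Ac : A *m c = 0.
  apply/matrixP => k i; rewrite (ord1 i) -combE -cE mxE.
  by have /(_ e eE0) := onb_mem k hF.
rewrite -(pinv_row_space b Ac) [RHS]frobE frob_suml; apply: eq_bigr => l _.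
rewrite big_ord1 frobZl frob_sumr; congr (_ * _).
rewrite (bigD1 l) //= frobZr Torth eqxx mulr1 big1 ?addr0 // => k kl.
by rewrite frobZr Torth eq_sym (negbTE kl) mulr0.
Qed.

(** A common point Y of E and the tangent space writes f as a tangent vector X2 - Y plus elements of
    E0, and f is orthogonal to all of these. *)
Lemma newton2_meet Y : E Y -> nproj Mt (Y - Mt) = 0 -> f = 0.
Proof.
move=> EY Y0; apply: frob_eq0.
have fM : frob f (X2 - f - M) = 0 by apply: f_orth; exact: affine_subr.
have fY : frob f (X2 - Y) = 0.
  have e : X2 - Y = (X2 - Mt) - (Y - Mt) by mx_ring.
  by rewrite e -f_normal nproj_adj linearB /= X2_tangent Y0 subrr frob0r.
have YM : frob f (Y - M) = 0 by apply: f_orth; exact: affine_subr.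
have e : f = (X2 - Y) + (Y - M) - (X2 - f - M) by mx_ring.
by rewrite {2}e frobBr frobDr fM fY YM addr0 subr0.
Qed.

End Variant2.
End NewtonStep.

(** * Singular values *)

Section SingularValues.
Variable R : realType.

(** In a rank factorization P = C B, idempotence gives B C = 1, so tr P = tr (B C) is the rank. *)
Lemma trace_idem n (P : 'M[R]_n) : P *m P = P -> \tr P = (\rank P)%:R.
Proof.
move=> PP; have e : row_base P *m col_base P = 1%:M.
  apply: (row_full_inj (col_base_full P)); apply: (row_free_inj (row_base_free P)).
  by rewrite /= mulmx1 mulmxA !mulmx_base -mulmxA mulmx_base PP.
by rewrite -{1}[P]mulmx_base mxtrace_mulC e mxtrace1.
Qed.

(** Equality of the ranks upgrades the inclusion of the columns of Y in the range of P to an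
    equality, and an orthogonal projection is determined by its range. *)
Lemma colproj_eq p q (Y : 'M[R]_(p, q)) P : oproj_mx P -> P *m Y = Y -> \rank P = \rank Y ->
  colproj Y = P.
Proof.
move=> [sP iP] PY rk; have [sC _] := oproj_cols Y.
have sub : (Y^T <= P^T)%MS by rewrite -PY trmx_mul submxMl.
have /submxP[B] : (P^T <= Y^T)%MS by rewrite -(geq_leqif (mxrank_leqif_sup sub)) !mxrank_tr rk.
move=> /(congr1 trmx); rewrite trmx_mul !trmxK => PB.
have e : colproj Y *m P = P by rewrite PB mulmxA colprojK.
by rewrite -[RHS]sP -e trmx_mul sP sC /colproj mulmxA PY.
Qed.

Lemma mp_pinv_tr m n (A : 'M[R]_(m, n)) : mp_pinv A^T = (mp_pinv A)^T.
Proof.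
have [h1 h2 h3 h4] := mp_pinvP A.
apply: mp_pinvE; split; rewrite -!trmx_mul ?mulmxA ?h1 ?h2 //.
  by rewrite trmxK h4.
by rewrite trmxK h3.
Qed.

Lemma rowproj_tr p q (Y : 'M[R]_(p, q)) : rowproj Y = colproj Y^T.
Proof. by rewrite /rowproj /colproj mp_pinv_tr -trmx_mul; have [-> _] := oproj_rows Y. Qed.

Lemma pid_mulE m n r (A : 'M[R]_(m, n)) i j : (pid_mx r *m A) i j = (i < r)%N%:R * A i j.
Proof.
rewrite mxE (bigD1 i) //= mxE eqxx big1 ?addr0 // => k ki.
by rewrite mxE eq_sym val_eqE (negbTE ki) mul0r.
Qed.

Lemma mul_pidE m n r (A : 'M[R]_(m, n)) i j : (A *m pid_mx r) i j = (j < r)%N%:R * A i j.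
Proof.
rewrite mxE (bigD1 j) //= mxE eqxx mulrC big1 ?addr0 // => k kj.
by rewrite mxE val_eqE (negbTE kj) mulr0.
Qed.

Lemma copidE m n r (A : 'M[R]_(m, n)) i j :
  (copid_mx r *m A *m copid_mx r) i j = ((r <= i)%N && (r <= j)%N)%:R * A i j.
Proof.
have e (B : 'M[R]_(m, n)) : (copid_mx r *m B) i j = (r <= i)%N%:R * B i j.
  rewrite mulmxBl mul1mx [LHS]mxE [X in _ + X = _]mxE pid_mulE (leqNgt r i).
  by case: (i < r)%N; rewrite ?mul1r ?mul0r ?subrr ?subr0.
rewrite -mulmxA e mulmxBr mulmx1 [X in _ * X = _]mxE [X in _ * (_ + X) = _]mxE mul_pidE (leqNgt r i) (leqNgt r j).
by case: (i < r)%N; case: (j < r)%N; rewrite /= ?mul1r ?mul0r ?subrr ?subr0.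
Qed.

Section Outer.
Variables (p q : nat) (U : 'M[R]_p) (V : 'M[R]_q).
Hypotheses (UU : U^T *m U = 1%:M) (VV : V^T *m V = 1%:M).

Lemma frob_outer ij X : frob (outer U V ij) X = (U^T *m X *m V) ij.1 ij.2.
Proof.
rewrite /outer frob_mull frobE big_ord1 mxE; apply: eq_bigr => k _.
rewrite !mxE mulrC; congr (_ * _).
by apply: eq_bigr => l _; rewrite !mxE.
Qed.

Lemma outer_orth ij kl : frob (outer U V ij) (outer U V kl) = (ij == kl)%:R.
Proof.
case: ij kl => [i j] [k l]; rewrite frob_outer /outer /= tr_col rowE colE.
rewrite !mulmxA UU mul1mx -mulmxA VV mulmx1 mxE big_ord1 !mxE xpair_eqE !eqxx andbT ?[l == j]eq_sym.
by case: (i == k); case: (j == l); rewrite ?mulr1 ?mulr0.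
Qed.

Lemma sum_outer (Z : 'M[R]_(p, q)) : U *m Z *m V^T = \sum_ij Z ij.1 ij.2 *: outer U V ij.
Proof.
apply/matrixP => a b; rewrite mxE summxE.
under eq_bigr => k _ do rewrite !mxE mulr_suml.
rewrite exchange_big pair_big /=; apply: eq_bigr => -[i j] _ /=.
by rewrite /outer !mxE big_ord1 !mxE mulrCA mulrA.
Qed.

End Outer.

Section Truncation.
Variables (p q r : nat) (M : 'M[R]_(p, q)) (U : 'M[R]_p) (S : 'M[R]_(p, q)) (V : 'M[R]_q).
Hypothesis svd : is_svd M U S V.
Hypotheses (rp : (r <= p)%N) (rq : (r <= q)%N).
Let Y := svd_trunc r U S V.
Let Pu := U *m pid_mx r *m U^T.
Let Pv := V *m pid_mx r *m V^T.

Let UU : U^T *m U = 1%:M. Proof. by case: svd. Qed.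
Let VV : V^T *m V = 1%:M. Proof. by case: svd. Qed.

Let oproj_frame n (W : 'M[R]_n) : W^T *m W = 1%:M -> (r <= n)%N -> oproj_mx (W *m pid_mx r *m W^T).
Proof.
move=> WW rn; split; first by rewrite !trmx_mul trmxK tr_pid_mx mulmxA.
by rewrite !mulmxA -(mulmxA _ W^T) WW mulmx1 -(mulmxA W) pid_mx_id.
Qed.

Let truncE : Y = U *m pid_mx r *m S *m pid_mx r *m V^T.
Proof.
rewrite /Y /svd_trunc !trmx_mul tr_pid_mx !mulmxA.
rewrite -(mulmxA U) mul_pid_mx minnn minnn.
by rewrite -(mulmxA _ (pid_mx r) (pid_mx r)) mul_pid_mx minnn minnn.
Qed.

Let pid_diag : (pid_mx r : 'M[R]_p) *m S = S *m pid_mx r.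
Proof.
have [_ _ _ /is_diag_mxP dS _] := svd.
apply/matrixP => i j; rewrite pid_mulE mul_pidE.
have [eij|/eqP nij] := eqVneq (i : nat) j; first by rewrite eij.
by rewrite dS ?mulr0 //; apply/eqP.
Qed.

Lemma trunc_colE : Y = Pu *m M.
Proof.
have [-> _ _ _ _] := svd; rewrite truncE /Pu !mulmxA -(mulmxA _ U^T) UU mulmx1.
by rewrite -(mulmxA _ S) -pid_diag !mulmxA -(mulmxA U) pid_mx_id.
Qed.

Lemma trunc_rowE : Y = M *m Pv.
Proof.
have [-> _ _ _ _] := svd; rewrite truncE /Pv !mulmxA -(mulmxA _ V^T) VV mulmx1.
by rewrite -(mulmxA U) pid_diag !mulmxA -(mulmxA _ (pid_mx r) (pid_mx r)) pid_mx_id.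
Qed.

Lemma rank_trunc : (\rank Y <= r)%N.
Proof.
rewrite trunc_colE; apply: leq_trans (mxrankM_maxl _ _) _.
by rewrite /Pu -mulmxA; apply: leq_trans (mxrankM_maxr _ _) _; apply: leq_trans (mxrankM_maxl _ _) _; rewrite rank_pid_mx.
Qed.

(* Writing P for the orthogonal projection onto the columns of Z and p_i for the diagonal entries of
   U^T P U, the claim is sum_i p_i s_i^2 <= sum_(i < r) s_i^2, where 0 <= p_i <= 1 and sum_i p_i <= r. *)
Lemma trunc_optimal Z : (\rank Z <= r)%N -> fnorm (M - Y) <= fnorm (M - Z).
Proof.
move=> rZ; pose P := colproj Z; have hP : oproj_mx P := oproj_cols Z.
(* Since S is diagonal this is the square of the i-th singular value, and 0 for i >= q. *)
pose lam i := \sum_j S i j ^+ 2.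
have projE (Q : 'M[R]_p) : oproj_mx Q ->
    frob (Q *m M) (Q *m M) = \sum_i (U^T *m Q *m U) i i * lam i.
  move=> [sQ iQ]; have [ME _ _ /is_diag_mxP dS _] := svd.
  rewrite frob_mull sQ mulmxA iQ ME -(mulmxA U) frob_mull frobC !mulmxA frobC.
  rewrite frob_mulr trmxK -!mulmxA VV mulmx1 !mulmxA.
  rewrite frobE; apply: eq_bigr => i _; rewrite mulr_sumr; apply: eq_bigr => j _.
  have [eij|/eqP nij] := eqVneq (i : nat) j; last first.
    by rewrite dS ?mul0r ?expr0n ?mulr0 //; apply/eqP.
  rewrite [X in _ * X]mxE (bigD1 i) //= big1 ?addr0; last first.
    move=> k ki; rewrite [S k j]dS ?mulr0 //.
    by apply: contra ki => /eqP kj; apply/eqP/val_inj; rewrite /= eij -kj.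
  by rewrite mulrCA -expr2.
have diag_ge0 (Q : 'M[R]_p) i : oproj_mx Q -> 0 <= (U^T *m Q *m U) i i.
  move=> [sQ iQ]; rewrite -iQ -{1}sQ mulmxA -trmx_mul -mulmxA mxE.
  by apply: sumr_ge0 => k _; rewrite mxE -expr2 sqr_ge0.
have lam_ge0 i : 0 <= lam i by apply: sumr_ge0 => j _; exact: sqr_ge0.
have lam_dec (i i' : 'I_p) : (i <= i')%N -> lam i' <= lam i.
  move=> ii'; have [_ _ _ /is_diag_mxP dS [S0 Sdec]] := svd.
  have [qi|i'q] := leqP q i'.
    rewrite {1}/lam big1 // => j _; rewrite dS ?expr0n //.
    by rewrite neq_ltn orbC (leq_trans (ltn_ord j) qi).
  rewrite {1}/lam (bigD1 (Ordinal i'q)) //= big1 ?addr0; last first.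
    move=> j ji'; rewrite dS ?expr0n //; apply: contra ji' => /eqP e.
    by apply/eqP/val_inj; rewrite /= e.
  rewrite /lam (bigD1 (Ordinal (leq_ltn_trans ii' i'q))) //=.
  apply: le_trans (_ : S i (Ordinal (leq_ltn_trans ii' i'q)) ^+ 2 <= _).
    by rewrite lerXn2r ?nnegrE // Sdec.
  by rewrite lerDl sumr_ge0 // => j _; exact: sqr_ge0.
have le : frob (P *m M) (P *m M) <= frob (Pu *m M) (Pu *m M).
  rewrite !projE //; last exact: oproj_frame.
  have PuE : U^T *m Pu *m U = pid_mx r.
    by rewrite /Pu !mulmxA UU mul1mx -mulmxA UU mulmx1.
  rewrite PuE -subr_ge0 -sumrB.
  pose tau := if (insub r : option 'I_p) is Some i then lam i else 0.
  have tau_ge0 : 0 <= tau by rewrite /tau; case: insubP.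
  have tau_lo (i : 'I_p) : (i < r)%N -> tau <= lam i.
    by rewrite /tau; case: insubP => [k _ kr /ltnW ir|_ _ //]; apply: lam_dec; rewrite kr.
  have tau_hi (i : 'I_p) : (r <= i)%N -> lam i <= tau.
    rewrite /tau; case: insubP => [k _ kr ri|]; first by apply: lam_dec; rewrite kr.
    by rewrite -leqNgt => pr /(leq_trans pr); rewrite leqNgt ltn_ord.
  have trP : \sum_i (U^T *m P *m U) i i <= r%:R.
    rewrite -/(\tr _) mxtrace_mulC mulmxA (mulmx1C UU) mul1mx.
    rewrite trace_idem; last by case: hP.
    by rewrite ler_nat; apply: leq_trans (mxrankM_maxl _ _) rZ.
  have trr : \sum_i ((pid_mx r : 'M[R]_p) i i) = r%:R.
    rewrite -/(\tr _) trace_idem ?rank_pid_mx // pid_mx_id //.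
  apply: le_trans (_ : \sum_i ((pid_mx r : 'M[R]_p) i i - (U^T *m P *m U) i i) * tau <= _).
    by rewrite -mulr_suml sumrB trr mulr_ge0 // subr_ge0.
  apply: ler_sum => i _; rewrite -mulrBl.
  have := diag_ge0 _ i hP; have := diag_ge0 _ i (oproj_mxC hP).
  rewrite mulmxBr mulmxBl mulmx1 UU !mxE eqxx /= => h1 h0.
  case: (ltnP i r) => ir; rewrite eqxx /=.
    by rewrite ler_wpM2l ?tau_lo.
  by rewrite ler_wnM2l ?tau_hi // sub0r oppr_le0.
have h1 := frob_oproj_mx M (oproj_frame UU rp); rewrite -/Pu -trunc_colE in h1.
have h2 := frob_oproj_mx (M - Z) (oproj_mxC hP).
rewrite fnorm_le.
have h3 := frob_oproj_mx M hP.
(* As P fixes Z, |M - Z|^2 is at least |M - P M|^2 = |M|^2 - |P M|^2, while |M - Y|^2 = |M|^2 - |Pu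
   M|^2. *)
have e : (1%:M - P) *m (M - Z) = M - P *m M.
  by rewrite mulmxBr colprojC_mul subr0 mulmxBl mul1mx.
rewrite -trunc_colE in le.
have := frob_ge0 (M - Z - (1%:M - P) *m (M - Z)); rewrite e in h2 *; lra.
Qed.

Hypothesis rY : \rank Y = r.

Let rank_frame n (W : 'M[R]_n) : W^T *m W = 1%:M -> (r <= n)%N -> \rank (W *m pid_mx r *m W^T) = r.
Proof.
move=> WW rn; have /mulmx1_unit[Wt Wu] := WW.
rewrite mxrankMfree ?row_free_unit // -mxrank_tr trmx_mul mxrankMfree ?row_free_unit //.
by rewrite tr_pid_mx rank_pid_mx.
Qed.

Lemma trunc_colproj : colproj Y = Pu.
Proof.
apply: colproj_eq; first exact: oproj_frame.
  by rewrite trunc_colE mulmxA; have [_ ->] := oproj_frame UU rp.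
by rewrite rY rank_frame.
Qed.

Lemma trunc_rowproj : rowproj Y = Pv.
Proof.
rewrite rowproj_tr; apply: colproj_eq; first exact: oproj_frame.
  have [sPv iPv] := oproj_frame VV rq.
  have e : Y *m Pv = Y by rewrite trunc_rowE -mulmxA iPv.
  by rewrite -[in RHS]e [RHS]trmx_mul /Pv sPv.
by rewrite mxrank_tr rY rank_frame.
Qed.

Lemma trunc_normal : nproj Y (M - Y) = M - Y.
Proof.
have [_ iPu] := oproj_frame UU rp.
rewrite /nproj trunc_colproj trunc_rowproj {1}trunc_colE.
have -> : (1%:M - Pu) *m (M - Pu *m M) = M - Y.
  by rewrite mulmxBl mul1mx mulmxBr mulmxA iPu subrr subr0 trunc_colE.
rewrite mulmxBr mulmx1 mulmxBl -trunc_rowE.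
suff -> : Y *m Pv = Y by rewrite subrr subr0.
by rewrite -trunc_rowproj rowprojK.
Qed.

Let copid_frame n (W : 'M[R]_n) : W^T *m W = 1%:M ->
  1%:M - W *m pid_mx r *m W^T = W *m copid_mx r *m W^T.
Proof. by move=> WW; rewrite /copid_mx mulmxBr mulmxBl mulmx1 (mulmx1C WW). Qed.

(** In the orthonormal bases given by U and V, the operator N_Y keeps only the block with both
    indices at least r: the matrices N_k of the first variant form an orthonormal basis of the
    normal space. *)
Lemma trunc_nproj X :
  nproj Y X = \sum_(k < #|normal_idx p q r|) frob (outer U V (enum_val k)) X *: outer U V (enum_val k).
Proof.
rewrite /nproj trunc_colproj trunc_rowproj !copid_frame //.
transitivity (U *m (copid_mx r *m (U^T *m X *m V) *m copid_mx r) *m V^T); first by rewrite !mulmxA.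
rewrite sum_outer -(big_enum_val (fun ij => frob (outer U V ij) X *: outer U V ij)).
rewrite [RHS]big_mkcond /=; apply: eq_bigr => -[i j] _; rewrite inE frob_outer copidE /=.
by case: (_ && _); rewrite ?mul1r // mul0r scale0r.
Qed.

Lemma trunc_tproj X :
  X - nproj Y X = \sum_(k < #|tangent_idx p q r|) frob (outer U V (enum_val k)) X *: outer U V (enum_val k).
Proof.
have XE : \sum_ij frob (outer U V ij) X *: outer U V ij = X.
  transitivity (U *m (U^T *m X *m V) *m V^T); last first.
    by rewrite !mulmxA (mulmx1C UU) mul1mx -mulmxA (mulmx1C VV) mulmx1.
  by rewrite sum_outer; apply: eq_bigr => ij _; rewrite frob_outer.
rewrite trunc_nproj -!(big_enum_val (fun ij => frob (outer U V ij) X *: outer U V ij)).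
rewrite -{1}XE (bigID (mem (normal_idx p q r))) /= addrAC subrr add0r; apply: eq_bigl => ij.
by rewrite !inE negb_and -!ltnNge.
Qed.

Lemma trunc_tangent (k : 'I_#|tangent_idx p q r|) : nproj Y (outer U V (enum_val k)) = 0.
Proof.
have := enum_valP k; rewrite inE => hk.
rewrite trunc_nproj big1 // => l _; rewrite outer_orth //.
have := enum_valP l; rewrite inE => hl.
case: eqP => [e|_]; last by rewrite scale0r.
by move: hk; rewrite -e !ltnNge -negb_and hl.
Qed.

End Truncation.
End SingularValues.

(** * Nearest points *)

Section NearestPoints.
Variables (R : realType) (p q : nat).
Implicit Types (M X Y Z v w x y : 'M[R]_(p, q)) (S : set 'M[R]_(p, q)).

(** A competitor within k t^2 of X + t w yields t <M - X, w> <= c t^2; divide by t and let t tend to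
    0. Only approximate curves in S are required, so the competitors may come from [retract] or from
    limits of the iteration. *)
Lemma nearest_first_order S M X w (k t0 : R) : 0 < t0 -> 0 <= k ->
  (forall Y, S Y -> fnorm (M - X) <= fnorm (M - Y)) ->
  (forall t, 0 < t -> t < t0 -> exists2 z, S z & fnorm (z - (X + t *: w)) <= k * t ^+ 2) ->
  frob (M - X) w <= 0.
Proof.
move=> t00 k0 hX hz; set F := frob (M - X) w.
pose c := fnorm (M - X) * k + (fnorm w + k) ^+ 2.
have c0 : 0 <= c by rewrite addr_ge0 ?sqr_ge0 // mulr_ge0 ?fnorm_ge0.
have key t : 0 < t -> t < t0 -> t <= 1 -> F <= t * c.
  move=> t0' tt0 t1; have [z Sz zle] := hz t t0' tt0.
  set u := z - (X + t *: w) in zle.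
  have Me : M - z = (M - X) - (t *: w + u) by rewrite /u; mx_ring.
  have := hX z Sz; rewrite fnorm_le Me (frobBB (M - X) (t *: w + u)) (frobDr (M - X) (t *: w)) frobZr -/F.
  have uC := frob_CS (M - X) (- u); rewrite frobNr fnormN in uC.
  have wuC : fnorm (t *: w + u) <= t * (fnorm w + k).
    apply: le_trans (fnormD _ _) _; rewrite fnormZ gtr0_norm // mulrDr lerD2l.
    by apply: le_trans zle _; rewrite expr2 mulrA (mulrC k) -mulrA ler_wpM2l ?(ltW t0') // ler_piMr.
  have : frob (t *: w + u) (t *: w + u) <= t ^+ 2 * (fnorm w + k) ^+ 2.
    rewrite -sqr_fnorm -exprMn lerXn2r ?nnegrE ?fnorm_ge0 //.
    by rewrite mulr_ge0 ?(ltW t0') // addr_ge0 ?fnorm_ge0.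
  have uk : fnorm (M - X) * fnorm u <= fnorm (M - X) * k * t ^+ 2.
    by rewrite -mulrA ler_wpM2l ?fnorm_ge0.
  move=> h1 h2; rewrite -(ler_pM2l t0') /c.
  have sq0 : 0 <= t ^+ 2 * (fnorm w + k) ^+ 2 by rewrite mulr_ge0 ?sqr_ge0.
  lra.
apply/ler_addgt0Pr => e e0; rewrite add0r.
pose t := Num.min (t0 / 2) (Num.min 1 (e / (c + 1))).
have t0' : 0 < t by rewrite !lt_min ltr01 !divr_gt0 //; lra.
have tt0 : t < t0 by rewrite gt_min; apply/orP; left; lra.
have t1 : t <= 1 by rewrite !ge_min lexx orbT.
have te : t * (c + 1) <= e by rewrite -ler_pdivlMr ?ge_min ?lexx ?orbT //; lra.
by have := key t t0' tt0 t1; lra.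
Qed.

(** Here k bounds the curvature of the set at X. The cross term 2 <M - X, Y - X> is at most 2 k |M -
    X| |Y - X|^2, which is less than |Y - X|^2 when M is closer to X than 1 / (2 k). *)
Lemma nearest_second_order M X Y v (k : R) :
  frob (M - X) v = 0 -> fnorm (Y - X - v) <= k * fnorm (Y - X) ^+ 2 ->
  2 * k * fnorm (M - X) < 1 -> Y <> X -> fnorm (M - X) < fnorm (M - Y).
Proof.
move=> Xv Yv hk YX; rewrite ltNge fnorm_le -ltNge.
have -> : M - Y = (M - X) - (Y - X) by mx_ring.
rewrite (frobBB (M - X) (Y - X)).
have e : frob (M - X) (Y - X) = frob (M - X) (Y - X - v) by rewrite [RHS](frobBr (M - X) (Y - X)) Xv subr0.
have h := frob_CS (M - X) (Y - X - v).
have d0 : 0 < frob (Y - X) (Y - X).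
  by rewrite -sqr_fnorm exprn_gt0 // fnorm_gt0 // => /eqP; rewrite subr_eq0 => /eqP.
have h2 : fnorm (M - X) * fnorm (Y - X - v) <= fnorm (M - X) * (k * frob (Y - X) (Y - X)).
  by rewrite ler_wpM2l ?fnorm_ge0 // -sqr_fnorm.
have h3 : 2 * k * fnorm (M - X) * frob (Y - X) (Y - X) < frob (Y - X) (Y - X).
  by rewrite gtr_pMl.
rewrite e; lra.
Qed.

Lemma rank_closed r Y : (forall e : R, 0 < e -> exists2 Z, (\rank Z <= r)%N & fnorm (Y - Z) < e) ->
  (\rank Y <= r)%N.
Proof.
move=> h; have k0 : 0 < 2^-1 / (fnorm (mp_pinv Y) + 1) by rewrite divr_gt0 // ltr_wpDl ?fnorm_ge0.
have [Z rZ] := h _ k0; rewrite ltr_pdivlMr ?ltr_wpDl ?fnorm_ge0 // => YZ.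
apply: leq_trans (rank_near _) rZ; rewrite fnormB.
by apply: le_trans (ltW YZ); rewrite mulrC ler_wpM2l ?fnorm_ge0 // lerDl.
Qed.

Lemma affine_closed a (E0 : {vspace 'M[R]_(p, q)}) X :
  (forall e : R, 0 < e -> exists2 Z, affine_space a E0 Z & fnorm (X - Z) < e) ->
  affine_space a E0 X.
Proof.
move=> h; have [Y YE0 hY] := orth_decomp E0 (X - a).
suff w0 : X - a - Y = 0 by rewrite /affine_space /= -[X - a](subrK Y) w0 add0r.
set w := X - a - Y in hY *.
apply: fnorm_eq0; apply/eqP; rewrite eq_le fnorm_ge0 andbT.
apply/ler_addgt0Pr => e e0; rewrite add0r; have [Z EZ XZ] := h e e0.
have ww : frob w w = frob w (X - Z).
  have -> : X - Z = w + (Y - (Z - a)) by rewrite /w; mx_ring.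
  by rewrite frobDr [frob w (Y - _)]hY ?addr0 // memvB.
have := frob_CS w (X - Z); rewrite -ww -sqr_fnorm.
have := fnorm_ge0 w; nra.
Qed.

Lemma rank_manifold_local r x : \rank x = r -> exists K rho : R,
  [/\ 1 <= K, 0 < rho, forall M, fnorm (M - x) <= rho -> (r <= \rank M)%N
    & forall y, \rank y = r -> fnorm (y - x) <= rho -> fnorm (mp_pinv y) <= K].
Proof.
move=> rx; set k := fnorm (mp_pinv x); have k0 : 0 <= k by exact: fnorm_ge0.
have near M : fnorm (M - x) <= 2^-1 / (k + 1) -> k * fnorm (M - x) <= 2^-1.
  rewrite ler_pdivlMr ?ltr_wpDl // => h; have := fnorm_ge0 (M - x); nra.
exists (2 * k + 1), (2^-1 / (k + 1)); split; first lra.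
- by rewrite divr_gt0 // ltr_wpDl.
- by move=> M /near Mx; rewrite -rx; exact: rank_near Mx.
- move=> y ry /near yx; apply: le_trans (fnorm_pinv_near yx _) _; rewrite ?ry //.
  by rewrite lerDl.
Qed.

(** All that the algorithm uses at M about D_r. The last clause ranges over all decompositions,
    since the truncation might a priori depend on the one chosen. *)
Definition rank_good r M : Prop := exists Mt, [/\ is_proj (@rank_manifold R p q r) M Mt,
  nproj Mt (M - Mt) = M - Mt
  & forall U Sg V, is_svd M U Sg V -> svd_trunc r U Sg V = Mt].

Lemma retract_rank r x (K rho : R) y w :
  (forall M, fnorm (M - x) <= rho -> (r <= \rank M)%N) ->
  \rank y = r -> nproj y w = 0 -> fnorm (mp_pinv y) <= K ->
  fnorm (y + w - x) + K * fnorm w ^+ 2 <= rho ->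
  \rank (retract y w) = r.
Proof.
move=> hr ry nw yK le; apply/eqP; rewrite eqn_leq -{1}ry rank_retract hr //.
rewrite -(subrKA (y + w)) addrC; apply: le_trans le; apply: fnormD_le => //.
apply: le_trans (fnorm_retract nw) _; by rewrite ler_wpM2r ?sqr_ge0.
Qed.

(** A nearest point X exists by compactness, satisfies the first order condition by retraction along
    tangent vectors, and is unique by the secant estimate. The truncation of any decomposition is
    optimal in rank at most r, and close enough to x to have rank exactly r, so it is X. *)
Lemma rank_good_near r x : \rank x = r ->
  exists2 e : R, 0 < e & fball x e `<=` rank_good r.
Proof.
move=> rx; have [K [rho [K1 rho0 hr hK]]] := rank_manifold_local rx.
have [rp rq] : (r <= p)%N /\ (r <= q)%N by rewrite -rx rank_leq_row rank_leq_col.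
(* The first bound keeps all points no farther from M than x within rho / 2 of x; the second gives 2
   K |M - X| < 1 for [nearest_second_order]. *)
pose e := Num.min (rho / 4) ((8 * K)^-1).
have e0 : 0 < e by rewrite lt_min divr_gt0 // invr_gt0; lra.
have erho : e <= rho / 4 by rewrite ge_min lexx.
have eK : e * (8 * K) <= 1 by rewrite -ler_pdivlMr ?div1r ?ge_min ?lexx ?orbT //; lra.
exists e => // M; rewrite /fball /= fnormB => Mx.
have near Y : fnorm (M - Y) <= fnorm (M - x) -> fnorm (Y - x) <= rho / 2.
  move=> h; apply: le_trans (fnorm_tri M _ _) _; rewrite fnormB; lra.
have [X rX hX] : exists2 X, @rank_manifold R p q r X & forall Y, @rank_manifold R p q r Y -> fnorm (M - X) <= fnorm (M - Y).
  apply: (nearest_exists (X0 := x)) => // Y YM hY; apply/eqP; rewrite eqn_leq.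
  rewrite rank_closed ?hr //; first by apply: le_trans (near _ YM) _; lra.
  by move=> d /hY[Z rZ YZ]; exists Z => //; rewrite rZ.
have MX : fnorm (M - X) <= fnorm (M - x) by exact: hX.
have XK : fnorm (mp_pinv X) <= K by apply: hK => //; apply: le_trans (near _ MX) _; lra.
have half w : nproj X w = 0 -> frob (M - X) w <= 0.
  move=> nw; pose c := fnorm w + K * fnorm w ^+ 2.
  have c0 : 0 <= c by rewrite addr_ge0 ?fnorm_ge0 // mulr_ge0 ?sqr_ge0 //; lra.
  pose t0 := Num.min 1 (rho / 2 / (c + 1)).
  have t00 : 0 < t0 by rewrite lt_min ltr01 !divr_gt0 //; lra.
  apply: (nearest_first_order (S := rank_manifold r) (k := K * fnorm w ^+ 2) t00) => //.
    by rewrite mulr_ge0 ?sqr_ge0 //; lra.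
  move=> t tp; rewrite lt_min => /andP[t1]; rewrite ltr_pdivlMr; last by lra.
  move=> tc; have nt : nproj X (t *: w) = 0 by rewrite linearZ /= nw scaler0.
  have tw : fnorm (t *: w) = t * fnorm w by rewrite fnormZ gtr0_norm.
  exists (retract X (t *: w)).
    apply: (retract_rank (x := x) (K := K) (rho := rho)) => //; rewrite tw.
    have : fnorm (X + t *: w - x) <= fnorm (X - x) + t * fnorm w.
      by rewrite addrAC -tw fnormD.
    have := near _ MX.
    have : K * (t * fnorm w) ^+ 2 <= t * (K * fnorm w ^+ 2).
      have t2 : t ^+ 2 <= t by rewrite expr2; nra.
      by rewrite exprMn mulrCA ler_wpM2r // mulr_ge0 ?sqr_ge0 //; lra.
    rewrite /c in tc; lra.
  apply: le_trans (fnorm_retract nt) _; rewrite tw exprMn mulrCA mulrA mulrC.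
  have : 0 <= t ^+ 2 * fnorm w ^+ 2 by rewrite mulr_ge0 ?sqr_ge0.
  nra.
have first w : nproj X w = 0 -> frob (M - X) w = 0.
  move=> nw; apply/eqP; rewrite eq_le half //= -oppr_le0 -frobNr half //.
  by rewrite linearN /= nw oppr0.
have hproj : is_proj (rank_manifold r) M X.
  split=> // Y rY YX; case: (leP (fnorm (M - Y)) (fnorm (M - X))) => // YM.
  have YK : fnorm (mp_pinv Y) <= K.
    by apply: hK => //; apply: le_trans (near _ (le_trans YM MX)) _; lra.
  suff : fnorm (M - X) < fnorm (M - Y) by rewrite ltNge YM.
  apply: (nearest_second_order (v := Y - X - nproj X (Y - X)) (k := K)) => //.
  - by apply: first; rewrite linearB /= nproj_idem subrr.
  - rewrite subKr; apply: le_trans (nproj_secant _ _) _.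
    by rewrite ler_wpM2r ?sqr_ge0.
  - have : fnorm (M - X) < e by exact: le_lt_trans Mx.
    have := fnorm_ge0 (M - X); nra.
exists X; split=> //.
  apply/esym/eqP; rewrite -subr_eq0; apply/eqP; apply: frob_eq0.
  have h : nproj X (M - X - nproj X (M - X)) = 0 by rewrite linearB /= nproj_idem subrr.
  by rewrite {1}frobBl first // nproj_adj h frob0r subrr.
move=> U Sg V svd; set Y := svd_trunc r U Sg V.
have YM Z : (\rank Z <= r)%N -> fnorm (M - Y) <= fnorm (M - Z) by exact: trunc_optimal.
have rY : \rank Y = r.
  apply/eqP; rewrite eqn_leq (rank_trunc svd) // hr //.
  by apply: le_trans (near Y (YM x _)) _; rewrite ?rx //; lra.
case: (eqVneq Y X) => [//|/eqP YX].
have := hproj.2 Y rY YX; rewrite ltNge YM // rX //.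
Qed.

End NearestPoints.

(** * Transversality *)

Section OrthogonalProjection.
Variables (R : realType) (p q : nat) (W : {vspace 'M[R]_(p, q)}).
Implicit Types (X Y Z : 'M[R]_(p, q)).

Definition oproj X : 'M[R]_(p, q) := projT1 (cid2 (orth_decomp W X)).

Lemma oproj_mem X : oproj X \in W.
Proof. by rewrite /oproj; case: cid2. Qed.

Lemma oproj_orth X Z : Z \in W -> frob (X - oproj X) Z = 0.
Proof. by rewrite /oproj; case: cid2 => Y /= _ h /h. Qed.

Lemma oproj_uniq X Y : Y \in W -> (forall Z, Z \in W -> frob (X - Y) Z = 0) -> oproj X = Y.
Proof.
move=> YW hY; apply/eqP; rewrite -subr_eq0; apply/eqP; apply: frob_eq0.
have dW : oproj X - Y \in W by rewrite memvB // oproj_mem.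
have e : oproj X - Y = (X - Y) - (X - oproj X) by mx_ring.
by rewrite {1}e frobBl hY // oproj_orth // subrr.
Qed.

Fact oproj_linear : linear oproj.
Proof.
move=> a X Y; apply: oproj_uniq; first by rewrite memvD ?memvZ ?oproj_mem.
move=> Z ZW; have -> : a *: X + Y - (a *: oproj X + oproj Y) = a *: (X - oproj X) + (Y - oproj Y) by mx_ring.
by rewrite frobDl frobZl !oproj_orth // mulr0 addr0.
Qed.
HB.instance Definition _ := GRing.isLinear.Build R 'M[R]_(p, q) 'M[R]_(p, q) _ oproj oproj_linear.

Lemma oproj_frob X Z : Z \in W -> frob (oproj X) Z = frob X Z.
Proof. by move=> ZW; have := oproj_orth X ZW; rewrite frobBl => /eqP; rewrite subr_eq0 => /eqP. Qed.

Lemma fnorm_oproj X : fnorm (oproj X) <= fnorm X.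
Proof.
have [->|n0] := eqVneq (oproj X) 0; first by rewrite fnorm0 fnorm_ge0.
have lt : 0 < fnorm (oproj X) by apply: fnorm_gt0; apply/eqP.
rewrite -(ler_pM2r lt) -expr2 sqr_fnorm oproj_frob ?oproj_mem // frob_CS //.
Qed.

End OrthogonalProjection.

Section Transversality.
Variables (R : realType) (p q : nat).
Implicit Types (M X Y Z v w n x e : 'M[R]_(p, q)).
Variable E0 : {vspace 'M[R]_(p, q)}.

Lemma linear_bounded (f : {linear 'M[R]_(p, q) -> 'M[R]_(p, q)}) :
  exists2 c : R, 0 < c & forall X, fnorm (f X) <= c * fnorm X.
Proof.
exists (\sum_i \sum_j fnorm (f (delta_mx i j)) + 1).
  by rewrite ltr_wpDl // !sumr_ge0 // => i _; rewrite sumr_ge0 // => j _; rewrite fnorm_ge0.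
move=> X; rewrite {1}[X]matrix_sum_delta linear_sum /=.
apply: le_trans (fnorm_sum _ _ _) _; rewrite mulrDl mul1r; apply: ler_wpDr; first exact: fnorm_ge0.
rewrite mulr_suml; apply: ler_sum => i _; rewrite linear_sum.
apply: le_trans (fnorm_sum _ _ _) _; rewrite mulr_suml; apply: ler_sum => j _.
by rewrite linearZ /= fnormZ mulrC ler_wpM2l ?fnorm_ge0 // fnorm_entry.
Qed.

(* Quantitative transversality: no normal vector at x is nearly orthogonal to E0. *)
Definition normal_bound x (kappa : R) := forall n, nproj x n = n -> fnorm n <= kappa * fnorm (oproj E0 n).

(** The codimension formula says E0 + T is the whole space. Split a normal n as n1 + n2 by a bounded
    linear map: then <n, n> = <n, n1> = <proj n, n1>, where proj n is the projection of n on E0, and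
    |n1| <= c |n|. *)
Lemma transversal_normal_bound r x : \rank x = r -> transversal_at E0 (@rank_manifold R p q r) x ->
  exists2 kappa, 1 <= kappa & normal_bound x kappa.
Proof.
move=> rx [T hT hcodim].
have full : (E0 + T)%VS = fullv.
  apply/eqP; rewrite eqEdim subvf /=.
  have := dimv_sum_cap E0 T; have := hcodim; rewrite /codimv.
  have := dimvS (subvf E0); have := dimvS (subvf T); have := dimvS (subvf (E0 :&: T)%VS).
  have := dimvS (capvSl E0 T).
  move: (\dim (E0 + T)) (\dim (E0 :&: T)) (\dim E0) (\dim T) (\dim {:'M[R]_(p, q)}) => a b c d f.
  lia.
have [c c0 hc] := linear_bounded (addv_pi1 E0 T).
exists (c + 1); first by lra.
move=> n nn.
have [n1 [n2 [n1E n2T nE n1c]]] : exists n1 n2, [/\ n1 \in E0, n2 \in T, n1 + n2 = n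
    & fnorm n1 <= c * fnorm n].
  exists (addv_pi1 E0 T n), (addv_pi2 E0 T n); split.
  - exact: memv_pi1.
  - exact: memv_pi2.
  - by rewrite addv_pi1_pi2 // full memvf.
  - exact: hc.
have nn2 : frob n n2 = 0.
  by rewrite -nn nproj_adj ((tangent_rank _ rx).1 ((hT n2).1 n2T)) frob0r.
have e : frob n n = frob (oproj E0 n) n1 by rewrite -{2}nE frobDr nn2 addr0 oproj_frob.
have h : fnorm n ^+ 2 <= fnorm (oproj E0 n) * (c * fnorm n).
  rewrite sqr_fnorm e; apply: le_trans (frob_CS _ _) _.
  by rewrite ler_wpM2l ?fnorm_ge0.
have [->|n0] := eqVneq n 0; first by rewrite fnorm0 mulr_ge0 ?fnorm_ge0 //; lra.
have lt : 0 < fnorm n by apply: fnorm_gt0; apply/eqP.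
rewrite -(ler_pM2r lt); have := fnorm_ge0 (oproj E0 n); nra.
Qed.

(** For n normal at y, let t be its tangential part at x. Then |t|^2 = <n, t> = <n, N_y t>, and
    [nproj_lip] makes this O(|y - x|) |n| |t|. So n is nearly normal at x, where the bound holds. *)
Lemma normal_bound_near x (kappa K rho : R) r : \rank x = r -> 0 < rho -> 1 <= K -> 1 <= kappa ->
  (forall y, \rank y = r -> fnorm (y - x) <= rho -> fnorm (mp_pinv y) <= K) ->
  normal_bound x kappa ->
  exists2 rho', 0 < rho' & forall y, \rank y = r -> fnorm (y - x) <= rho' -> normal_bound y (2 * kappa).
Proof.
move=> rx rho0 K1 k1 hK hx.
(* This radius gives |t| <= |n| / (4 kappa); the two occurrences of t then cost at most half of |n|,
   which doubles kappa. *)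
exists ((8 * K * kappa)^-1); first by rewrite invr_gt0 !mulr_gt0 //; lra.
move=> y ry yx n nn.
have yx' : fnorm (y - x) * (8 * K * kappa) <= 1.
  by rewrite -ler_pdivlMr ?div1r // !mulr_gt0 //; lra.
pose t := n - nproj x n.
have t0 : nproj x t = 0 by rewrite linearB /= nproj_idem subrr.
have tt : frob t t = frob n t by rewrite {1}/t frobBl nproj_adj t0 frob0r subr0.
have tle : fnorm t <= 2 * K * fnorm (y - x) * fnorm n.
  have [->|tn0] := eqVneq t 0.
    by rewrite fnorm0 !mulr_ge0 ?fnorm_ge0 //; lra.
  have lt : 0 < fnorm t by apply: fnorm_gt0; apply/eqP.
  rewrite -(ler_pM2r lt) -expr2 sqr_fnorm tt -nn nproj_adj nn.
  apply: le_trans (frob_CS _ _) _.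
  have xK : fnorm (mp_pinv x) <= K by apply: hK => //; rewrite subrr fnorm0 ltW.
  have h := nproj_lip y t0; rewrite (fnormB x y) in h.
  have {}h : fnorm (nproj y t) <= 2 * K * fnorm (y - x) * fnorm t.
    apply: le_trans h _; do 2 rewrite ler_wpM2r ?fnorm_ge0 //.
    by rewrite ler_wpM2l.
  rewrite mulrC -[leRHS]mulrA [fnorm n * _]mulrC mulrA.
  by rewrite ler_wpM2r ?fnorm_ge0.
have e : n = nproj x n + t by rewrite /t addrC subrK.
have h1 := hx (nproj x n) (nproj_idem _ _).
have h2 : fnorm (oproj E0 (nproj x n)) <= fnorm (oproj E0 n) + fnorm t.
  have -> : nproj x n = n - t by rewrite {2}e addrK.
  rewrite linearB /=; apply: fnormD_le => //; rewrite fnormN; exact: fnorm_oproj.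
have h3 : fnorm n <= fnorm (nproj x n) + fnorm t by rewrite {1}e fnormD.
have h4 : kappa * fnorm t * 4 <= fnorm n.
  apply: le_trans (_ : kappa * (2 * K * fnorm (y - x) * fnorm n) * 4 <= _).
    by rewrite ler_wpM2r // ler_wpM2l //; lra.
  have := fnorm_ge0 n; have -> : kappa * (2 * K * fnorm (y - x) * fnorm n) * 4 =
    fnorm (y - x) * (8 * K * kappa) * fnorm n by ring.
  by move=> n0; rewrite ler_piMl.
have := fnorm_ge0 t; have := fnorm_ge0 (oproj E0 n); nra.
Qed.

(** A matrix orthogonal to E0 + T_x is normal with zero projection on E0, hence zero by the bound;
    so E0 + T_x is everything. *)
Lemma normal_bound_surj x (kappa : R) Z : normal_bound x kappa ->
  exists2 e, e \in E0 & nproj x (Z - e) = 0.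
Proof.
move=> hk; pose T := lker (linfun (nproj x)).
have TE X : (X \in T) = (nproj x X == 0) by rewrite memv_ker lfunE.
have [s sS hs] := orth_decomp (E0 + T)%VS Z.
set w := Z - s in hs.
have nw : nproj x w = w.
  have wT : w - nproj x w \in T by rewrite TE linearB /= nproj_idem subrr.
  apply/esym/eqP; rewrite -subr_eq0; apply/eqP; apply: frob_eq0.
  rewrite {1}frobBl hs ?(subvP (addvSr E0 T)) // nproj_adj.
  by move: wT; rewrite TE => /eqP ->; rewrite frob0r subr0.
have ow : oproj E0 w = 0.
  apply: oproj_uniq; first exact: mem0v.
  by move=> e eE0; rewrite subr0 hs // (subvP (addvSl E0 T)).
have w0 : w = 0.
  by apply: fnorm_eq0; apply/eqP; rewrite eq_le fnorm_ge0 andbT; have := hk w nw; rewrite ow fnorm0 mulr0.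
have /memv_addP[e eE0 [t tT seq]] := sS.
exists e => //; have -> : Z - e = t.
  by have := w0; rewrite /w => /eqP; rewrite subr_eq0 => /eqP ->; rewrite seq addrC addKr.
by apply/eqP; rewrite -TE.
Qed.

(** Inside E0, the orthogonal complement of E0 /\ T_x is the projection on E0 of the normal space.
    If e1 is the component of v there, coming from the normal vector n, then |e1|^2 = <n, N_x e1> <=
    kappa |e1| |N_x e1|, and N_x e1 = N_x v. *)
Lemma normal_bound_split x (kappa : R) v : normal_bound x kappa -> v \in E0 ->
  exists2 w, w \in E0 /\ nproj x w = 0 & fnorm (v - w) <= kappa * fnorm (nproj x v).
Proof.
move=> hk vE0; pose N := linfun (nproj x); pose P := linfun (oproj E0).
have NE X : N X = nproj x X by rewrite lfunE.
have PE X : P X = oproj E0 X by rewrite lfunE.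
pose W := (P @: limg N)%VS.
have [e] := orth_decomp W v.
move=> /memv_imgP[n /memv_imgP[n' _ ->]]; rewrite NE PE => ->.
move: (nproj x n') (nproj_idem x n') => {}n nn hn.
pose g := v - oproj E0 n.
have gE0 : g \in E0 by rewrite memvB // oproj_mem.
have gN : nproj x g = 0.
  apply: frob_eq0; rewrite -nproj_sqr -(oproj_frob _ gE0) frobC.
  apply: hn; rewrite -PE -NE; apply: memv_img; exact: memv_img (memvf _).
exists g; first by split.
have -> : v - g = oproj E0 n by rewrite /g subKr.
have vn : nproj x v = nproj x (oproj E0 n).
  by apply/eqP; rewrite -subr_eq0 -linearB; apply/eqP; exact: gN.
rewrite vn; set e1 := oproj E0 n.
have h : fnorm e1 ^+ 2 <= fnorm (nproj x e1) * (kappa * fnorm e1).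
  rewrite sqr_fnorm {1}/e1 oproj_frob ?oproj_mem // -nn nproj_adj frobC.
  apply: le_trans (frob_CS _ _) _; rewrite ler_wpM2l ?fnorm_ge0 //; exact: hk.
have [e0|n0] := eqVneq e1 0; first by rewrite e0 linear0 fnorm0 mulr0.
have lt : 0 < fnorm e1 by apply: fnorm_gt0; apply/eqP.
by rewrite -(ler_pM2r lt) -expr2; apply: le_trans h _; apply: eq_ler; ring.
Qed.

End Transversality.

(** * Convergence *)

Section Convergence.
Variables (R : realType) (p q r : nat) (a : 'M[R]_(p, q)) (E0 : {vspace 'M[R]_(p, q)}).
Implicit Types (M X Y Z v w x y : 'M[R]_(p, q)).
Let E := affine_space a E0.
Let D := @rank_manifold R p q r.
Variables (zeta : 'M[R]_(p, q)) (K rho : R) (phi pi : 'M[R]_(p, q) -> 'M[R]_(p, q)).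
Hypotheses (Ez : E zeta) (Dz : D zeta) (K1 : 1 <= K) (rho0 : 0 < rho).
Hypothesis rank_lower : forall M, fnorm (M - zeta) <= rho -> (r <= \rank M)%N.
Hypothesis pinv_bound : forall x, D x -> fnorm (x - zeta) <= rho -> fnorm (mp_pinv x) <= K.
Hypothesis transv : forall x, D x -> fnorm (x - zeta) <= rho -> normal_bound E0 x K.
Hypothesis stepP : forall M, E M -> fnorm (M - zeta) < rho ->
  [/\ D (pi M), forall Y, D Y -> fnorm (M - pi M) <= fnorm (M - Y),
      nproj (pi M) (M - pi M) = M - pi M & newton_eqs a E0 (pi M) M (phi M)].

Ltac klra := move: (K1) (rho0) => ? ?; lra.
Ltac knra := move: (K1) (rho0) => ? ?; nra.

(** The retraction error K |v|^2 for a tangent step of length |v| <= (K + 1) [err M]. *)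
Let C := K * (K + 1) ^+ 2.
(** The first bound keeps the initial distance nu plus the total displacement 2 K nu below rho / 4;
    the second makes each step at least halve the error. *)
Let nu := Num.min (rho / (8 * (K + 1))) ((2 * C)^-1).
Let err M := fnorm (M - pi M).

Let C1 : 1 <= C. Proof. by rewrite mulr_ege1 // exprn_ege1 //; klra. Qed.
Let nu0 : 0 < nu.
Proof. by rewrite lt_min divr_gt0 ?invr_gt0 ?mulr_gt0 //; klra. Qed.
Let nu_rho : nu * (8 * (K + 1)) <= rho.
Proof. by rewrite -ler_pdivlMr ?ge_min ?lexx // mulr_gt0 //; klra. Qed.
Let nu_C : nu * (2 * C) <= 1.
Proof. by rewrite -ler_pdivlMr ?div1r ?ge_min ?lexx ?orbT // ?mulr_gt0 //; have := C1; klra. Qed.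
Let nu_rho16 : nu <= rho / 16.
Proof. by have := nu_rho; have := nu0; knra. Qed.

(** Transversality at pi M provides some e in E0 with M + e in the tangent space. Removing from e
    its part w along E0 /\ T leaves a displacement of size at most K [err M], and the Newton step is
    no longer than that. *)
Lemma newton_step_near M : E M -> fnorm (M - zeta) <= rho / 4 -> err M <= nu ->
  [/\ E (phi M), fnorm (phi M - M) <= K * err M, nproj (pi M) (phi M - pi M) = 0
    & exists2 e, e \in E0 & nproj (pi M) (M + e - pi M) = 0].
Proof.
move=> EM Mz Mnu; have [|DM Mmin Mn Mphi] := stepP EM; first by apply: le_lt_trans Mz _; klra.
have piz : fnorm (pi M - zeta) <= rho.
  apply: le_trans (fnorm_tri M _ _) _; rewrite fnormB -/(err M).
  have := nu_rho16; klra.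
have hb := transv DM piz.
have [e eE0 he] := normal_bound_surj (pi M - M) hb.
have [w [wE0 w0] ew] := normal_bound_split hb eE0.
have ne : nproj (pi M) e = - (M - pi M).
  have : nproj (pi M) (pi M - M - e) = - (M - pi M) - nproj (pi M) e.
    by rewrite linearB /= -(opprB M) linearN /= Mn.
  by rewrite he => /esym/eqP; rewrite subr_eq0 => /eqP ->.
have he' : nproj (pi M) (M + e - pi M) = 0.
  have -> : M + e - pi M = - (pi M - M - e) by mx_ring.
  by rewrite linearN /= he oppr0.
have T0 := newton_eqs_tangent Mphi (affine_addr EM eE0) he'.
have [Ephi _ orth] := Mphi; split=> //; last by exists e.
rewrite ne fnormN -/(err M) in ew; apply: le_trans ew.
set Y := M + (e - w).
have dE0 : Y - phi M \in E0 by apply: affine_subr Ephi; apply: affine_addr EM _; rewrite memvB.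
have d0 : nproj (pi M) (Y - phi M) = 0.
  have -> : Y - phi M = (M + e - pi M) - w - (phi M - pi M) by rewrite /Y; mx_ring.
  by rewrite linearB linearB /= he' w0 T0 !subr0.
have e1 : e - w = (phi M - M) + (Y - phi M) by rewrite /Y; mx_ring.
rewrite fnorm_le e1 (frobDD (phi M - M) (Y - phi M)) (orth (Y - phi M)) // mulr0 addr0 lerDl; exact: frob_ge0.
Qed.

(** The vector v = phi M - pi M is tangent at pi M, so its retraction is a point of D within K |v|^2
    of phi M; the nearest point of D is at least as close. *)
Lemma newton_err_sqr M : E M -> fnorm (M - zeta) <= rho / 4 -> err M <= nu ->
  err (phi M) <= C * err M ^+ 2.
Proof.
move=> EM Mz Mnu; have [Ephi phiM T0 _] := newton_step_near EM Mz Mnu.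
have [|DM _ _ _] := stepP EM; first by apply: le_lt_trans Mz _; klra.
have e0 : 0 <= err M by exact: fnorm_ge0.
have phiz : fnorm (phi M - zeta) <= rho / 2.
  apply: le_trans (fnorm_tri M _ _) _; have := nu_rho.
  have : K * err M <= K * nu by rewrite ler_wpM2l //; klra.
  have := nu0; knra.
have [|_ pmin _ _] := stepP Ephi; first by apply: le_lt_trans phiz _; klra.
set v := phi M - pi M in T0.
have vle : fnorm v <= (K + 1) * err M.
  apply: le_trans (fnorm_tri M _ _) _; rewrite -/(err M); klra.
have piz : fnorm (pi M - zeta) <= rho.
  by apply: le_trans (fnorm_tri M _ _) _; rewrite fnormB -/(err M); have := nu_rho16; klra.
have vC : K * fnorm v ^+ 2 <= C * err M ^+ 2.
  rewrite /C -mulrA -exprMn ler_wpM2l //; first by klra.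
  by rewrite lerXn2r ?nnegrE ?fnorm_ge0 // mulr_ge0 //; klra.
have Ce : C * err M ^+ 2 <= err M.
  have : C * err M <= 1 by have := nu_C; have := C1; knra.
  by rewrite expr2 mulrA => h; rewrite ler_piMl.
have vE : pi M + v = phi M by rewrite /v addrC subrK.
apply: le_trans (_ : fnorm (phi M - retract (pi M) v) <= _).
  apply: pmin; apply: (retract_rank (x := zeta) (K := K) (rho := rho)) => //.
    exact: pinv_bound.
  rewrite vE; apply: le_trans (lerD phiz (le_trans vC Ce)) _; have := nu_rho16; klra.
rewrite fnormB -vE; apply: le_trans (fnorm_retract T0) _; apply: le_trans vC.
by rewrite ler_wpM2r ?sqr_ge0 // pinv_bound.
Qed.

Section Iteration.
Variable M0 : 'M[R]_(p, q).
Hypotheses (EM0 : E M0) (M0z : fnorm (M0 - zeta) < nu).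
Let Ms i := iter i phi M0.

Let err0 : err M0 < nu.
Proof.
have [|_ h _ _] := stepP EM0; first by apply: lt_le_trans M0z _; have := nu_rho16; klra.
by apply: le_lt_trans (h _ Dz) M0z.
Qed.

Lemma newton_invariant i : [/\ E (Ms i), fnorm (Ms i - M0) <= 2 * K * nu * (1 - 2^-1 ^+ i)
  & err (Ms i) <= nu * 2^-1 ^+ i].
Proof.
elim: i => [|i [EMi Mi0 ei]].
  by rewrite /Ms /= expr0 !subrr mulr0 mulr1 fnorm0; split => //; exact: ltW.
have h0 : 0 <= (2^-1 : R) ^+ i by rewrite exprn_ge0 // invr_ge0.
have h1 : (2^-1 : R) ^+ i <= 1 by rewrite exprn_ile1 ?invr_ge0 // invf_le1 ?ler1n.
have ei' : err (Ms i) <= nu by apply: le_trans ei _; rewrite ler_piMr // ltW.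
have Miz : fnorm (Ms i - zeta) <= rho / 4.
  apply: le_trans (fnorm_tri M0 _ _) _.
  have : 2 * K * nu * (1 - 2^-1 ^+ i) <= 2 * K * nu.
    by rewrite ler_piMr ?gerBl // !mulr_ge0 //; have := nu0; klra.
  have := nu_rho; have := nu0; have := M0z; knra.
have [EMi1 Mi1 _ _] := newton_step_near EMi Miz ei'.
have e1 := newton_err_sqr EMi Miz ei'.
rewrite /Ms iterS; split=> //.
  apply: le_trans (fnorm_tri (Ms i) _ _) _; rewrite exprS.
  have : K * err (Ms i) <= K * (nu * 2^-1 ^+ i) by rewrite ler_wpM2l //; klra.
  rewrite -/(Ms i); klra.
rewrite -/(Ms i); apply: le_trans e1 _; rewrite [2^-1 ^+ i.+1]exprS.
have e0 : 0 <= err (Ms i) by exact: fnorm_ge0.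
have : C * err (Ms i) <= 2^-1 by have := nu_C; have := C1; knra.
rewrite expr2 mulrA => h; apply: le_trans (ler_wpM2r e0 h) _; klra.
Qed.

Lemma newton_near i : [/\ E (Ms i), fnorm (Ms i - zeta) <= rho / 4 & err (Ms i) <= nu].
Proof.
have [EMi Mi0 ei] := newton_invariant i; split => //.
  have h0 : 0 <= (2^-1 : R) ^+ i by rewrite exprn_ge0 // invr_ge0.
  apply: le_trans (fnorm_tri M0 _ _) _.
  have : 2 * K * nu * (1 - 2^-1 ^+ i) <= 2 * K * nu.
    by rewrite ler_piMr ?gerBl // !mulr_ge0 //; have := nu0; klra.
  have := nu_rho; have := nu0; have := M0z; knra.
have h1 : (2^-1 : R) ^+ i <= 1 by rewrite exprn_ile1 ?invr_ge0 // invf_le1 ?ler1n.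
by apply: le_trans ei _; rewrite ler_piMr // ltW.
Qed.

Let err_half i : err (Ms i.+1) <= err (Ms i) / 2.
Proof.
have [EMi Miz ei'] := newton_near i.
have e0 : 0 <= err (Ms i) by exact: fnorm_ge0.
have : C * err (Ms i) <= 2^-1 by have := nu_C; have := C1; knra.
have := newton_err_sqr EMi Miz ei'; rewrite /Ms iterS -/(Ms i) expr2 mulrA => h1 h2.
by apply: le_trans h1 _; rewrite mulrC ler_wpM2l.
Qed.

(** Halving gives [err] <= 2 ([err] - next [err]), so the step lengths are bounded by a telescoping
    sum. *)
Let tail i k : fnorm (Ms (i + k)%N - Ms i) <= 2 * K * (err (Ms i) - err (Ms (i + k)%N)).
Proof.
elim: k => [|k IH]; first by rewrite addn0 !subrr mulr0 fnorm0.
rewrite addnS; apply: le_trans (fnorm_tri (Ms (i + k)%N) _ _) _.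
have [EMi Miz ei'] := newton_near (i + k)%N.
have [_ h _ _] := newton_step_near EMi Miz ei'.
have {}h : fnorm (Ms (i + k).+1 - Ms (i + k)%N) <= K * err (Ms (i + k)%N) := h.
have K0 : 0 <= K by klra.
by have := ler_wpM2l K0 (err_half (i + k)%N); lra.
Qed.

(** The error and the distance to the limit are comparable: the distance is at most 2 K times the
    error by [tail], and the error is at most the distance because the limit lies in D. Quadratic
    decrease of the error thus carries over to the distance. *)
Lemma newton_limit : exists Minf, [/\ E Minf, D Minf, Ms @ \oo --> Minf,
  forall i, fnorm (Ms i - Minf) <= 2 * K * err (Ms i)
  & forall i, fnorm (Ms i.+1 - Minf) <= 2 * K * C * fnorm (Ms i - Minf) ^+ 2].
Proof.
have [Minf lim] : exists X, Ms @ \oo --> X.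
  apply: (fnorm_geometric_cvg (c := K * nu)) => n.
  have [EMi Miz ei'] := newton_near n; have [_ _ en] := newton_invariant n.
  have [_ h _ _] := newton_step_near EMi Miz ei'.
  by apply: le_trans h _; rewrite -mulrA ler_wpM2l //; klra.
have lim' := (cvg_fnorm _ _).1 lim.
have dist i : fnorm (Ms i - Minf) <= 2 * K * err (Ms i).
  apply/ler_addgt0Pr => e e0; have [N hN] := lim' e e0.
  have h1 := hN (i + N)%N (leq_addl _ _); rewrite fnormB in h1.
  have h2 := tail i N; rewrite fnormB in h2.
  have h3 := fnorm_tri (Ms (i + N)%N) (Ms i) Minf.
  have : 0 <= K * err (Ms (i + N)%N) by rewrite mulr_ge0 ?fnorm_ge0 //; klra.
  lra.
have EMinf : E Minf.
  by apply: affine_closed => e /lim'[N hN]; exists (Ms N); [case: (newton_near N)|exact: hN].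
have err_lim e : 0 < e -> exists N, err (Ms N) < e.
  move=> e0; have : (fun n => nu * 2^-1 ^+ n) @ \oo --> (nu * 0 : R).
    by apply: cvgMr; apply: cvg_expr; rewrite ger0_norm; klra.
  move/cvgrPdist_lt => /(_ e e0)[N _ hN]; exists N.
  have [_ _ en] := newton_invariant N; apply: le_lt_trans en _.
  by have := hN N (leqnn N); rewrite mulr0 sub0r normrN; apply: le_lt_trans (ler_norm _).
have DMinf : D Minf.
  apply/eqP; rewrite eqn_leq rank_lower ?andbT.
    apply: rank_closed => e e0.
    have [N hN] := err_lim (e / (2 * K + 1)) ltac:(by rewrite divr_gt0 //; klra).
    have [EMi Miz ei'] := newton_near N.
    have [|DM _ _ _] := stepP EMi; first by apply: le_lt_trans Miz _; klra.
    exists (pi (Ms N)); first by rewrite DM.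
    move: hN; rewrite ltr_pdivlMr; last by klra.
    apply: le_lt_trans; apply: le_trans (fnorm_tri (Ms N) _ _) _.
    by have := dist N; rewrite (fnormB (Ms N)) -/(err _); klra.
  apply: le_trans (fnorm_tri (Ms 0%N) _ _) _; rewrite fnormB.
  have := dist 0%N; rewrite /Ms /=.
  have : K * err M0 <= K * nu by rewrite ler_wpM2l ?(ltW err0) //; klra.
  have := nu_rho; have := nu0; have := M0z; knra.
exists Minf; split=> // i.
have [EMi Miz ei'] := newton_near i.
have [|_ pmin _ _] := stepP EMi; first by apply: le_lt_trans Miz _; klra.
have h1 := newton_err_sqr EMi Miz ei'; have h2 := dist i.+1.
have h3 : err (Ms i) <= fnorm (Ms i - Minf) by exact: pmin.
have h4 : err (Ms i) ^+ 2 <= fnorm (Ms i - Minf) ^+ 2 by rewrite lerXn2r ?nnegrE ?fnorm_ge0.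
apply: le_trans h2 _; rewrite -[leRHS]mulrA ler_wpM2l //; first by klra.
by apply: le_trans h1 _; rewrite ler_wpM2l //; have := C1; klra.
Qed.

End Iteration.

(** A substitute for a retraction onto E /\ D: running the iteration from X reaches E /\ D within a
    multiple of the distance from X to D alone. *)
Lemma lift_near X : E X -> fnorm (X - zeta) < nu ->
  exists2 Y, (E `&` D) Y & forall Z, D Z -> fnorm (Y - X) <= 2 * K * fnorm (X - Z).
Proof.
move=> EX Xz; have [Y [EY DY _ h _]] := newton_limit EX Xz.
exists Y => // Z DZ; rewrite fnormB; apply: le_trans (h 0%N) _.
rewrite ler_wpM2l //; first by klra.
have [|_ pmin _ _] := stepP EX; first by apply: lt_le_trans Xz _; have := nu_rho16; klra.
exact: pmin.
Qed.

(** Small enough for points near the nearest point Z to be admissible starts of the iteration, and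
    for 2 K^2 |M0 - Z| < 1 in [nearest_second_order]. *)
Let nu1 := Num.min (nu / 4) ((8 * K ^+ 2)^-1).
Let nu10 : 0 < nu1.
Proof. by rewrite lt_min divr_gt0 ?invr_gt0 ?mulr_gt0 ?exprn_gt0 //; klra. Qed.
Let nu1_nu : nu1 <= nu / 4. Proof. by rewrite ge_min lexx. Qed.
Let nu1_K : nu1 * (8 * K ^+ 2) <= 1.
Proof. by rewrite -ler_pdivlMr ?div1r ?ge_min ?lexx ?orbT // mulr_gt0 ?exprn_gt0 //; klra. Qed.

Lemma nearest_meet M0 : E M0 -> fnorm (M0 - zeta) < nu1 -> exists Z,
  [/\ is_proj (E `&` D) M0 Z, fnorm (Z - zeta) <= 2 * nu1 &
      forall w, w \in E0 -> nproj Z w = 0 -> frob (M0 - Z) w = 0].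
Proof.
move=> EM0 M0z.
have near Y : fnorm (M0 - Y) <= fnorm (M0 - zeta) -> fnorm (Y - zeta) <= 2 * nu1.
  move=> h; apply: le_trans (fnorm_tri M0 _ _) _; rewrite fnormB; klra.
have [Z [EZ DZ] hZ] : exists2 Z, (E `&` D) Z & forall Y, (E `&` D) Y -> fnorm (M0 - Z) <= fnorm (M0 - Y).
  apply: (nearest_exists (X0 := zeta)) => // Y YM hY; split.
    by apply: affine_closed => d /hY[Z [EZ _] YZ]; exists Z.
  apply/eqP; rewrite eqn_leq rank_closed ?rank_lower //.
    by apply: le_trans (near _ YM) _; have := nu_rho16; have := nu1_nu; klra.
  by move=> d /hY[Z [_ rZ] YZ]; exists Z => //; rewrite rZ.
have MZ : fnorm (M0 - Z) <= fnorm (M0 - zeta) by exact: hZ.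
have Zz := near _ MZ.
have Zrho : fnorm (Z - zeta) <= rho by have := nu_rho16; have := nu1_nu; klra.
have half w : w \in E0 -> nproj Z w = 0 -> frob (M0 - Z) w <= 0.
  move=> wE0 nw; pose c := fnorm w + K * fnorm w ^+ 2.
  have c0 : 0 <= c by rewrite addr_ge0 ?fnorm_ge0 // mulr_ge0 ?sqr_ge0 //; klra.
  pose t0 := Num.min 1 (nu / 2 / (c + 1)).
  have t00 : 0 < t0 by rewrite lt_min ltr01 !divr_gt0 //; klra.
  apply: (nearest_first_order (S := E `&` D) (k := 2 * K * (K * fnorm w ^+ 2)) t00) => //.
    by rewrite !mulr_ge0 ?fnorm_ge0 //; klra.
  move=> t tp; rewrite lt_min => /andP[t1]; rewrite ltr_pdivlMr; last by klra.
  move=> tc; have nt : nproj Z (t *: w) = 0 by rewrite linearZ /= nw scaler0.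
  have tw : fnorm (t *: w) = t * fnorm w by rewrite fnormZ gtr0_norm.
  have Ew : E (Z + t *: w) by apply: affine_addr => //; exact: memvZ.
  have Kw0 : 0 <= K * fnorm w ^+ 2 by rewrite mulr_ge0 ?sqr_ge0 //; klra.
  have Zw : fnorm (Z + t *: w - zeta) <= fnorm (Z - zeta) + t * fnorm w.
    by rewrite addrAC -tw fnormD.
  have tK : t * (K * fnorm w ^+ 2) <= t * (c + 1).
    by rewrite ler_wpM2l ?(ltW tp) // /c; have := fnorm_ge0 w; klra.
  have tF : t * fnorm w <= t * (c + 1) by rewrite ler_wpM2l ?(ltW tp) // /c; klra.
  have ZwN : fnorm (Z + t *: w - zeta) < nu by have := nu1_nu; klra.
  have [Y EDY hY] := lift_near Ew ZwN.
  have t2 : K * (t * fnorm w) ^+ 2 <= t * (K * fnorm w ^+ 2).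
    have : t ^+ 2 <= t by rewrite expr2; knra.
    by move=> t2; rewrite exprMn mulrCA ler_wpM2r.
  (* Retracting t w at Z gives a point of D within K |t w|^2 of Z + t w, so the lifted point Y of E
     /\ D is within 2 K times that. *)
  exists Y => //; apply: le_trans (hY (retract Z (t *: w)) _) _.
    apply: (retract_rank (x := zeta) (K := K) (rho := rho)) => //; first exact: pinv_bound.
    by rewrite tw; have := nu_rho16; klra.
  rewrite -!mulrA ler_wpM2l // ler_wpM2l //; first by klra.
  rewrite fnormB; apply: le_trans (fnorm_retract nt) _; rewrite tw exprMn mulrC mulrAC mulrA.
  have h := pinv_bound DZ Zrho; have : 0 <= t ^+ 2 * fnorm w ^+ 2 by rewrite mulr_ge0 ?sqr_ge0.
  knra.
have first w : w \in E0 -> nproj Z w = 0 -> frob (M0 - Z) w = 0.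
  move=> wE0 nw; apply/eqP; rewrite eq_le half //= -oppr_le0 -frobNr half ?memvN //.
  by rewrite linearN /= nw oppr0.
exists Z; split=> //; split=> // Y [EY DY] YZ.
case: (leP (fnorm (M0 - Y)) (fnorm (M0 - Z))) => // YM.
suff : fnorm (M0 - Z) < fnorm (M0 - Y) by rewrite ltNge YM.
have Yrho : fnorm (Y - zeta) <= rho.
  by apply: le_trans (near _ (le_trans YM MZ)) _; have := nu_rho16; have := nu1_nu; klra.
(* The curvature constant of E /\ D at Z is K^2: one factor K from this splitting, the other from
   the secant estimate. *)
have [w [wE0 w0] hw] := normal_bound_split (transv DZ Zrho) (affine_subr EY EZ).
apply: (nearest_second_order (v := w) (k := K ^+ 2)) => //; first exact: first.
  apply: le_trans hw _; rewrite expr2 -mulrA ler_wpM2l //; first by klra.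
  apply: le_trans (nproj_secant _ _) _.
  by rewrite ler_wpM2r ?sqr_ge0 // pinv_bound.
have := nu1_K; have : fnorm (M0 - Z) < nu1 by exact: le_lt_trans M0z.
have := fnorm_ge0 (M0 - Z); have : 1 <= K ^+ 2 by rewrite expr2; knra.
knra.
Qed.

(** With v = phi M0 - Z, let w be its approximation in E0 /\ T_P, where P = pi M0, and w' that of w
    in E0 /\ T_Z. Then v - w = O(d^2) and w - w' = O(d |w|). As phi M0 - M0 is orthogonal to w and
    M0 - Z to w', |w|^2 = <M0 - Z, w - w'> + <w, w - v>, whence |w| = O(d^2). The constant 12 is 4
    for v - w plus 8 for w. *)
Lemma newton_first_step M0 Z : E M0 -> fnorm (M0 - zeta) < nu1 -> (E `&` D) Z ->
  fnorm (M0 - Z) <= fnorm (M0 - zeta) ->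
  (forall w, w \in E0 -> nproj Z w = 0 -> frob (M0 - Z) w = 0) ->
  fnorm (phi M0 - Z) <= 12 * K ^+ 2 * fnorm (M0 - Z) ^+ 2.
Proof.
move=> EM0 M0z [EZ DZ] MZ first; set d := fnorm (M0 - Z).
have d0 : 0 <= d by exact: fnorm_ge0.
have nr := nu_rho16; have nn := nu1_nu; have n0 := nu0.
have [|DM pmin _ Meqs] := stepP EM0; first by klra.
have ed : err M0 <= d by exact: pmin.
have M0z4 : fnorm (M0 - zeta) <= rho / 4 by klra.
have e0nu : err M0 <= nu by apply: le_trans ed _; rewrite /d; klra.
have [Ephi _ T0 _] := newton_step_near EM0 M0z4 e0nu.
have [_ _ orth] := Meqs.
have Zrho : fnorm (Z - zeta) <= rho.
  by apply: le_trans (fnorm_tri M0 _ _) _; rewrite fnormB; klra.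
have Prho : fnorm (pi M0 - zeta) <= rho.
  by apply: le_trans (fnorm_tri M0 _ _) _; rewrite fnormB -/(err M0); klra.
set P := pi M0 in DM T0 Prho orth *.
have ZP : fnorm (Z - P) <= 2 * d.
  apply: le_trans (fnorm_tri M0 _ _) _; rewrite fnormB -/d -/(err M0); klra.
have nZP : fnorm (nproj P (Z - P)) <= 4 * K * d ^+ 2.
  apply: le_trans (nproj_secant _ _) _.
  apply: le_trans (_ : K * (2 * d) ^+ 2 <= _); last by apply: eq_ler; ring.
  apply: ler_pM; rewrite ?fnorm_ge0 ?sqr_ge0 ?pinv_bound //.
  by rewrite lerXn2r ?nnegrE ?fnorm_ge0 // mulr_ge0.
set v := phi M0 - Z; have vE0 : v \in E0 by rewrite /v; exact: (affine_subr Ephi EZ).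
have [w [wE0 w0] hw] := normal_bound_split (transv DM Prho) vE0.
have {}hw : fnorm (v - w) <= 4 * K ^+ 2 * d ^+ 2.
  apply: le_trans hw _; have -> : v = (phi M0 - P) - (Z - P) by rewrite /v; mx_ring.
  rewrite linearB /= T0 sub0r fnormN.
  have : K * fnorm (nproj P (Z - P)) <= K * (4 * K * d ^+ 2) by rewrite ler_wpM2l //; klra.
  by move/le_trans; apply; apply: eq_ler; ring.
have [w' [w'E0 w'0] hw'] := normal_bound_split (transv DZ Zrho) wE0.
have {}hw' : fnorm (w - w') <= 4 * K ^+ 2 * d * fnorm w.
  apply: le_trans hw' _.
  have h := nproj_lip Z w0.
  have : fnorm (nproj Z w) <= 2 * K * (2 * d) * fnorm w.
    apply: le_trans h _; rewrite ler_wpM2r ?fnorm_ge0 // -!mulrA ler_wpM2l //.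
    by apply: ler_pM; rewrite ?fnorm_ge0 ?pinv_bound // fnormB.
  have K0 : 0 <= K := le_trans ler01 K1.
  by move=> /(ler_wpM2l K0) /le_trans; apply; apply: eq_ler; ring.
have ww : frob w w = frob (M0 - Z) (w - w') + frob w (w - v).
  have e : frob (M0 - Z) w = frob w v.
    have -> : v = (phi M0 - M0) + (M0 - Z) by rewrite /v; mx_ring.
    by rewrite (frobDr w) (frobC w (phi M0 - M0)) (orth w) // add0r frobC.
  by rewrite (frobBr (M0 - Z) w) (first w' w'E0 w'0) subr0 e (frobBr w w) addrC subrK.
have wle : fnorm w <= 8 * K ^+ 2 * d ^+ 2.
  have [e0|n0'] := eqVneq w 0; first by rewrite e0 fnorm0 !mulr_ge0 // ?(le_trans ler01 K1).
  have lt : 0 < fnorm w by apply: fnorm_gt0; apply/eqP.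
  rewrite -(ler_pM2r lt) -expr2 sqr_fnorm ww.
  have h1 := frob_CS (M0 - Z) (w - w'); have h2 := frob_CS w (w - v).
  rewrite -/d in h1; rewrite (fnormB w v) in h2.
  have h3 : d * fnorm (w - w') <= d * (4 * K ^+ 2 * d * fnorm w) by rewrite ler_wpM2l.
  have h4 : fnorm w * fnorm (v - w) <= fnorm w * (4 * K ^+ 2 * d ^+ 2) by rewrite ler_wpM2l ?fnorm_ge0.
  have -> : 8 * K ^+ 2 * d ^+ 2 * fnorm w = d * (4 * K ^+ 2 * d * fnorm w) + fnorm w * (4 * K ^+ 2 * d ^+ 2) by ring.
  by apply: lerD; [exact: le_trans h1 h3 | exact: le_trans h2 h4].
have -> : v = (v - w) + w by rewrite subrK.
by apply: le_trans (fnormD _ _) _; apply: le_trans (lerD hw wle) _; apply: eq_ler; ring.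
Qed.

Lemma fdist_proj (S : set 'M[R]_(p, q)) M Z : is_proj S M Z -> fdist M S = fnorm (M - Z).
Proof.
move=> [SZ hZ]; apply/eqP; rewrite eq_le; apply/andP; split.
  by apply: ge_inf; [exists 0 => _ [Y _ <-]; exact: fnorm_ge0 | exists Z].
apply: lb_le_inf; first by exists (fnorm (M - Z)), Z.
move=> _ [Y SY <-]; have [->|/eqP YZ] := eqVneq Y Z; first by [].
exact: ltW (hZ Y SY YZ).
Qed.

Lemma newton_quadratic : exists nu gamma gamma' : R, [/\ 0 < nu, 0 < gamma, 0 < gamma'
  & forall M0, E M0 -> fnorm (M0 - zeta) < nu ->
    let Ms := fun i : nat => iter i phi M0 in
    (forall i, [/\ E (Ms i), fnorm (Ms i - zeta) <= rho / 4
       & exists2 e, e \in E0 & nproj (pi (Ms i)) (Ms i + e - pi (Ms i)) = 0]) /\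
    exists Minf, [/\ (E `&` D) Minf, Ms @ \oo --> Minf,
      (forall i, fnorm (Ms i.+1 - Minf) <= gamma * fnorm (Ms i - Minf) ^+ 2)
      & exists2 Z, is_proj (E `&` D) M0 Z &
          fnorm (Z - Minf) <= gamma' * fdist M0 (E `&` D) ^+ 2]].
Proof.
(* The two terms of gamma' bound the distances from Z to M_1 and from M_1 to the limit, in units of
   d^2. *)
exists nu1, (2 * K * C), (12 * K ^+ 2 + 2 * K * C); split => //.
- by rewrite !mulr_gt0 //; klra.
- by rewrite addr_gt0 ?mulr_gt0 ?exprn_gt0 //; klra.
move=> M0 EM0 M0z Ms; have M0nu : fnorm (M0 - zeta) < nu.
  by apply: lt_le_trans M0z _; have := nu1_nu; have := nu0; klra.
split.
  move=> i; have [EMi Miz ei] := newton_near EM0 M0nu i; split=> //.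
  by have [_ _ _ h] := newton_step_near EMi Miz ei.
have [Minf [EMinf DMinf lim dist quad]] := newton_limit EM0 M0nu.
exists Minf; split=> //; have [Z [hZ Zz first]] := nearest_meet EM0 M0z.
have [EDZ minZ] := hZ.
exists Z => //; rewrite (fdist_proj hZ); set d := fnorm (M0 - Z).
have dz : d <= fnorm (M0 - zeta).
  have [zZ|/eqP zZ] := eqVneq zeta Z; first by rewrite /d zZ.
  by apply/ltW/minZ.
have h1 := newton_first_step EM0 M0z EDZ dz first; rewrite -/d in h1.
have [EM00 M00 e00] := newton_near EM0 M0nu 0%N.
have h2 := newton_err_sqr EM00 M00 e00; have h3 := dist 1%N.
have ed : err M0 <= d.
  have [|_ pmin _ _] := stepP EM0; first by have := nu_rho16; klra.
  by apply: pmin; case: EDZ.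
have h4 : err M0 ^+ 2 <= d ^+ 2 by rewrite lerXn2r ?nnegrE ?fnorm_ge0.
apply: le_trans (fnorm_tri (phi M0) _ _) _; rewrite (fnormB Z) mulrDl; apply: lerD => //.
apply: le_trans h3 _; rewrite -[leRHS]mulrA ler_wpM2l //; first by klra.
by apply: le_trans h2 _; rewrite ler_wpM2l //; have := C1; klra.
Qed.

End Convergence.

(** * Operation counts *)

Section StraightLine.
Variables (R : realType) (I : Type).
Let fn := (I -> R) -> R.
Implicit Types (G H : set fn) (f g : fn).

(* [reach H n G]: at most n arithmetic operations produce all the functions in H from those in G,
   every intermediate result being kept. *)
Inductive reach H : nat -> set fn -> Prop :=
  | reach_done n G of H `<=` G : reach H n G
  | reach_op n G o f g of G f & G g &
      reach H n (G `|` [set fun x => eval_op o (f x) (g x)]) : reach H n.+1 G.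

Lemma reach_sub H n G G' : G `<=` G' -> reach H n G -> reach H n G'.
Proof.
move=> GG' h; elim: h G' GG' => {n G} [n G HG|n G o f g Gf Gg _ IH] G' GG'.
  by apply: reach_done; exact: subset_trans GG'.
apply: (reach_op (o := o) (GG' _ Gf) (GG' _ Gg)); apply: IH; exact: setSU.
Qed.

Lemma reach_leq H n m G : (n <= m)%N -> reach H n G -> reach H m G.
Proof.
move=> nm h; elim: h m nm => {n G} [n G HG|n G o f g Gf Gg _ IH] m nm.
  exact: reach_done.
by case: m nm => // m nm; apply: (reach_op (o := o) Gf Gg); exact: IH.
Qed.

Lemma reach_trans H' H n m G : reach H' n G -> reach H m (G `|` H') -> reach H (n + m) G.
Proof.
move=> h; elim: h => {n G} [n G HG|n G o f g Gf Gg _ IH] hm.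
  apply: reach_leq (leq_addl _ _) _; apply: reach_sub hm.
  by move=> f [//|/HG].
apply: (reach_op (o := o) Gf Gg); apply: IH; apply: reach_sub hm.
by move=> k [Gk|Hk]; [left; left|right].
Qed.

Lemma reach_cover H' H n G : H `<=` H' -> reach H' n G -> reach H n G.
Proof.
move=> HH' h; rewrite -[n]addn0; apply: reach_trans h _.
by apply: reach_done => f /HH'; right.
Qed.

Lemma reach_ext H' H n G : H = H' -> reach H' n G -> reach H n G.
Proof. by move->. Qed.

Lemma reach1 o f g G : G f -> G g -> reach [set fun x => eval_op o (f x) (g x)] 1 G.
Proof. by move=> Gf Gg; apply: (reach_op (o := o) Gf Gg); apply: reach_done => h; right. Qed.

Lemma reach_bigcup (T : finType) (Hs : T -> set fn) c G :
  (forall t, reach (Hs t) c G) -> reach (\bigcup_t Hs t) (#|T| * c) G.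
Proof.
move=> h; rewrite cardE.
suff hs (s : seq T) : reach (\bigcup_(t in [set` s]) Hs t) (size s * c) G.
  apply: reach_cover (hs (enum T)) => f [t _ ft]; exists t => //=; exact: mem_enum.
elim: s => [|t s IH]; first by apply: reach_done => f [].
rewrite mulSn; apply: reach_trans (h t) _.
apply: (@reach_cover (Hs t `|` \bigcup_(t in [set` s]) Hs t)).
  move=> f [u /=]; rewrite inE => /orP[/eqP ->|us] fu; first by left.
  by right; exists u.
rewrite -[(size s * c)%N]addn0; apply: reach_trans.
  by apply: reach_sub IH => k; left.
by apply: reach_done => f [ft|ft]; [left; right|right].
Qed.

Lemma reach_scalar o f g h G : G f -> G g -> (forall x, h x = eval_op o (f x) (g x)) ->
  reach [set h] 1 G.
Proof. by move=> Gf Gg hE; have -> : h = _ := funext hE; exact: reach1. Qed.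

Definition consts : set fn := [set f | exists z : int, f = fun=> z%:~R].

Lemma reach_sum (T : finType) (F : T -> fn) G : consts `<=` G -> (forall t, G (F t)) ->
  reach [set fun x => \sum_t F t x] #|T| G.
Proof.
move=> cG FG; rewrite cardE /=.
apply: (@reach_ext [set fun x => \sum_(t <- enum T) F t x]).
  by congr [set _]; apply/funext => x; rewrite big_enum.
elim: (enum T) => [|t s IH] /=.
  apply: reach_done => f ->; apply: cG; exists 0; apply/funext => x; by rewrite big_nil.
rewrite -addn1; apply: reach_trans IH _.
apply: reach_ext (reach1 OpAdd (f := F t) (g := fun x => \sum_(t <- s) F t x) _ _).
- by congr [set _]; apply/funext => x; rewrite big_cons.
- by left.
- by right.
Qed.

Lemma reach_dot (T : finType) (F F' : T -> fn) G : consts `<=` G ->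
  (forall t, G (F t)) -> (forall t, G (F' t)) ->
  reach [set fun x => \sum_t F t x * F' t x] (2 * #|T|) G.
Proof.
move=> cG FG FG'; rewrite mul2n -addnn; apply: reach_trans.
  rewrite -[#|T|]muln1; apply: reach_bigcup (fun t => [set fun x => F t x * F' t x]) _ _ _ => t.
  exact: (reach1 OpMul).
apply: reach_sum; first by move=> f /cG; left.
by move=> t; right; exists t.
Qed.

Section Matrices.
Implicit Types m n k : nat.

Definition ents m n (A : (I -> R) -> 'M[R]_(m, n)) : set fn :=
  [set f | exists i j, f = fun x => A x i j].

Lemma ents_sub m n (A : (I -> R) -> 'M[R]_(m, n)) G :
  (forall i j, G (fun x => A x i j)) -> ents A `<=` G.
Proof. by move=> h f [i [j ->]]. Qed.

Lemma entsP m n (A : (I -> R) -> 'M[R]_(m, n)) G i j : ents A `<=` G -> G (fun x => A x i j).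
Proof. by apply; exists i, j. Qed.

Lemma ents_tr m n (A : (I -> R) -> 'M[R]_(m, n)) G : ents A `<=` G -> ents (fun x => (A x)^T) `<=` G.
Proof.
move=> h; apply: ents_sub => i j; have := entsP j i h.
by congr G; apply/funext => x; rewrite mxE.
Qed.

Lemma reach_ents m n (A : (I -> R) -> 'M[R]_(m, n)) c G :
  (forall i j, reach [set fun x => A x i j] c G) -> reach (ents A) (m * n * c) G.
Proof.
move=> h; have -> : (m * n = #|{: 'I_m * 'I_n}|)%N by rewrite card_prod !card_ord.
apply: reach_cover (reach_bigcup (fun ij => h ij.1 ij.2)).
by move=> f [i [j ->]]; exists (i, j).
Qed.

Lemma reach_entries_eq m n (A A' : (I -> R) -> 'M[R]_(m, n)) c G :
  (forall x, A x = A' x) -> reach (ents A') c G -> reach (ents A) c G.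
Proof. by move=> h; have -> : A = A' by apply/funext. Qed.

Lemma reach_map2 o m n (A B C : (I -> R) -> 'M[R]_(m, n)) G :
  ents A `<=` G -> ents B `<=` G -> (forall x i j, C x i j = eval_op o (A x i j) (B x i j)) ->
  reach (ents C) (m * n) G.
Proof.
move=> hA hB hC; rewrite -[(m * n)%N]muln1; apply: reach_ents => i j.
apply: reach_ext (reach1 o (entsP i j hA) (entsP i j hB)).
by congr [set _]; apply/funext => x.
Qed.

Lemma reach_add m n (A B : (I -> R) -> 'M[R]_(m, n)) G :
  ents A `<=` G -> ents B `<=` G -> reach (ents (fun x => A x + B x)) (m * n) G.
Proof. by move=> hA hB; apply: (reach_map2 (o := OpAdd) hA hB) => x i j; rewrite mxE. Qed.

Lemma reach_subm m n (A B : (I -> R) -> 'M[R]_(m, n)) G :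
  ents A `<=` G -> ents B `<=` G -> reach (ents (fun x => A x - B x)) (m * n) G.
Proof. by move=> hA hB; apply: (reach_map2 (o := OpSub) hA hB) => x i j; rewrite !mxE. Qed.

Lemma reach_mulm m n k (A : (I -> R) -> 'M[R]_(m, k)) (B : (I -> R) -> 'M[R]_(k, n)) G :
  consts `<=` G -> ents A `<=` G -> ents B `<=` G ->
  reach (ents (fun x => A x *m B x)) (m * n * (2 * k)) G.
Proof.
move=> cG hA hB; apply: reach_ents => i j; rewrite -{2}[k]card_ord.
apply: reach_ext (reach_dot (F := fun t x => A x i t) (F' := fun t x => B x t j) cG _ _).
- by congr [set _]; apply/funext => x; rewrite mxE.
- by move=> t; exact: entsP.
- by move=> t; exact: entsP.
Qed.

Lemma reach_frob m n (A B : (I -> R) -> 'M[R]_(m, n)) G :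
  consts `<=` G -> ents A `<=` G -> ents B `<=` G ->
  reach [set fun x => frob (A x) (B x)] (2 * (m * n)) G.
Proof.
move=> cG hA hB; have -> : (m * n = #|{: 'I_m * 'I_n}|)%N by rewrite card_prod !card_ord.
apply: reach_ext (reach_dot (F := fun t x => A x t.1 t.2) (F' := fun t x => B x t.1 t.2) cG _ _).
- by congr [set _]; apply/funext => x; rewrite frobE pair_big.
- by move=> t; exact: entsP.
- by move=> t; exact: entsP.
Qed.

Lemma reach_scale m n (s : fn) (A : (I -> R) -> 'M[R]_(m, n)) G :
  G s -> ents A `<=` G -> reach (ents (fun x => s x *: A x)) (m * n) G.
Proof.
move=> hs hA; rewrite -[(m * n)%N]muln1; apply: reach_ents => i j.
apply: reach_ext (reach1 OpMul hs (entsP i j hA)).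
by congr [set _]; apply/funext => x; rewrite mxE.
Qed.

Lemma reach_comb m n k (c : (I -> R) -> 'cV[R]_k) (A : 'I_k -> (I -> R) -> 'M[R]_(m, n)) G :
  consts `<=` G -> ents c `<=` G -> (forall l, ents (A l) `<=` G) ->
  reach (ents (fun x => \sum_l c x l 0 *: A l x)) (m * n * (2 * k)) G.
Proof.
move=> cG hc hA; apply: reach_ents => i j.
have <- : (2 * #|'I_k| = 2 * k)%N by rewrite card_ord.
apply: reach_ext (reach_dot (F := fun t x => c x t 0) (F' := fun t x => A t x i j) cG _ _).
- by congr [set _]; apply/funext => x; rewrite summxE; apply: eq_bigr => l _; rewrite mxE.
- by move=> t; exact: entsP.
- by move=> t; exact: entsP.
Qed.

Lemma union_left (H H' G : set fn) : H `<=` G -> H `<=` G `|` H'.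
Proof. by move=> h f /h; left. Qed.

Lemma union_right (H G : set fn) : H `<=` G `|` H.
Proof. by move=> f; right. Qed.

End Matrices.
End StraightLine.

Ltac avail := solve [ assumption | apply: union_right | apply: union_left; avail | apply: ents_tr; avail ].
Ltac availf := solve [ assumption | right; reflexivity | left; availf ].
(* Opaque names keep the searches above purely syntactic. *)
Ltac new_fun d dE t := pose d := t; assert (dE : forall x, d x = t x) by reflexivity; cbv beta in dE; clearbody d.

(** * Cost of pseudoinverses and of least squares *)

Section PinvCost.
Variables (R : realType) (I : Type).
Let fn := (I -> R) -> R.

Lemma reach_greville m n (A : (I -> R) -> 'M[R]_(m, n)) (B : (I -> R) -> 'M[R]_(n, m))
    (a : (I -> R) -> 'cV[R]_m) (G : set fn) : (0 < m)%N ->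
  @consts R I `<=` G -> ents A `<=` G -> ents B `<=` G -> ents a `<=` G ->
  reach (ents (fun x => greville_step (B x) (A x) (a x))) (11 * (m * n.+1)) G.
Proof.
move=> m0 cG hA hB ha.
have one : G (fun=> 1) by apply: cG; exists 1.
(* The summands are the costs of the instructions below, in their order. The five scalar operations
   are absorbed in m (n + 1) because m is positive. *)
apply: (@reach_leq _ _ _ (n * 1 * (2 * m) + (m * 1 * (2 * n) + (m * 1 + (1 * 1 * (2 * m) +
  (1 * 1 * (2 * n) + (1 * m * (2 * n) + (1 + (1 + (1 + (1 + (1 + (1 * m + (1 * m + (1 * m +
  (n * m * (2 * 1) + (n * m + 0))))))))))))))))); first by nia.
new_fun d dE (fun x => B x *m a x).
apply: (reach_trans (H' := ents d)); first by apply: reach_entries_eq dE _; apply: reach_mulm; avail.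
new_fun Ad AdE (fun x => A x *m d x).
apply: (reach_trans (H' := ents Ad)); first by apply: reach_entries_eq AdE _; apply: reach_mulm; avail.
new_fun c cE (fun x => a x - Ad x).
apply: (reach_trans (H' := ents c)); first by apply: reach_entries_eq cE _; apply: reach_subm; avail.
new_fun cc ccE (fun x => (c x)^T *m c x).
apply: (reach_trans (H' := ents cc)); first by apply: reach_entries_eq ccE _; apply: reach_mulm; avail.
new_fun dd ddE (fun x => (d x)^T *m d x).
apply: (reach_trans (H' := ents dd)); first by apply: reach_entries_eq ddE _; apply: reach_mulm; avail.
new_fun dB dBE (fun x => (d x)^T *m B x).
apply: (reach_trans (H' := ents dB)); first by apply: reach_entries_eq dBE _; apply: reach_mulm; avail.
match goal with |- reach _ _ ?X => set G1 := X end.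
have [cG1 hB1 hd1 hc1] : [/\ @consts R I `<=` G1, ents B `<=` G1, ents d `<=` G1 & ents c `<=` G1].
  by split; rewrite /G1; avail.
have hdB1 : ents dB `<=` G1 by rewrite /G1; avail.
have {}one : G1 (fun=> 1) by do 6 left.
have scc : G1 (fun x => cc x 0 0) by apply: (@entsP _ _ _ _ cc); rewrite /G1; avail.
have tdd : G1 (fun x => dd x 0 0) by apply: (@entsP _ _ _ _ dd); rewrite /G1; avail.
clearbody G1.
new_fun s sE (fun x => cc x 0 0); new_fun t tE (fun x => dd x 0 0).
have sG : G1 s by have -> : s = fun x => cc x 0 0 by exact/funext.
have tG : G1 t by have -> : t = fun x => dd x 0 0 by exact/funext.
clear scc tdd; new_fun o oE (fun _ : I -> R => 1 : R).
have {}one : G1 o by have -> : o = fun=> 1 by exact/funext.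
new_fun si siE (fun x => o x / s x).
apply: (reach_trans (H' := [set si])); first by apply: (reach_scalar (o := OpDiv) _ _ siE); availf.
new_fun ss ssE (fun x => s x / s x).
apply: (reach_trans (H' := [set ss])); first by apply: (reach_scalar (o := OpDiv) _ _ ssE); availf.
new_fun u uE (fun x => o x - ss x).
apply: (reach_trans (H' := [set u])); first by apply: (reach_scalar (o := OpSub) _ _ uE); availf.
new_fun t1 t1E (fun x => o x + t x).
apply: (reach_trans (H' := [set t1])); first by apply: (reach_scalar (o := OpAdd) _ _ t1E); availf.
new_fun e eE (fun x => u x / t1 x).
apply: (reach_trans (H' := [set e])); first by apply: (reach_scalar (o := OpDiv) _ _ eE); availf.
new_fun b1 b1E (fun x => si x *: (c x)^T).
apply: (reach_trans (H' := ents b1)); first by apply: reach_entries_eq b1E _; apply: reach_scale; [availf|avail].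
new_fun b2 b2E (fun x => e x *: dB x).
apply: (reach_trans (H' := ents b2)); first by apply: reach_entries_eq b2E _; apply: reach_scale; [availf|avail].
new_fun b bE (fun x => b1 x + b2 x).
apply: (reach_trans (H' := ents b)); first by apply: reach_entries_eq bE _; apply: reach_add; avail.
new_fun db dbE (fun x => d x *m b x).
apply: (reach_trans (H' := ents db)); first by apply: reach_entries_eq dbE _; apply: reach_mulm; avail.
new_fun Bdb BdbE (fun x => B x - db x).
apply: (reach_trans (H' := ents Bdb)); first by apply: reach_entries_eq BdbE _; apply: reach_subm; avail.
match goal with |- reach _ _ ?X => set G2 := X end.
have h1 : ents Bdb `<=` G2 by rewrite /G2; avail.
have h2 : ents b `<=` G2 by rewrite /G2; avail.
have gE x : greville_step (B x) (A x) (a x) = col_mx (Bdb x) (b x).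
  rewrite /greville_step /greville_row BdbE dbE bE b1E b2E eE uE t1E ssE siE oE sE tE ccE ddE dBE cE AdE dE.
  by rewrite div1r.
apply: reach_done; apply: ents_sub => i j.
case: (split_ordP i) => k ->.
  by have := entsP k j h1; congr G2; apply/funext => x; rewrite gE col_mxEu.
by have := entsP k j h2; congr G2; apply/funext => x; rewrite gE col_mxEd.
Qed.

Lemma reach_pinv m n (A : (I -> R) -> 'M[R]_(m, n)) (G : set fn) : (0 < m)%N ->
  @consts R I `<=` G -> ents A `<=` G ->
  reach (ents (fun x => mp_pinv (A x))) (11 * (m * n * n)) G.
Proof.
move=> m0 cG; elim: n A => [|n IH].
  by move=> A _; apply: reach_done; apply: ents_sub => -[].
rewrite -[n.+1]addn1 => A hA.
pose A1 x := lsubmx (A x); pose a x := rsubmx (A x).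
have hA1 : ents A1 `<=` G.
  apply: ents_sub => i j; have := entsP i (lshift 1 j) hA.
  by congr G; apply/funext => x; rewrite mxE.
have ha : ents a `<=` G.
  apply: ents_sub => i j; have := entsP i (rshift n j) hA.
  by congr G; apply/funext => x; rewrite mxE.
apply: (@reach_leq _ _ _ (11 * (m * n * n) + 11 * (m * n.+1))); first by nia.
apply: reach_trans (IH _ hA1) _.
apply: reach_entries_eq (reach_greville (A := A1) (B := fun x => mp_pinv (A1 x)) (a := a) _ _ _ _ _); try avail.
move=> x; apply: mp_pinvE; rewrite -{1}[A x]hsubmxK; apply: greville_penrose.
exact: mp_pinvP.
Qed.

(** The shared core of both variants. As d <= p q, the 11 m d^2 operations of the pseudoinverse fit
    in 11 p q m d; the matrix, the right-hand side, the product and the final combination contribute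
    2 each, which makes 19. *)
Lemma reach_least_squares p q m d (N : 'I_m -> (I -> R) -> 'M[R]_(p, q))
    (T : 'I_d -> (I -> R) -> 'M[R]_(p, q)) (X : (I -> R) -> 'M[R]_(p, q)) (G : set fn) :
  (0 < m)%N -> (0 < d)%N -> (d <= p * q)%N ->
  @consts R I `<=` G -> (forall k, ents (N k) `<=` G) -> (forall l, ents (T l) `<=` G) ->
  ents X `<=` G ->
  reach (ents (fun x =>
    let A := \matrix_(k < m, l < d) frob (N k x) (T l x) in
    let b := \col_(k < m) frob (N k x) (X x) in
    \sum_(l < d) (mp_pinv A *m b) l 0 *: T l x)) (19 * (p * q * m * d)) G.
Proof.
move=> m0 d0 dpq cG hN hT hX.
apply: (@reach_leq _ _ _ (m * d * (2 * (p * q)) + (m * 1 * (2 * (p * q)) + (11 * (m * d * d) +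
  (d * 1 * (2 * m) + p * q * (2 * d)))))).
  have h1 : (m * d * d <= m * d * (p * q))%N by rewrite leq_mul2l dpq orbT.
  have h2 : (d * m <= p * q * m * d)%N by rewrite mulnC -mulnA leq_pmull //; lia.
  have h3 : (m * (p * q) <= p * q * m * d)%N by rewrite (mulnC m) leq_pmulr.
  have h4 : (p * q * d <= p * q * m * d)%N by rewrite leq_mul2r leq_pmulr ?orbT.
  move: h1 h2 h3 h4; rewrite !mulnA; lia.
new_fun A AE (fun x => \matrix_(k < m, l < d) frob (N k x) (T l x) : 'M[R]_(m, d)).
apply: (reach_trans (H' := ents A)).
  apply: reach_ents => k l.
  apply: reach_ext (reach_frob cG (hN k) (hT l)).
  by congr [set _]; apply/funext => x; rewrite AE mxE.
new_fun b bE (fun x => \col_(k < m) frob (N k x) (X x) : 'cV[R]_m).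
apply: (reach_trans (H' := ents b)).
  apply: reach_ents => k l; have hNk := hN k.
  apply: reach_ext (reach_frob (A := N k) (B := X) _ _ _); try avail.
  by congr [set _]; apply/funext => x; rewrite bE mxE.
new_fun Ai AiE (fun x => mp_pinv (A x)).
apply: (reach_trans (H' := ents Ai)); first by apply: reach_entries_eq AiE _; apply: reach_pinv; avail.
new_fun y yE (fun x => Ai x *m b x).
apply: (reach_trans (H' := ents y)); first by apply: reach_entries_eq yE _; apply: reach_mulm; avail.
apply: reach_entries_eq (reach_comb (c := y) (A := T) _ _ _); try avail.
  by move=> x; rewrite /= yE AiE AE bE.
by move=> l; have hTl := hT l; avail.
Qed.

End PinvCost.

(** * From straight-line computations to programs *)

Section Compile.
Variables (R : realType) (I : Type).

Definition reg_below k (op : operand I) := if op is Reg j then (j < k)%N else true.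

(** Each operation writes in the fresh register k, so that earlier results, all held below k,
    survive as G grows. The tree is chosen before the input x, hence the register contents s are a
    function of x. *)
Lemma reach_run (O : Type) (out : O -> (I -> R) -> R) n G :
  reach [set f | exists o, f = out o] n G ->
  forall (s : (I -> R) -> nat -> R) k,
  (forall f, G f -> exists op, reg_below k op /\ forall x, eval_operand x (s x) op = f x) ->
  exists2 t : actree I O, (op_count t <= n)%N & forall x o, run_from x (s x) t o = out o x.
Proof.
elim=> {n G} [n G HG|n G o f g Gf Gg _ IH] s k hG.
  have hO u : exists op, forall x, eval_operand x (s x) op = out u x.
    by have [|op [_ opE]] := hG (out u); [apply: HG; exists u | exists op].
  have [w hw] := choice hO.
  by exists (Output w) => // x u; exact: hw.
have [opf [_ fE]] := hG f Gf; have [opg [_ gE]] := hG g Gg.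
pose s' x m := if m == k then eval_op o (f x) (g x) else s x m.
have [|t tn tE] := IH s' k.+1.
  move=> h [Gh|->]; last by exists (Reg I k); split=> //= x; rewrite /s' eqxx.
  have [op [opk opE]] := hG h Gh; exists op; split.
    by case: op opk {opE} => //= j; exact: ltnW.
  move=> x; rewrite -opE; case: op opk {opE} => //= j jk.
  by rewrite /s' (ltn_eqF jk).
exists (Arith o k opf opg t) => //= x u.
by rewrite -tE /= fE gE.
Qed.

Definition inputs : set ((I -> R) -> R) := [set f | (exists i, f = fun x => x i) \/ @consts R I f].

Lemma reach_program (p q : nat) (A : (I -> R) -> 'M[R]_(p, q)) n :
  reach (ents A) n inputs ->
  exists2 P : actree I ('I_p * 'I_q), (op_count P <= n)%N & forall x i j, run x P (i, j) = A x i j.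
Proof.
move=> h; have [||t tn tE] := @reach_run ('I_p * 'I_q) (fun ij x => A x ij.1 ij.2) n inputs _ (fun=> fun=> 0) 0.
- by apply: reach_cover h => f [[i j] ->]; exists i, j.
- move=> f [[i ->]|[z ->]]; [by exists (Inp i)|by exists (Cst I z)].
- by exists t => // x i j; rewrite /run tE.
Qed.

End Compile.

(** * Cost of the two variants *)

Section Variants.
Variables (R : realType) (p q r d : nat).
Hypotheses (rp : (r <= p)%N) (rq : (r <= q)%N).
Let I := slra_input p q d.
Let X := I -> R.

Definition inM (x : X) : 'M[R]_(p, q) := \matrix_(i, j) x (InM _ i j).
Definition inU (x : X) : 'M[R]_p := \matrix_(i, j) x (InU _ _ i j).
Definition inS (x : X) : 'M[R]_(p, q) := \matrix_(i, j) x (InS _ i j).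
Definition inV (x : X) : 'M[R]_q := \matrix_(i, j) x (InV _ _ i j).
Definition inEs (x : X) : d.-tuple 'M[R]_(p, q) := [tuple \matrix_(i, j) x (InE l i j) | l < d].
Definition inFs (x : X) : (p * q - d).-tuple 'M[R]_(p, q) := [tuple \matrix_(i, j) x (InF l i j) | l < p * q - d].

Section Values.
Variables (M : 'M[R]_(p, q)) (U : 'M[R]_p) (S : 'M[R]_(p, q)) (V : 'M[R]_q).
Variables (Es : d.-tuple 'M[R]_(p, q)) (Fs : (p * q - d).-tuple 'M[R]_(p, q)).
Let x := slra_input_val M U S V Es Fs.
Lemma inM_val : inM x = M. Proof. by apply/matrixP => i j; rewrite mxE. Qed.
Lemma inU_val : inU x = U. Proof. by apply/matrixP => i j; rewrite mxE. Qed.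
Lemma inS_val : inS x = S. Proof. by apply/matrixP => i j; rewrite mxE. Qed.
Lemma inV_val : inV x = V. Proof. by apply/matrixP => i j; rewrite mxE. Qed.
Lemma inEs_val : inEs x = Es.
Proof. by apply: eq_from_tnth => l; rewrite tnth_mktuple; apply/matrixP => i j; rewrite mxE. Qed.
Lemma inFs_val : inFs x = Fs.
Proof. by apply: eq_from_tnth => l; rewrite tnth_mktuple; apply/matrixP => i j; rewrite mxE. Qed.
End Values.

Lemma inputs_mx m n (A : X -> 'M[R]_(m, n)) (idx : 'I_m -> 'I_n -> I) :
  (forall x i j, A x i j = x (idx i j)) -> ents A `<=` @inputs R I.
Proof. by move=> h; apply: ents_sub => i j; left; exists (idx i j); apply/funext => x. Qed.

Lemma inputs_consts : @consts R I `<=` @inputs R I. Proof. by move=> f; right. Qed.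

Lemma mul_pid_widen m n (rn : (r <= n)%N) (A : 'M[R]_(m, n)) i (k : 'I_r) :
  (A *m (pid_mx r : 'M[R]_(n, r))) i k = A i (widen_ord rn k).
Proof.
rewrite mxE (bigD1 (widen_ord rn k)) //= mxE /= eqxx ltn_ord mulr1 big1 ?addr0 // => j jk.
by rewrite mxE; case: eqP => [e|_]; rewrite ?mulr0 //; case/eqP: jk; exact: val_inj.
Qed.

Lemma pid_mul_widen m n (rm : (r <= m)%N) (A : 'M[R]_(m, n)) (k : 'I_r) j :
  ((pid_mx r : 'M[R]_(r, m)) *m A) k j = A (widen_ord rm k) j.
Proof.
rewrite mxE (bigD1 (widen_ord rm k)) //= mxE /= eqxx ltn_ord mul1r big1 ?addr0 // => i ik.
by rewrite mxE; case: eqP => [e|_]; rewrite ?mul0r //; case/eqP: ik; exact: val_inj.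
Qed.

Variable G : set (X -> R).
Hypothesis iG : @inputs R I `<=` G.

(** Products with [pid_mx] only select entries of the input and are free. Two true products remain,
    costing 2 p r^2 and 2 p q r, and r <= q. *)
Lemma reach_trunc : reach (ents (fun x => svd_trunc r (inU x) (inS x) (inV x))) (4 * (p * q * r)) G.
Proof.
have cG : @consts R I `<=` G by apply: subset_trans iG; exact: inputs_consts.
have hU : ents (fun x => inU x *m (pid_mx r : 'M[R]_(p, r))) `<=` G.
  apply: subset_trans iG; apply: (inputs_mx (idx := fun i k => InU _ _ i (widen_ord rp k))) => x i k.
  by rewrite mul_pid_widen mxE.
have hV : ents (fun x => inV x *m (pid_mx r : 'M[R]_(q, r))) `<=` G.
  apply: subset_trans iG; apply: (inputs_mx (idx := fun i k => InV _ _ i (widen_ord rq k))) => x i k.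
  by rewrite mul_pid_widen mxE.
have hS : ents (fun x => (pid_mx r : 'M[R]_(r, p)) *m inS x *m (pid_mx r : 'M[R]_(q, r))) `<=` G.
  apply: subset_trans iG; apply: (inputs_mx (idx := fun i k => InS _ (widen_ord rp i) (widen_ord rq k))) => x i k.
  by rewrite mul_pid_widen pid_mul_widen mxE.
apply: (@reach_leq _ _ _ (p * r * (2 * r) + p * q * (2 * r))).
  have : (p * r * r <= p * r * q)%N by rewrite leq_mul2l rq orbT.
  by move: rp; nia.
new_fun Ur UrE (fun x => inU x *m (pid_mx r : 'M[R]_(p, r))).
new_fun Vr VrE (fun x => inV x *m (pid_mx r : 'M[R]_(q, r))).
new_fun Sr SrE (fun x => (pid_mx r : 'M[R]_(r, p)) *m inS x *m (pid_mx r : 'M[R]_(q, r))).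
have {}hU : ents Ur `<=` G by have -> : Ur = _ := funext UrE.
have {}hV : ents Vr `<=` G by have -> : Vr = _ := funext VrE.
have {}hS : ents Sr `<=` G by have -> : Sr = _ := funext SrE.
new_fun US USE (fun x => Ur x *m Sr x).
apply: (reach_trans (H' := ents US)); first by apply: reach_entries_eq USE _; apply: reach_mulm; avail.
apply: reach_entries_eq (reach_mulm (A := US) (B := fun x => (Vr x)^T) _ _ _); try avail.
by move=> x; rewrite /svd_trunc USE UrE SrE VrE.
Qed.

Lemma reach_outer m (idx : 'I_m -> 'I_p * 'I_q) :
  reach (\bigcup_k ents (fun x => outer (inU x) (inV x) (idx k))) (m * (p * q)) G.
Proof.
have <- : (#|'I_m| * (p * q) = m * (p * q))%N by rewrite card_ord.
apply: reach_bigcup => k; rewrite -[(p * q)%N]muln1.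
apply: reach_ents => i j.
apply: (reach_scalar (o := OpMul) (f := fun x => inU x i (idx k).1) (g := fun x => inV x j (idx k).2)).
- by apply: iG; left; exists (InU _ _ i (idx k).1); apply/funext => x; rewrite mxE.
- by apply: iG; left; exists (InV _ _ j (idx k).2); apply/funext => x; rewrite mxE.
- by move=> x; rewrite /outer mxE big_ord1 !mxE.
Qed.

Lemma card_ge_ord n : #|finset (fun i : 'I_n => r <= i)%N| = (n - r)%N.
Proof.
have -> : #|finset (fun i : 'I_n => r <= i)%N| = (\sum_(i < n) (r <= i))%N.
  by rewrite -sum1_card big_mkcond /=; apply: eq_bigr => i _; rewrite inE; case: (r <= i)%N.
elim: n => [|n IH]; first by rewrite big_ord0.
by rewrite big_ord_recr /= IH; case: leqP => rn; lia.
Qed.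

Lemma card_normal_idx : #|normal_idx p q r| = ((p - r) * (q - r))%N.
Proof.
rewrite -!card_ge_ord -cardsX; apply: eq_card => -[i j]; by rewrite !inE.
Qed.

Lemma card_tangent_idx : #|tangent_idx p q r| = ((p + q - r) * r)%N.
Proof.
have e : tangent_idx p q r = ~: normal_idx p q r.
  by apply/setP => -[i j]; rewrite !inE negb_and -!ltnNge.
rewrite e cardsCs finset.setCK card_prod !card_ord card_normal_idx.
have [p' ->] : exists p', p = (p' + r)%N by exists (p - r)%N; rewrite subnK.
have [q' ->] : exists q', q = (q' + r)%N by exists (q - r)%N; rewrite subnK.
rewrite !addnK; nia.
Qed.

(** Positivity of d and of the normal dimension lets the p q operations of each matrix addition be
    charged to the leading term; the remaining cases get a program without operations. *)
Lemma reach_variant1 : (0 < d)%N -> (d <= p * q)%N -> (0 < (p - r) * (q - r))%N ->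
  reach (ents (fun x => newtonSLRA1 r (inM x) (inU x) (inS x) (inV x) (inEs x)))
    (40 * (p * q * d * (p - r) * (q - r) + p * q * r)) G.
Proof.
move=> d0 dpq m0; pose m := #|normal_idx p q r|.
have mE : m = ((p - r) * (q - r))%N := card_normal_idx.
rewrite -mE in m0.
have cG : @consts R I `<=` G by apply: subset_trans iG; exact: inputs_consts.
apply: (@reach_leq _ _ _ (4 * (p * q * r) + (p * q + (m * (p * q) + (19 * (p * q * m * d) + p * q))))).
  have -> : (p * q * d * (p - r) * (q - r) = p * q * d * m)%N by rewrite mE !mulnA.
  have h1 : (p * q <= p * q * d * m)%N by rewrite -mulnA leq_pmulr // muln_gt0 d0.
  have h2 : (m * (p * q) <= p * q * d * m)%N by rewrite mulnC leq_mul2r leq_pmulr ?orbT.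
  have h3 : (p * q * m * d = p * q * d * m)%N by rewrite mulnAC.
  rewrite h3; move: h1 h2; clear; lia.
have hM : ents inM `<=` G.
  by apply: subset_trans iG; apply: (inputs_mx (idx := fun i j => InM _ i j)) => x i j; rewrite mxE.
have hE l : ents (fun x => tnth (inEs x) l) `<=` G.
  apply: subset_trans iG; apply: (inputs_mx (idx := fun i j => InE l i j)) => x i j.
  by rewrite tnth_mktuple mxE.
new_fun Mt MtE (fun x : X => svd_trunc r (inU x) (inS x) (inV x)).
apply: (reach_trans (H' := ents Mt)); first by apply: reach_entries_eq MtE _; exact: reach_trunc.
new_fun B BE (fun x : X => Mt x - inM x).
apply: (reach_trans (H' := ents B)); first by apply: reach_entries_eq BE _; apply: reach_subm; avail.
apply: reach_trans.
  apply: reach_sub (reach_outer (fun k : 'I_m => enum_val k)).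
  by move=> f Gf; left; left.
new_fun W WE (fun x : X =>
    let A := \matrix_(k < m, l < d) frob (outer (inU x) (inV x) (enum_val k)) (tnth (inEs x) l) in
    let b := \col_(k < m) frob (outer (inU x) (inV x) (enum_val k)) (B x) in
    \sum_(l < d) (mp_pinv A *m b) l 0 *: tnth (inEs x) l).
apply: (reach_trans (H' := ents W)).
  apply: reach_entries_eq WE _.
  apply: (reach_least_squares (N := fun k x => outer (inU x) (inV x) (enum_val k))
     (T := fun l x => tnth (inEs x) l)) => //; try avail.
  - by move=> k f fk; right; exists k.
  - by move=> l; have hEl := hE l; avail.
apply: reach_entries_eq (reach_add (A := inM) (B := W) _ _); try avail.
by move=> x; rewrite /newtonSLRA1 WE /= BE MtE.
Qed.

(** The second variant followed by the orthogonal projection onto E, which restores the Newton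
    equations when E misses the tangent space. *)
Definition variant2_point (x : X) :=
  let X2 := newtonSLRA2 r (inM x) (inU x) (inS x) (inV x) (inFs x) in
  X2 - \sum_(k < p * q - d) frob (tnth (inFs x) k) (X2 - inM x) *: tnth (inFs x) k.

Lemma reach_variant2 : (0 < r)%N -> (d < p * q)%N ->
  reach (ents variant2_point) (40 * (p * q * r * (p * q - d) * (p + q - r))) G.
Proof.
move=> r0 dpq; pose t := #|tangent_idx p q r|; pose n := (p * q - d)%N.
have tE : t = ((p + q - r) * r)%N := card_tangent_idx.
have n0 : (0 < n)%N by rewrite subn_gt0.
have s0 : (0 < p + q - r)%N by rewrite subn_gt0; move: rp rq r0; lia.
have t0 : (0 < t)%N by rewrite tE muln_gt0 s0.
have tpq : (t <= p * q)%N by apply: leq_trans (max_card _) _; rewrite card_prod !card_ord.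
have rt : (r <= t)%N by rewrite tE leq_pmull.
have cG : @consts R I `<=` G by apply: subset_trans iG; exact: inputs_consts.
apply: (@reach_leq _ _ _ (4 * (p * q * r) + (p * q + (t * (p * q) + (19 * (p * q * n * t) + (p * q +
   (p * q + (n * 1 * (2 * (p * q)) + (p * q * (2 * n) + p * q))))))))).
  have -> : (p * q * r * (p * q - d) * (p + q - r) = p * q * n * t)%N by rewrite tE /n; lia.
  have h1 : (p * q <= p * q * n * t)%N by rewrite -mulnA leq_pmulr // muln_gt0 n0.
  have h2 : (t * (p * q) <= p * q * n * t)%N by rewrite mulnC leq_mul2r leq_pmulr ?orbT.
  have h3 : (p * q * n <= p * q * n * t)%N by rewrite leq_pmulr.
  have h4 : (p * q * r <= p * q * n * t)%N.
    by apply: leq_trans (_ : p * q * t <= _)%N; rewrite ?leq_mul2l ?rt ?orbT // leq_mul2r leq_pmulr ?orbT.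
  move: h1 h2 h3 h4; move: (p * q * n * t)%N (p * q * r)%N; clear; nia.
have hM : ents inM `<=` G.
  by apply: subset_trans iG; apply: (inputs_mx (idx := fun i j => InM _ i j)) => x i j; rewrite mxE.
have hF l : ents (fun x => tnth (inFs x) l) `<=` G.
  apply: subset_trans iG; apply: (inputs_mx (idx := fun i j => InF l i j)) => x i j.
  by rewrite tnth_mktuple mxE.
new_fun Mt MtE (fun x : X => svd_trunc r (inU x) (inS x) (inV x)).
apply: (reach_trans (H' := ents Mt)); first by apply: reach_entries_eq MtE _; exact: reach_trunc.
new_fun B BE (fun x : X => inM x - Mt x).
apply: (reach_trans (H' := ents B)); first by apply: reach_entries_eq BE _; apply: reach_subm; avail.
apply: reach_trans.
  apply: reach_sub (reach_outer (fun k : 'I_t => enum_val k)).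
  by move=> f Gf; left; left.
new_fun W WE (fun x : X =>
    let A := \matrix_(k < n, l < t) frob (tnth (inFs x) k) (outer (inU x) (inV x) (enum_val l)) in
    let b := \col_(k < n) frob (tnth (inFs x) k) (B x) in
    \sum_(l < t) (mp_pinv A *m b) l 0 *: outer (inU x) (inV x) (enum_val l)).
apply: (reach_trans (H' := ents W)).
  apply: reach_entries_eq WE _.
  apply: (reach_least_squares (N := fun k x => tnth (inFs x) k)
     (T := fun l x => outer (inU x) (inV x) (enum_val l))) => //; try avail.
  - by move=> l; have hFl := hF l; avail.
  - by move=> k f fk; right; exists k.
new_fun X2 X2E (fun x : X => Mt x + W x).
apply: (reach_trans (H' := ents X2)); first by apply: reach_entries_eq X2E _; apply: reach_add; avail.
new_fun X2M X2ME (fun x : X => X2 x - inM x).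
apply: (reach_trans (H' := ents X2M)); first by apply: reach_entries_eq X2ME _; apply: reach_subm; avail.
new_fun c cE (fun x : X => \col_(k < n) frob (tnth (inFs x) k) (X2M x) : 'cV[R]_n).
apply: (reach_trans (H' := ents c)).
  apply: reach_ents => k l; have hFk := hF k.
  apply: reach_ext (reach_frob (A := fun x => tnth (inFs x) k) (B := X2M) _ _ _); try avail.
  by congr [set _]; apply/funext => x; rewrite cE mxE.
new_fun f fE (fun x : X => \sum_(k < n) c x k 0 *: tnth (inFs x) k).
apply: (reach_trans (H' := ents f)).
  apply: reach_entries_eq fE _; apply: reach_comb; try avail.
  by move=> l; have hFl := hF l; avail.
apply: reach_entries_eq (reach_subm (A := X2) (B := f) _ _); try avail.
move=> x; have e : newtonSLRA2 r (inM x) (inU x) (inS x) (inV x) (inFs x) = X2 x.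
  by rewrite /newtonSLRA2 X2E WE /= BE MtE.
rewrite /variant2_point e fE; congr (_ - _); apply: eq_bigr => k _.
by rewrite cE mxE X2ME.
Qed.

End Variants.

(** * Assembly of the program and of phi *)

Section Assembly.
Variable R : realType.

Section Program.
Variables (p q r d : nat) (a : 'M[R]_(p, q)) (E0 : {vspace 'M[R]_(p, q)}).
Variables (M : 'M[R]_(p, q)) (U : 'M[R]_p) (S : 'M[R]_(p, q)) (V : 'M[R]_q).
Let E := affine_space a E0.
Let Mt := svd_trunc r U S V.
Hypotheses (EM : E M) (svd : is_svd M U S V) (rMt : \rank Mt = r).

Let rp : (r <= p)%N. Proof. by rewrite -rMt rank_leq_row. Qed.
Let rq : (r <= q)%N. Proof. by rewrite -rMt rank_leq_col. Qed.

Lemma newtonSLRA1_eqs (Es : d.-tuple 'M[R]_(p, q)) :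
  is_onb [set X | X \in E0] Es -> newton_eqs a E0 Mt M (newtonSLRA1 r M U S V Es).
Proof.
move=> hE; apply: (newton1_eqs (N := fun k => outer U V (enum_val k))) => // X.
exact: (trunc_nproj svd rp rq rMt).
Qed.

Let orth_outer (k l : 'I_#|tangent_idx p q r|) :
  frob (outer U V (enum_val k)) (outer U V (enum_val l)) = (k == l)%:R.
Proof.
have [_ UU VV _ _] := svd; rewrite outer_orth //.
by rewrite (inj_eq enum_val_inj).
Qed.

Lemma newtonSLRA2_eqs n (Fs : n.-tuple 'M[R]_(p, q)) : is_onb (orth_compl E0) Fs ->
  let X2 := newtonSLRA2 r M U S V Fs in
  newton_eqs a E0 Mt M (X2 - \sum_(k < n) frob (tnth Fs k) (X2 - M) *: tnth Fs k).
Proof.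
move=> hF; apply: (newton2_eqs (T := fun k => outer U V (enum_val k))) => //.
- by move=> X; exact: (trunc_tproj svd rp rq rMt).
- by move=> l; exact: (trunc_tangent svd rp rq rMt).
- exact: (trunc_normal svd rp rq rMt).
Qed.

Lemma newtonSLRA2_meet n (Fs : n.-tuple 'M[R]_(p, q)) Y : is_onb (orth_compl E0) Fs ->
  E Y -> nproj Mt (Y - Mt) = 0 -> newton_eqs a E0 Mt M (newtonSLRA2 r M U S V Fs).
Proof.
move=> hF EY Y0; have := newtonSLRA2_eqs hF => /=.
have -> : \sum_(k < n) frob (tnth Fs k) (newtonSLRA2 r M U S V Fs - M) *: tnth Fs k = 0.
  apply: (newton2_meet (T := fun k => outer U V (enum_val k)) _ _ hF EM EY Y0).
    by move=> X; exact: (trunc_tproj svd rp rq rMt).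
  by move=> l; exact: (trunc_tangent svd rp rq rMt).
by rewrite subr0.
Qed.

(** For r = 0 the tangent space at Mt = 0 is reduced to 0. This justifies the constant program, the
    only kind of answer allowed when the operation bound is 0. *)
Lemma newton_eqs_rank0 X : r = 0%N -> E 0 -> newton_eqs a E0 Mt M X -> X = 0.
Proof.
move=> r0 E00 hX; have Mt0 : Mt = 0 by apply/eqP; rewrite -mxrank_eq0 rMt r0.
have n0 Y : nproj (0 : 'M[R]_(p, q)) Y = Y.
  by rewrite /nproj /colproj /rowproj mul0mx mulmx0 !subr0 mul1mx mulmx1.
by have := newton_eqs_tangent hX E00; rewrite Mt0 !n0 !subr0; apply.
Qed.

Lemma newton_eqs_trivial X : \dim E0 = 0%N \/ ((p - r) * (q - r) = 0)%N ->
  newton_eqs a E0 Mt M X -> X = M.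
Proof.
move=> triv hX; case: triv => [dim0|card0].
  have [EX _ _] := hX; have := affine_subr EX EM.
  have /eqP -> : E0 == 0%VS by rewrite -dimv_eq0 dim0.
  by rewrite memv0 subr_eq0 => /eqP.
apply: (newton_eqs_uniq hX); have c0 : #|normal_idx p q r| = 0%N by rewrite card_normal_idx.
have n0 Y : nproj Mt Y = 0.
  by rewrite (trunc_nproj svd rp rq rMt) big1 // => k _; exfalso; case: k => k; rewrite c0.
split=> // e _; first by rewrite n0 frob0l.
by rewrite subrr frob0l.
Qed.

End Program.

(** The program depends on the dimensions only, so the choice between the two variants is made
    beforehand, by comparing the two bounds. *)
Lemma newton_program p q r d : exists2 P : actree (slra_input p q d) ('I_p * 'I_q),
  (op_count P <= 40 * slra_ops p q r d)%N &
  forall (a : 'M[R]_(p, q)) (E0 : {vspace 'M[R]_(p, q)}), \dim E0 = d ->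
  forall M U S V, affine_space a E0 M -> is_svd M U S V -> \rank (svd_trunc r U S V) = r ->
  (r = 0%N -> affine_space a E0 0) ->
  forall X, newton_eqs a E0 (svd_trunc r U S V) M X ->
  forall (Es : d.-tuple 'M[R]_(p, q)) (Fs : (p * q - d).-tuple 'M[R]_(p, q)),
  is_onb [set X | X \in E0] Es -> is_onb (orth_compl E0) Fs ->
  forall i j, run (slra_input_val M U S V Es Fs) P (i, j) = X i j.
Proof.
have [/and4P[r0 rp rq dpq]|bad] := boolP [&& (0 < r)%N, (r <= p)%N, (r <= q)%N & (d <= p * q)%N]; last first.
  (* The rank of the truncation and the dimension of E0 force the three upper bounds, so the failing
     condition can only be 0 < r, and then the Newton step returns 0. *)
  exists (Output (fun=> Cst _ 0)) => // a E0 dimE M U S V EM svd rk E00 X hX Es Fs _ _ i j /=.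
  have r0 : r = 0%N.
    apply: contraNeq bad; rewrite -lt0n => ->; rewrite -{1}rk rank_leq_row -{1}rk rank_leq_col /=.
    by have := dimvS (subvf E0); rewrite dimvf dimE /dim /= => ->.
  by rewrite (newton_eqs_rank0 rk r0 (E00 r0) hX) mxE /run /=.
have [/andP[d0 m0]|triv] := boolP ((0 < d)%N && (0 < (p - r) * (q - r))%N); last first.
  exists (Output (fun ij => Inp (InM _ ij.1 ij.2))) => //.
  move=> a E0 dimE M U S V EM svd rk E00 X hX Es Fs _ _ i j; rewrite /run /=.
  rewrite (newton_eqs_trivial EM svd rk _ hX) //.
  move: triv; rewrite negb_and !lt0n !negbK dimE => /orP[/eqP ->|/eqP ->]; [by left|by right].
have h1 := reach_variant1 rp rq (@subset_refl _ (@inputs R (slra_input p q d))) d0 dpq m0.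
have [P1 c1 hP1] := reach_program h1.
have P1ok : forall (a : 'M[R]_(p, q)) (E0 : {vspace 'M[R]_(p, q)}), \dim E0 = d ->
  forall M U S V, affine_space a E0 M -> is_svd M U S V -> \rank (svd_trunc r U S V) = r ->
  forall X, newton_eqs a E0 (svd_trunc r U S V) M X ->
  forall (Es : d.-tuple 'M[R]_(p, q)) (Fs : (p * q - d).-tuple 'M[R]_(p, q)),
  is_onb [set X | X \in E0] Es -> 
  forall i j, run (slra_input_val M U S V Es Fs) P1 (i, j) = X i j.
  move=> a E0 dimE M U S V EM svd rk X hX Es Fs hEs i j.
  rewrite hP1 inM_val inU_val inS_val inV_val inEs_val.
  by rewrite (newton_eqs_uniq hX (newtonSLRA1_eqs EM svd rk hEs)).
have [use1|/norP[dn c21]] := boolP ((d == p * q)%N || (p * q * d * (p - r) * (q - r) + p * q * r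
    <= p * q * r * (p * q - d) * (p + q - r))%N).
  exists P1; last by move=> a E0 dimE M U S V EM svd rk _ X hX Es Fs hEs _; exact: P1ok hX Es Fs hEs.
  apply: leq_trans c1 _; rewrite leq_mul2l /= /slra_ops.
  by case: eqP use1 => //= _ c12; rewrite leq_min leqnn.
have dlt : (d < p * q)%N by rewrite ltn_neqAle dn.
have h2 := reach_variant2 rp rq (@subset_refl _ (@inputs R (slra_input p q d))) r0 dlt.
have [P2 c2 hP2] := reach_program h2.
exists P2.
  apply: leq_trans c2 _; rewrite leq_mul2l /= /slra_ops (negbTE dn).
  by rewrite leq_min leqnn andbT; apply: ltnW; rewrite ltnNge.
move=> a E0 dimE M U S V EM svd rk _ X hX Es Fs _ hFs i j.
rewrite hP2 /variant2_point inM_val inU_val inS_val inV_val inFs_val.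
by rewrite (newton_eqs_uniq hX (newtonSLRA2_eqs EM svd rk hFs)).
Qed.

End Assembly.

Theorem mainTheorem1 (R : realType) :
  exists C : nat, forall p q r d : nat,
  exists P : actree (slra_input p q d) ('I_p * 'I_q),
  (op_count P <= C * slra_ops p q r d)%N /\
  forall (a : 'M[R]_(p, q)) (E0 : {vspace 'M[R]_(p, q)}), \dim E0 = d ->
  let E := affine_space a E0 in
  let D := @rank_manifold R p q r in
  exists (Omega : set 'M[R]_(p, q)) (phi : 'M[R]_(p, q) -> 'M[R]_(p, q)),
  [/\ open Omega,
      D `<=` Omega,
      (forall M, Omega M -> E (phi M)),
      (* phi is the function computed by the algorithm *)
      (forall M, Omega M -> exists Mt,
        [/\ is_proj D M Mt,
            (E `&` tangent_affine D Mt !=set0 ->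
               is_proj (E `&` tangent_affine D Mt) M (phi M))
          & E M -> forall U S V, is_svd M U S V ->
            [/\ svd_trunc r U S V = Mt,
                (forall Es : d.-tuple 'M[R]_(p, q),
                   is_onb [set X | X \in E0] Es ->
                   newtonSLRA1 r M U S V Es = phi M),
                (forall Fs : (p * q - d).-tuple 'M[R]_(p, q),
                   is_onb (orth_compl E0) Fs ->
                   E `&` tangent_affine D Mt !=set0 ->
                   newtonSLRA2 r M U S V Fs = phi M)
              & forall (Es : d.-tuple 'M[R]_(p, q))
                       (Fs : (p * q - d).-tuple 'M[R]_(p, q)),
                  is_onb [set X | X \in E0] Es -> is_onb (orth_compl E0) Fs ->
                  forall i j,
                    run (slra_input_val M U S V Es Fs) P (i, j) = phi M i j]])
    & (* local quadratic convergence *)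
      forall zeta, E zeta -> D zeta -> transversal_at E0 D zeta ->
      exists nu gamma gamma' : R,
      [/\ 0 < nu, 0 < gamma, 0 < gamma'
        & forall M0, E M0 -> fball zeta nu M0 ->
          let Ms := fun i : nat => iter i phi M0 in
          (forall i, Omega (Ms i) /\ newton_step_defined E D (Ms i)) /\
          exists Minf,
          [/\ (E `&` D) Minf,
              Ms @ \oo --> Minf,
              (forall i, fnorm (Ms i.+1 - Minf)
                           <= gamma * fnorm (Ms i - Minf) ^+ 2)
            & exists2 Z, is_proj (E `&` D) M0 Z &
                fnorm (Z - Minf) <= gamma' * fdist M0 (E `&` D) ^+ 2]]].
Proof.
exists 40 => p q r d; have [P Pcost Pok] := newton_program R p q r d.
exists P; split=> // a E0 dimE E D.
(* The pair consists of the projection of M on D and of the Newton iterate. Its second component is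
   kept in E even at bad points, where it defaults to a, so that a choice function has all its
   iterates in E. *)
pose step M (Y : 'M[R]_(p, q) * 'M[R]_(p, q)) := E Y.2 /\
  (rank_good r M -> [/\ is_proj D M Y.1, nproj Y.1 (M - Y.1) = M - Y.1,
     forall U S V, is_svd M U S V -> svd_trunc r U S V = Y.1 & newton_eqs a E0 Y.1 M Y.2]).
have step_ex M : exists Y, step M Y.
  have [[Mt [h1 h2 h3]]|bad] := pselect (rank_good r M).
    have [X hX] := newton_eqs_exists a E0 Mt M.
    by exists (Mt, X); split; [case: hX|].
  by exists (a, a); split=> //; rewrite /E /affine_space /= subrr mem0v.
have [f hf] := choice step_ex.
(* The second clause protects the constant program of the case r = 0, which is correct on points of
   E only if E contains 0. *)
pose good := [set M | rank_good r M /\ (r = 0%N -> E M -> E 0)].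
pose phi M := (f M).2; pose pi M := (f M).1.
have tanE x : D x -> forall Y, tangent_affine D x Y <-> nproj x (Y - x) = 0.
  by move=> Dx Y; exact: tangent_rank.
have good_nbhs : D `<=` good°.
  move=> x Dx; apply: filterI.
    by apply/nbhs_fball; exact: rank_good_near.
  (* In the case r = 0 with 0 outside E, the point x is 0 and E is closed, so a ball around x
     contains no point of E and the clause holds there vacuously. *)
  have [[r0 nE]|h] := pselect (r = 0%N /\ ~ E 0); last first.
    by apply: filterE => M r0 EM; apply: contrapT => nE; apply: h.
  have x0 : x = 0 by apply/eqP; rewrite -mxrank_eq0 Dx r0.
  apply/nbhs_fball; apply: contrapT => hE; apply: nE; apply: affine_closed => e e0.
  apply: contrapT => he; apply: hE; exists e => // M; rewrite /fball /= x0 => Me _ EM.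
  by exfalso; apply: he; exists M.
exists good°, phi; split.
- exact: open_interior.
- exact: good_nbhs.
- by move=> M _; case: (hf M).
- move=> M /interior_subset [gM E00]; have [_ /(_ gM) [proj normal trunc eqs]] := hf M.
  have DMt : D (pi M) by case: proj.
  exists (pi M); split=> //.
    by move=> ne; apply: (newton_eqs_proj (tanE _ DMt)).
  move=> EM U S V svd; have tE := trunc _ _ _ svd; rewrite -/(pi M) in tE.
  have rk : \rank (svd_trunc r U S V) = r by rewrite tE.
  have eqs' : newton_eqs a E0 (svd_trunc r U S V) M (phi M) by rewrite tE.
  split=> //.
  + move=> Es hEs; exact: newton_eqs_uniq (newtonSLRA1_eqs EM svd rk hEs) eqs'.
  + move=> Fs hFs [Y [EY /(tanE _ DMt) Y0]]; apply: newton_eqs_uniq eqs'.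
    by apply: (newtonSLRA2_meet EM svd rk hFs EY); rewrite tE.
  + move=> Es Fs hEs hFs i j; apply: (Pok a E0) => //.
    by move=> r0; apply: E00.
- move=> zeta Ez Dz tr.
  have [e e0 ball_good] : exists2 e : R, 0 < e & fball zeta e `<=` good°.
    by apply/nbhs_fball; apply: open_nbhs_nbhs; split; [exact: open_interior | exact: good_nbhs].
  have [K [rho [K1 rho0 hr hK]]] := rank_manifold_local Dz.
  have [kappa k1 hk] := transversal_normal_bound Dz tr.
  have [rho' rho'0 hk'] := normal_bound_near Dz rho0 K1 k1 hK hk.
  (* A single constant for pseudoinverses and transversality, on a ball where both bounds hold and
     which stays inside the domain of phi. *)
  pose K' := Num.max K (2 * kappa); pose rho2 := Num.min e (Num.min rho rho').
  have KK' : K <= K' by rewrite le_max lexx.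
  have kK' : 2 * kappa <= K' by rewrite le_max lexx orbT.
  have e2 : rho2 <= e by rewrite ge_min lexx.
  have r2 : rho2 <= rho by rewrite !ge_min lexx orbT.
  have r2' : rho2 <= rho' by rewrite !ge_min lexx !orbT.
  have rho20 : 0 < rho2 by rewrite !lt_min e0 rho0.
  have [] := @newton_quadratic R p q r a E0 zeta K' rho2 phi pi Ez Dz (le_trans K1 KK') rho20.
  + by move=> M Mz; apply: hr; exact: le_trans r2.
  + by move=> x Dx xz; apply: le_trans (hK x Dx (le_trans xz r2)) KK'.
  + move=> x Dx xz n nn; apply: le_trans (hk' x Dx (le_trans xz r2') n nn) _.
    by rewrite ler_wpM2r ?fnorm_ge0.
  + move=> M EM Mz; have /ball_good /interior_subset [gM _] : fball zeta e M.
      by rewrite /fball /= fnormB; exact: lt_le_trans e2.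
    have [_ /(_ gM) [[DM minM] normal trunc eqs]] := hf M; split=> // Y DY.
    by have [->|/eqP YM] := eqVneq Y (pi M); [|exact: ltW (minM Y DY YM)].
  move=> nu [gamma [gamma' [nu0 g0 g'0 conv]]]; exists nu, gamma, gamma'; split=> // M0 EM0.
  rewrite /fball /= fnormB => M0z; have [near lim] := conv M0 EM0 M0z.
  split=> // i; have [EMi Miz [w wE0 w0]] := near i.
  have Oi : good° (iter i phi M0).
    by apply: ball_good; rewrite /fball /= fnormB; apply: le_lt_trans Miz _; lra.
  split=> //; have [gM _] := interior_subset Oi.
  have [_ /(_ gM) [proj _ _ _]] := hf (iter i phi M0).
  exists (pi (iter i phi M0)) => //; exists (iter i phi M0 + w); split.
    exact: affine_addr.
  by apply/tanE; [case: proj|].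
Qed.
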